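(* Let $\mathfrak{g}=\mathfrak{g}_{\bar 0}\oplus\mathfrak{g}_{\bar 1}$ be a classical Lie superalgebra over $\mathbb{C}$ and let $\mathcal{F}$ be the category of finite dimensional $\mathfrak{g}$-supermodules which are finitely semisimple over $\mathfrak{g}_{\bar 0}$. Let $M\in\mathcal{F}$. Then $M$ is projective in $\mathcal{F}$ if and only if $M$ is injective in $\mathcal{F}$.
   Context: A finite dimensional Lie superalgebra $\mathfrak{g}=\mathfrak{g}_{\bar 0}\oplus\mathfrak{g}_{\bar 1}$ over $\mathbb{C}$ is called classical if there is a connected reductive algebraic group $G_{\bar 0}$ with $\operatorname{Lie}(G_{\bar 0})=\mathfrak{g}_{\bar 0}$ and an action of $G_{\bar 0}$ on $\mathfrak{g}_{\bar 1}$ which differentiates to the adjoint action of $\mathfrak{g}_{\bar 0}$ on $\mathfrak{g}_{\bar 1}$ (simplicity of $\mathfrak{g}$ is not required). A supermodule is finitely semisimple if it is a direct sum of finite dimensional simple supermodules. $\mathcal{F}$ is the full subcategory of $\mathfrak{g}$-supermodules whose objects are finite dimensional and finitely semisimple over $\mathfrak{g}_{\bar 0}$. Morphisms between supermodules are all (sums of even and odd) homomorphisms, where a homogeneous morphism $f$ is a homogeneous linear map with $f(xm)=(-1)^{\overline{f}\,\overline{x}}xf(m)$ for homogeneous $x$; here $\overline{v}\in\mathbb{Z}_2$ denotes the degree of $v$. Homological algebra is carried out using the underlying even category (same objects, only even morphisms), which is abelian, together with the parity change functor. *)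

(* Defs.v *)
(* R : realType is the field of real numbers (unique up to isomorphism) and
   R[i] is the field of complex numbers. *)
From HB Require Import structures.
From mathcomp Require Import all_boot all_order all_algebra.
From mathcomp Require Import classical_sets reals.
From mathcomp Require Import complex mpoly.

Set Implicit Arguments.
Unset Strict Implicit.
Unset Printing Implicit Defensive.

Import GRing.Theory.
Local Open Scope ring_scope.

(* Z/2 is bool: false is the even degree, true the odd one, addition is (+).
   Only used below over K = R[i]; some definitions would have to be amended in
   characteristic 2 or 3. *)
Record grading (K : fieldType) (V : vectType K) := Grading {
  gpart :> bool -> {vspace V};
  grading_sum : (gpart false + gpart true)%VS = fullv;
  grading_cap : (gpart false :&: gpart true)%VS = 0%VS
}.

(* The Koszul sign (-1)^(i j). *)
Definition ksign (K : fieldType) (i j : bool) : K := (-1) ^+ (i && j).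

Record lieSuperalgebra (K : fieldType) := LieSuperalgebra {
  lie_space :> vectType K;
  lie_gr : grading lie_space;
  lie_br : 'Hom(lie_space, 'End(lie_space));
  lie_br_deg : forall (i j : bool) (x y : lie_space),
    x \in lie_gr i -> y \in lie_gr j -> lie_br x y \in lie_gr (i (+) j);
  lie_br_anti : forall (i j : bool) (x y : lie_space),
    x \in lie_gr i -> y \in lie_gr j ->
    lie_br x y = - (ksign K i j *: lie_br y x);
  lie_br_jacobi : forall (i j : bool) (x y z : lie_space),
    x \in lie_gr i -> y \in lie_gr j ->
    lie_br x (lie_br y z) =
      lie_br (lie_br x y) z + ksign K i j *: lie_br y (lie_br x z)
}.

(* Finite dimensional supermodules: a vectType is finite dimensional. *)
Record supermodule (K : fieldType) (g : lieSuperalgebra K) := Supermodule {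
  mod_space :> vectType K;
  mod_gr : grading mod_space;
  mod_act : 'Hom(g, 'End(mod_space));
  mod_act_deg : forall (i j : bool) (x : g) (m : mod_space),
    x \in lie_gr g i -> m \in mod_gr j -> mod_act x m \in mod_gr (i (+) j);
  mod_act_br : forall (i j : bool) (x y : g) (m : mod_space),
    x \in lie_gr g i -> y \in lie_gr g j ->
    mod_act (lie_br g x y) m =
      mod_act x (mod_act y m) - ksign K i j *: mod_act y (mod_act x m)
}.

Definition homogeneous_morphism (K : fieldType) (g : lieSuperalgebra K)
    (M N : supermodule g) (d : bool) (f : 'Hom(M, N)) : Prop :=
  (forall (j : bool) (m : M), m \in mod_gr M j -> f m \in mod_gr N (d (+) j)) /\
  (forall (i : bool) (x : g) (m : M), x \in lie_gr g i ->
     f (mod_act M x m) = ksign K d i *: mod_act N x (f m)).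

Definition even_morphism (K : fieldType) (g : lieSuperalgebra K)
    (M N : supermodule g) (f : 'Hom(M, N)) : Prop :=
  homogeneous_morphism false f.

(* U is a sub-supermodule of the restriction of M to the even part of g. *)
Definition even_subsupermodule (K : fieldType) (g : lieSuperalgebra K)
    (M : supermodule g) (U : {vspace M}) : Prop :=
  (U :&: mod_gr M false + U :&: mod_gr M true)%VS = U /\
  (forall (x : g) (u : M), x \in lie_gr g false -> u \in U ->
     mod_act M x u \in U).

Definition even_simple (K : fieldType) (g : lieSuperalgebra K)
    (M : supermodule g) (U : {vspace M}) : Prop :=
  [/\ even_subsupermodule U,
      U <> 0%VS &
      forall W : {vspace M}, even_subsupermodule W -> (W <= U)%VS ->
        W = 0%VS \/ W = U].

(* Membership in F. A direct sum decomposition of a finite dimensional space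
   into simple summands has finitely many of them. *)
Definition in_F (K : fieldType) (g : lieSuperalgebra K)
    (M : supermodule g) : Prop :=
  exists (k : nat) (U : 'I_k -> {vspace M}),
    [/\ forall i, even_simple (U i),
        (\sum_(i < k) U i)%VS = fullv &
        directv (\sum_(i < k) U i)].

(* Epimorphisms, monomorphisms, projective and injective objects of the
   underlying even category of F, in the categorical sense. *)
Definition epi_F (K : fieldType) (g : lieSuperalgebra K)
    (A B : supermodule g) (e : 'Hom(A, B)) : Prop :=
  even_morphism e /\
  forall (N : supermodule g) (u v : 'Hom(B, N)),
    in_F N -> even_morphism u -> even_morphism v ->
    (u \o e)%VF = (v \o e)%VF -> u = v.

Definition mono_F (K : fieldType) (g : lieSuperalgebra K)
    (A B : supermodule g) (e : 'Hom(A, B)) : Prop :=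
  even_morphism e /\
  forall (N : supermodule g) (u v : 'Hom(N, A)),
    in_F N -> even_morphism u -> even_morphism v ->
    (e \o u)%VF = (e \o v)%VF -> u = v.

Definition projective_F (K : fieldType) (g : lieSuperalgebra K)
    (P : supermodule g) : Prop :=
  forall (A B : supermodule g) (e : 'Hom(A, B)) (f : 'Hom(P, B)),
    in_F A -> in_F B -> epi_F e -> even_morphism f ->
    exists h : 'Hom(P, A), even_morphism h /\ (e \o h)%VF = f.

Definition injective_F (K : fieldType) (g : lieSuperalgebra K)
    (I : supermodule g) : Prop :=
  forall (A B : supermodule g) (e : 'Hom(A, B)) (f : 'Hom(A, I)),
    in_F A -> in_F B -> mono_F e -> even_morphism f ->
    exists h : 'Hom(B, I), even_morphism h /\ (h \o e)%VF = f.

(* Affine algebraic groups over an algebraically closed field K of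
   characteristic 0, realised as Zariski closed subgroups of some GL_n(K).
   A polynomial function on matrices is a polynomial in their n * n entries,
   listed in the order of mxvec. *)
Definition mx_eval (K : fieldType) (n : nat) (p : {mpoly K[n * n]})
    (A : 'M[K]_n) : K := p.@[fun k => mxvec A 0 k].

Definition mx_dir_deriv (K : fieldType) (n : nat) (p : {mpoly K[n * n]})
    (A X : 'M[K]_n) : K :=
  \sum_(k < n * n) (p^`M(k)).@[fun l => mxvec A 0 l] * mxvec X 0 k.

(* Closed subsets of GL_n: the powers of 1/det occurring in regular functions
   on GL_n do not affect their zero sets. *)
Definition zariski_closed (K : fieldType) (n : nat) (Z : set 'M[K]_n) : Prop :=
  exists S : set {mpoly K[n * n]}, forall A : 'M[K]_n,
    Z A <-> (A \in unitmx /\ forall p, S p -> mx_eval p A = 0).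

Definition algebraic_group (K : fieldType) (n : nat) (G : set 'M[K]_n) : Prop :=
  [/\ zariski_closed G,
      G 1%:M,
      forall A B, G A -> G B -> G (A *m B) &
      forall A, G A -> G (invmx A)].

Definition zariski_connected (K : fieldType) (n : nat)
    (G : set 'M[K]_n) : Prop :=
  forall Z1 Z2 : set 'M[K]_n,
    zariski_closed Z1 -> zariski_closed Z2 ->
    (forall A, G A -> Z1 A \/ Z2 A) ->
    (forall A, G A -> ~ (Z1 A /\ Z2 A)) ->
    (forall A, G A -> Z1 A) \/ (forall A, G A -> Z2 A).

Definition unipotent_group (K : fieldType) (n : nat)
    (H : set 'M[K]_n) : Prop :=
  forall A, H A -> exists k : nat, (A - 1%:M) ^+ k = 0.

(* The unipotent radical, i.e. the largest connected normal unipotent closed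
   subgroup, is trivial. *)
Definition reductive_group (K : fieldType) (n : nat)
    (G : set 'M[K]_n) : Prop :=
  forall H : set 'M[K]_n,
    algebraic_group H -> zariski_connected H -> unipotent_group H ->
    (forall A, H A -> G A) ->
    (forall A B, G A -> H B -> H (A *m B *m invmx A)) ->
    forall A, H A -> A = 1%:M.

(* Lie(G): the tangent space of G at the identity matrix. *)
Definition lie_of_group (K : fieldType) (n : nat)
    (G : set 'M[K]_n) : set 'M[K]_n :=
  fun X => forall p : {mpoly K[n * n]},
    (forall A, G A -> mx_eval p A = 0) -> mx_dir_deriv p 1%:M X = 0.

(* On G, the function f is the restriction of the regular function p / det^k
   on GL_n. *)
Definition represents (K : fieldType) (n : nat) (G : set 'M[K]_n)
    (p : {mpoly K[n * n]}) (k : nat) (f : 'M[K]_n -> K) : Prop :=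
  forall A, G A -> f A = mx_eval p A / (\det A) ^+ k.

(* c is the derivative of the regular function f on G at the identity along X.
   The differential of det at the identity is the trace, so p / det^k has
   derivative dp(X) - k p(1) tr X there; for X in Lie(G) this only depends on
   the restriction of p / det^k to G. *)
Definition has_derivative_at1 (K : fieldType) (n : nat) (G : set 'M[K]_n)
    (f : 'M[K]_n -> K) (X : 'M[K]_n) (c : K) : Prop :=
  exists (p : {mpoly K[n * n]}) (k : nat),
    represents G p k f /\
    c = mx_dir_deriv p 1%:M X - k%:R * mx_eval p 1%:M * \tr X.

(* rho is a morphism of algebraic groups from G to GL(V); its values outside G
   are irrelevant. *)
Definition rational_rep (K : fieldType) (n : nat) (G : set 'M[K]_n)
    (V : vectType K) (rho : 'M[K]_n -> 'End(V)) : Prop :=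
  [/\ rho 1%:M = \1%VF,
      forall A B, G A -> G B -> rho (A *m B) = (rho A \o rho B)%VF &
      forall (l : 'Hom(V, K^o)) (v : V),
        exists (p : {mpoly K[n * n]}) (k : nat),
          represents G p k (fun A => l (rho A v))].

(* phi restricts to a Lie algebra isomorphism from the even part of g onto
   Lie(G); its values on the odd part are irrelevant. *)
Definition lie_identification (K : fieldType) (g : lieSuperalgebra K) (n : nat)
    (G : set 'M[K]_n) (phi : 'Hom(g, 'M[K]_n)) : Prop :=
  [/\ forall x, x \in lie_gr g false -> lie_of_group G (phi x),
      forall X, lie_of_group G X ->
        exists2 x, x \in lie_gr g false & phi x = X,
      forall x, x \in lie_gr g false -> phi x = 0 -> x = 0 &
      forall x y, x \in lie_gr g false -> y \in lie_gr g false ->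
        phi (lie_br g x y) = phi x *m phi y - phi y *m phi x].

(* Under phi, the differential of rho is the adjoint action of the even part of
   g on the odd part; derivatives are tested on matrix coefficients. *)
Definition differentiates_to_adjoint (K : fieldType) (g : lieSuperalgebra K)
    (n : nat) (G : set 'M[K]_n) (phi : 'Hom(g, 'M[K]_n))
    (rho : 'M[K]_n -> 'End(subvs_of (lie_gr g true))) : Prop :=
  forall (x : g) (v : subvs_of (lie_gr g true)) (l : 'Hom(g, K^o)),
    x \in lie_gr g false ->
    has_derivative_at1 G (fun A => l (vsval (rho A v))) (phi x)
      (l (lie_br g x (vsval v))).

Definition classical (K : fieldType) (g : lieSuperalgebra K) : Prop :=
  exists (n : nat) (G : set 'M[K]_n),
    [/\ algebraic_group G, zariski_connected G, reductive_group G &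
        exists (phi : 'Hom(g, 'M[K]_n))
               (rho : 'M[K]_n -> 'End(subvs_of (lie_gr g true))),
          [/\ lie_identification G phi,
              rational_rep G rho &
              differentiates_to_adjoint G phi rho]].

(* Main.v *)
From HB Require Import structures.
Require Import Defs.
From mathcomp Require Import all_boot all_order all_algebra.
From mathcomp Require Import boolp reals complex ring.

(* F is a rigid monoidal category, and this makes projective and injective
   objects coincide.  Given a monomorphism e : A -> B and f : A -> P with P
   projective, lift v |-> (phi |-> str(f phi) v) from P to Hom(Hom(P,A),P)
   along Hom(Hom(P,B),P) -> Hom(Hom(P,A),P); contracting the lift, an element of
   P^* (x) P (x) P (x) B^*, crosswise with the Koszul signs gives the extension
   of f to B.  The converse contracts in the same way an extension of the
   evaluation at f from Hom(Hom(P,B),P) to Hom(Hom(P,A),P).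

   That F is closed under Hom is Chevalley's theorem: for finite dimensional
   semisimple modules V, W over a Lie algebra in characteristic 0, Hom(V,W) is
   semisimple.  One may take V and W irreducible; removing the traces, which act
   on Hom(V,W) by scalars, the image S of the Lie algebra in End(V x W) has no
   center, so by Cartan's criterion the trace form is nondegenerate on every
   ideal of S, and the Casimir argument shows that all modules over S are
   semisimple. *)

Set Implicit Arguments.
Unset Strict Implicit.
Unset Printing Implicit Defensive.
Import GRing.Theory Num.Theory VectorInternalTheory passmx.
Local Open Scope ring_scope.


(** The supertrace pairing identifies Hom(P,A)^* with Hom(A,P) and turns phi |-> str(f phi) back
    into f, so the map to be lifted is f tensored with the identity of P. Once it is lifted, the
    extra factor has to be removed. Contracting the argument of the lift against its value would
    multiply f by the superdimension of P, which may vanish. The argument is instead contracted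
    against the factor P coming from the dual of Hom(P,B), and nothing has to be divided out.

    Cartan's criterion tests nilpotency of A against the complex conjugate B of its semisimple part,
    for then tr(A B) is a sum of squared moduli. This is where the conjugation of the base field
    enters.

    Quotients are modelled on linear complements with their projections, and gradings by the
    involution v |-> (-1)^|v| v, so that conditions on parity become equations between linear
    maps. *)

(** * Polynomial congruences at several points *)

Lemma coprimep_prod_XsubC_exp (K : fieldType) (s : seq K) (a : K) n :
  a \notin s ->
  coprimep (('X - a%:P) ^+ n) (\prod_(b <- s) ('X - b%:P) ^+ n).
Proof.
move=> aNs; rewrite big_seq; elim/big_rec: _ => [|b p bs cop]; first exact: coprimep1.
rewrite coprimepMr cop andbT coprimep_expl // coprimep_expr //.
by rewrite coprimep_XsubC2 // subr_eq0; apply: contraNneq aNs => <-.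
Qed.

(** Chinese remainders with constant residues: one point is added at a time, using a Bezout relation
    between the new power and the product of the old ones. *)
Lemma poly_interpolation_mod (K : fieldType) (s : seq K) (c : K -> K) n :
  uniq s -> exists r : {poly K},
    {in s, forall a, ('X - a%:P) ^+ n %| r - (c a)%:P}.
Proof.
elim: s => [|a s IHs] /=; first by exists 0.
case/andP=> aNs /IHs[r rP].
have /Bezout_eq1_coprimepP[[u v] /= uv1] := coprimep_prod_XsubC_exp n aNs.
set p := ('X - a%:P) ^+ n in uv1; set q := \prod_(b <- s) _ in uv1.
exists (u * p * r + v * q * (c a)%:P) => b; rewrite inE => /predU1P[->|bs].
  have -> : u * p * r + v * q * (c a)%:P - (c a)%:P = p * (u * (r - (c a)%:P)).
    have -> : v * q = 1 - u * p by rewrite -uv1; ring.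
    by ring.
  exact: dvdp_mulr.
have -> : u * p * r + v * q * (c a)%:P - (c b)%:P =
   (r - (c b)%:P) + q * (v * ((c a)%:P - r)).
  have -> : u * p = 1 - v * q by rewrite -uv1; ring.
  by ring.
rewrite dvdp_add ?rP // dvdp_mulr //.
by rewrite /q (big_rem b) //= dvdp_mulr.
Qed.

(** Evaluated at a matrix annihilated by [p], the [e a] become the projections onto its generalized
    eigenspaces; no Jordan basis is needed. *)
Lemma poly_unity_decomposition (K : fieldType) (s : seq K) n :
  uniq s -> exists e : K -> {poly K},
    let p := \prod_(a <- s) ('X - a%:P) ^+ n in
    p %| \sum_(a <- s) e a - 1 /\
    {in s, forall a, p %| ('X - a%:P) ^+ n * e a}.
Proof.
elim: s => [|a s IHs] /=; first by exists (fun=> 0); split=> //; rewrite big_nil dvd1p.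
case/andP=> aNs /IHs[e [eS eP]].
have /Bezout_eq1_coprimepP[[u v] /= uv1] := coprimep_prod_XsubC_exp n aNs.
set q := \prod_(b <- s) _ in uv1 eS eP.
exists (fun b => if b == a then v * q else u * ('X - a%:P) ^+ n * e b).
rewrite !big_cons eqxx -/q; split.
  rewrite (eq_big_seq (fun b => u * ('X - a%:P) ^+ n * e b)); last first.
    by move=> b bs; case: eqP => // ba; rewrite -ba bs in aNs.
  rewrite -mulr_sumr; set S := \sum_(b <- s) _.
  have -> : v * q + u * ('X - a%:P) ^+ n * S - 1 = u * (('X - a%:P) ^+ n * (S - 1)).
    by rewrite -[in X in v * q + _ - X]uv1; ring.
  by rewrite dvdp_mull // dvdp_mul.
move=> b; rewrite inE; case: eqP => [->|_] /= => [_|bs].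
  by rewrite mulrCA dvdp_mull.
have -> : ('X - b%:P) ^+ n * (u * ('X - a%:P) ^+ n * e b) =
  u * (('X - a%:P) ^+ n * (('X - b%:P) ^+ n * e b)) by ring.
by rewrite dvdp_mull // dvdp_mul // eP.
Qed.

Lemma lin_comb_closed_scale (K : pzRingType) (U : lmodType K) (N : U -> Prop) :
  N 0 -> (forall a u v, N u -> N v -> N (a *: u + v)) ->
  forall a u, N u -> N (a *: u).
Proof. by move=> N0 NP a u Nu; rewrite -[_ *: u]addr0; apply: NP. Qed.

Lemma subrACA (V : zmodType) (x y z t : V) : x - y - (z - t) = x - z - (y - t).
Proof. by rewrite opprD addrACA -opprD. Qed.

(** * The conjugate of the semisimple part of a matrix *)

Section JordanConjugate.
Variables (C : numClosedFieldType) (n : nat).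
Implicit Types (A w : 'M[C]_n.+1) (p q : {poly C}).

Let ad A w := A * w - w * A.

Lemma trig_mul_diag A w : is_trig_mx A -> is_trig_mx w ->
  is_trig_mx (A * w) /\ forall i, (A * w) i i = A i i * w i i.
Proof.
move=> /is_trig_mxP tA /is_trig_mxP tw; split.
  apply/is_trig_mxP => i j ij; rewrite mxE big1 // => k _.
  have [ik|ki] := ltnP i k; first by rewrite tA ?mul0r.
  by rewrite tw ?mulr0 // (leq_ltn_trans ki).
move=> i; rewrite mxE (bigD1 i) //= big1 ?addr0 // => k.
rewrite neq_ltn => /orP[ki|ik]; last by rewrite tA ?mul0r.
by rewrite tw ?mulr0.
Qed.

Lemma trig_horner A p : is_trig_mx A ->
  is_trig_mx (horner_mx A p) /\ forall i, (horner_mx A p) i i = p.[A i i].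
Proof.
move=> tA; elim/poly_ind: p => [|p c [tp dp]].
  by rewrite rmorph0; split=> [|i]; rewrite ?mx0_is_trig // mxE horner0.
rewrite rmorphD rmorphM /= horner_mx_X horner_mx_C.
have [tpA dpA] := trig_mul_diag tp tA; split=> [|i].
  apply/is_trig_mxP => i j ij; move/is_trig_mxP: tpA => /(_ i j ij) tpA.
  by rewrite mxE tpA mxE -val_eqE ltn_eqF // addr0.
by rewrite mxE dpA dp mxE eqxx hornerMXaddC.
Qed.

(** The value of [p] at the operator [ad A], written as a sum because [ad A] is a bare function here
    and not an element of a ring. *)
Definition ad_horner A p w := \sum_(i < size p) p`_i *: iter i (ad A) w.

Lemma ad_hornerE A p w m : (size p <= m)%N ->
  ad_horner A p w = \sum_(i < m) p`_i *: iter i (ad A) w.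
Proof.
move=> le_pm; rewrite /ad_horner (big_ord_widen m (fun i => p`_i *: iter i (ad A) w)) //.
rewrite big_mkcond; apply: eq_bigr => i _; case: ltnP => // le_pi.
by rewrite nth_default // scale0r.
Qed.

Lemma adZ A c w : ad A (c *: w) = c *: ad A w.
Proof. by rewrite /ad -scalerAr -scalerAl scalerBr. Qed.
Lemma adD A w1 w2 : ad A (w1 + w2) = ad A w1 + ad A w2.
Proof. by rewrite /ad mulrDr mulrDl opprD addrACA. Qed.
Lemma adB A w1 w2 : ad A (w1 - w2) = ad A w1 - ad A w2.
Proof. by rewrite -scaleN1r adD adZ scaleN1r. Qed.
Lemma ad0 A : ad A 0 = 0.
Proof. by rewrite /ad mulr0 mul0r subrr. Qed.

Lemma ad_hornerD A p q w : ad_horner A (p + q) w = ad_horner A p w + ad_horner A q w.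
Proof.
pose m := maxn (size p) (size q).
rewrite !(@ad_hornerE _ _ _ m) ?leq_maxl ?leq_maxr ?(leq_trans (size_polyD _ _)) //.
by rewrite -big_split; apply: eq_bigr => i _; rewrite coefD scalerDl.
Qed.

Lemma ad_hornerC A c w : ad_horner A c%:P w = c *: w.
Proof. by rewrite (@ad_hornerE _ _ _ 1) ?size_polyC ?leq_b1 // big_ord1 coefC. Qed.

Lemma ad_hornerMX A p w : ad_horner A (p * 'X) w = ad_horner A p (ad A w).
Proof.
rewrite (@ad_hornerE _ _ _ (size p).+1) ?big_ord_recl; last first.
  by rewrite (leq_trans (size_polyMleq _ _)) // size_polyX addn2.
rewrite coefMX eqxx scale0r add0r; apply: eq_bigr => i _.
by rewrite coefMX lift0 /= -iterSr.
Qed.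

Lemma ad_hornerZ A c p w : ad_horner A (c *: p) w = c *: ad_horner A p w.
Proof.
rewrite (@ad_hornerE _ _ _ (size p)) ?size_scale_leq // scaler_sumr.
by apply: eq_bigr => i _; rewrite coefZ scalerA.
Qed.

Lemma ad_horner_is_linear A p : linear (ad_horner A p).
Proof.
move=> c u v; rewrite /ad_horner scaler_sumr -big_split; apply: eq_bigr => i _ /=.
rewrite scalerA mulrC -scalerA -scalerDr; congr (_ *: _).
by elim: (val i) => //= k ->; rewrite adD adZ.
Qed.

Lemma ad_horner_exp A p nu m w : iter m (fun v => ad A v - nu *: v) w = 0 ->
  ad_horner A (p * ('X - nu%:P) ^+ m) w = 0.
Proof.
elim: m w => [|m IHm] w.
  by move=> /= ->; have := ad_horner_is_linear A (p * ('X - nu%:P) ^+ 0) (-1) 0 0;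
     rewrite scaler0 addr0 scaleN1r addNr.
rewrite iterSr => /IHm {}IHm; rewrite exprSr mulrA; set q := p * _ in IHm *.
have -> : q * ('X - nu%:P) = q * 'X + (- nu) *: q.
  by rewrite mulrBr scaleNr [q * nu%:P]mulrC mul_polyC.
by rewrite ad_hornerD ad_hornerMX ad_hornerZ addrC -ad_horner_is_linear addrC scaleNr.
Qed.

(** The operator ad A - (a - b) is left multiplication by A - a minus right multiplication by A - b.
    The two commute and are nilpotent on such [w]; each step of the induction lowers [k] or [l]. *)
Lemma ad_shift_nilpotent A (a b : C) k l w :
  (A - a%:M) ^+ k * w = 0 -> w * (A - b%:M) ^+ l = 0 ->
  iter (k + l) (fun v => ad A v - (a - b) *: v) w = 0.
Proof.
have [m] := ubnP (k + l); elim: m => // m IHm in k l w *.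
have D0 j : iter j (fun v => ad A v - (a - b) *: v) 0 = 0.
  by elim: j => //= j ->; rewrite ad0 scaler0 subrr.
case: k => [|k]; first by rewrite expr0 mul1r => _ -> _; apply: D0.
case: l => [|l]; first by rewrite expr0 mulr1 => _ _ ->; apply: D0.
rewrite addSn addnS ltnS => klm h1 h2; rewrite iterSr.
pose D v := ad A v - (a - b) *: v.
have DB u v : D (u - v) = D u - D v.
  by rewrite /D adB scalerBr subrACA.
have -> : ad A w - (a - b) *: w = (A - a%:M) * w - w * (A - b%:M).
  by rewrite mulrBl mulrBr -!mulmxE mul_scalar_mx mul_mx_scalar scalerBl subrACA.
have -> : iter (k + l).+1 D ((A - a%:M) * w - w * (A - b%:M)) =
   iter (k + l).+1 D ((A - a%:M) * w) - iter (k + l).+1 D (w * (A - b%:M)).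
  by elim: (k + l).+1 => //= j ->; rewrite DB.
rewrite -{1}addnS -addSn; rewrite !IHm ?subrr // ?addSn ?addnS //.
- by rewrite mulrA h1 mul0r.
- by rewrite -mulrA -exprS.
- by rewrite mulrA -exprSr.
- by rewrite -mulrA h2 mulr0.
Qed.
Lemma horner_mx_eigen A (c a : C) r k w :
  ('X - a%:P) ^+ k %| r - c%:P -> (A - a%:M) ^+ k * w = 0 ->
  horner_mx A r * w = c *: w.
Proof.
case/dvdpP=> h /eqP; rewrite subr_eq => /eqP-> Aw.
rewrite rmorphD rmorphM rmorphXn rmorphB /= horner_mx_X !horner_mx_C.
by rewrite mulrDl -mulrA Aw mulr0 add0r -mulmxE mul_scalar_mx.
Qed.

Lemma horner_mx_eigenr A (c a : C) r k w :
  ('X - a%:P) ^+ k %| r - c%:P -> w * (A - a%:M) ^+ k = 0 ->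
  w * horner_mx A r = c *: w.
Proof.
case/dvdpP=> h /eqP; rewrite mulrC subr_eq => /eqP-> Aw.
rewrite rmorphD rmorphM rmorphXn rmorphB /= horner_mx_X !horner_mx_C.
by rewrite mulrDr mulrA Aw mul0r add0r -mulmxE mul_mx_scalar.
Qed.

Lemma ad_horner_eigen A (c a : C) q k w :
  ('X - a%:P) ^+ k %| q - c%:P -> iter k (fun v => ad A v - a *: v) w = 0 ->
  ad_horner A q w = c *: w.
Proof.
case/dvdpP=> h /eqP; rewrite subr_eq => /eqP-> Aw.
by rewrite ad_hornerD ad_hornerC ad_horner_exp // add0r.
Qed.

(* B is the complex conjugate of the semisimple part of A. *)
Theorem jordan_conjugate_mx A : exists B : 'M[C]_n.+1,
  (\tr (A * B) = 0 -> A ^+ n.+1 = 0) /\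
  forall N : 'M[C]_n.+1 -> Prop, N 0 ->
    (forall a u v, N u -> N v -> N (a *: u + v)) ->
    (forall w, N w -> N (A * w - w * A)) ->
    forall s, N (A * s - s * A) -> N (B * s - s * B).
Proof.
have [P uP] := Schur A (ltn0Sn n); set T := conjmx P A => tT.
have {}uP : P \in unitmx by apply: unitarymx_unit.
have conjM X Y : conjmx P (X * Y) = conjmx P X * conjmx P Y.
  by rewrite !conjumx // -!mulmxE !mulmxA mulmxKV.
have conj_inj X : conjmx P X = 0 -> X = 0.
  by move=> X0; rewrite -[X](conjmxK _ uP) X0 conjmx0.
have conj_horner p : horner_mx T p = conjmx P (horner_mx A p).
  by rewrite horner_mx_conj // ?row_free_unit // stablemx_unit.
have tr_conj X : \tr (conjmx P X) = \tr X.
  by rewrite conjumx // mxtrace_mulC mulKmx.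
pose evs := undup [seq T i i | i : 'I_n.+1].
have evsT i : T i i \in evs by rewrite mem_undup; apply/imageP; exists i.
have [r rP] := poly_interpolation_mod (fun a => a^*) n.+1 (undup_uniq _ : uniq evs).
pose dif := undup [seq a - b | a <- evs, b <- evs].
(* The eigenvalues of ad A are the differences of eigenvalues of A, with exponents bounded as in
   [ad_shift_nilpotent]. Since conjugation is additive, [q] evaluated at ad A will be ad B. *)
have [q qP] := poly_interpolation_mod (fun a => a^*) (n.+1 + n.+1) (undup_uniq _ : uniq dif).
have [e []] := poly_unity_decomposition n.+1 (undup_uniq _ : uniq evs).
set G := \prod_(a <- _) _ => e1 eP.
have GA0 p : G %| p -> horner_mx A p = 0.
  case/dvdpP=> h ->; rewrite rmorphM /=.
  suff -> : horner_mx A G = 0 by rewrite mulr0.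
  apply: conj_inj; rewrite -conj_horner.
  (* [G] consists of one copy of the product of all X - a for each diagonal entry of [T], and the
     i-th copy is divisible by X - T i i. *)
  have [g ->] : exists g, G = g * char_poly T; last by rewrite rmorphM /= Cayley_Hamilton mulr0.
  apply/dvdpP.
  rewrite char_poly_trig // /G prodrXl -[X in _ ^+ X](card_ord n.+1) -prodr_const.
  elim/big_ind2: _ => // [p1 p2 p3 p4|i _]; first exact: dvdp_mul.
  by rewrite (big_rem (T i i)) ?evsT //= dvdp_mulr.
exists (horner_mx A r); split=> [|N N0 NP NA s Ns].
  rewrite -tr_conj conjM -conj_horner => trT0.
  have [_ dT] := trig_horner r tT.
  have [_ dTr] := trig_mul_diag tT (proj1 (trig_horner r tT)).
  have T0 i : T i i = 0.
    apply/eqP; rewrite -normr_eq0 -sqrf_eq0 normCK.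
    move/eqP: trT0; rewrite /mxtrace psumr_eq0 => [/allP/(_ i)|j _].
      rewrite mem_index_enum implyTb dTr dT => /(_ isT).
      have := rP _ (evsT i); rewrite exprS => /(dvdp_trans (dvdp_mulr _ (dvdpp _))).
      by rewrite dvdp_XsubCl rootE !hornerE subr_eq0 => /eqP->.
    rewrite dTr dT.
    have := rP _ (evsT j); rewrite exprS => /(dvdp_trans (dvdp_mulr _ (dvdpp _))).
    by rewrite dvdp_XsubCl rootE !hornerE subr_eq0 => /eqP->; rewrite mul_conjC_ge0.
  apply: conj_inj.
  have -> : A ^+ n.+1 = horner_mx A 'X^(n.+1) by rewrite rmorphXn /= horner_mx_X.
  rewrite -conj_horner; have := Cayley_Hamilton T; rewrite char_poly_trig //.
  under eq_bigr do rewrite T0 subr0.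
  by rewrite prodr_const card_ord.
(* 0 is a difference of eigenvalues and is its own conjugate, so [q] has no constant term. Hence ad
   B s is a combination of iterates of ad A applied to ad A s, which lies in [N]. *)
have q0 : q = (q %/ 'X) * 'X.
  have /qP : T ord0 ord0 - T ord0 ord0 \in dif.
    by rewrite mem_undup; apply/allpairsP; exists (T ord0 ord0, T ord0 ord0); split=> //=; exact: evsT.
  rewrite subrr conjC0 subr0 addSn exprS subr0.
  by move=> /(dvdp_trans (dvdp_mulr _ (dvdpp _))) /divpK ->.
suff -> : horner_mx A r * s - s * horner_mx A r = ad_horner A q s.
  rewrite q0 ad_hornerMX /ad_horner; elim/big_ind: _ => //.
  - by move=> u v Nu Nv; rewrite -[u]scale1r; apply: NP.
  - move=> i _; apply: lin_comb_closed_scale => //.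
    by elim: (val i) => //= k; apply: NA.
pose E a := horner_mx A (e a).
have E1 : \sum_(a <- evs) E a = 1.
  by have /eqP := GA0 _ e1; rewrite rmorphB rmorph1 rmorph_sum subr_eq0 => /eqP.
(* On the block [E a * s * E b] both sides are multiplication by the conjugate of a - b. *)
have -> : s = \sum_(a <- evs) \sum_(b <- evs) E a * s * E b.
  under eq_bigr do rewrite -mulr_sumr E1 mulr1.
  by rewrite -mulr_suml E1 mul1r.
have Dlin (I : Type) (t : seq I) (F : I -> _) (Q : pred I) :
    ad_horner A q (\sum_(i <- t | Q i) F i) = \sum_(i <- t | Q i) ad_horner A q (F i).
  elim/big_rec2: _ => [|i y1 y2 _ <-].
    by have := ad_horner_is_linear A q (-1) 0 0; rewrite scaler0 addr0 scaleN1r addNr.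
  by rewrite -[F i]scale1r ad_horner_is_linear !scale1r.
rewrite Dlin mulr_sumr mulr_suml -sumrB; apply: eq_big_seq => a aev.
rewrite Dlin mulr_sumr mulr_suml -sumrB; apply: eq_big_seq => b bev.
have Ea : (A - a%:M) ^+ n.+1 * E a = 0.
  by have := GA0 _ (eP a aev); rewrite rmorphM rmorphXn rmorphB /= horner_mx_X horner_mx_C.
have Eb : E b * (A - b%:M) ^+ n.+1 = 0.
  by have := GA0 _ (eP b bev); rewrite mulrC rmorphM rmorphXn rmorphB /= horner_mx_X horner_mx_C.
have Ew : (A - a%:M) ^+ n.+1 * (E a * s * E b) = 0 by rewrite !mulrA Ea !mul0r.
have wE : E a * s * E b * (A - b%:M) ^+ n.+1 = 0 by rewrite -!mulrA Eb !mulr0.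
rewrite (horner_mx_eigen (rP a aev) Ew) (horner_mx_eigenr (rP b bev) wE).
have ab : a - b \in dif by rewrite mem_undup; apply/allpairsP; exists (a, b).
by rewrite (ad_horner_eigen (qP _ ab) (ad_shift_nilpotent Ew wE)) rmorphB scalerBl.
Qed.
End JordanConjugate.

(* Proves an identity in a vectType that follows from linearity, by comparing
   coordinates. *)
Ltac vring :=
  apply: v2r_inj; apply/rowP => ?;
  rewrite ?(opprK, opprB, opprD, linearD, linearN, linearB, linearZ, linear0) /= ?mxE; ring.

Ltac lfun_expand :=
  do ?rewrite (comp_lfunE, add_lfunE, opp_lfunE, scale_lfunE, zero_lfunE, id_lfunE) /=;
  rewrite ?(opprK, opprB, opprD, linearD, linearN, linearB, linearZ, linear0) /=.

(** * Traces and commutators of linear maps *)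

Section LinearMapTrace.
Variable K : fieldType.

(** Matrices act on row vectors, so composition becomes the product in the opposite order. *)
Definition lfun_mx (U V : vectType K) : 'Hom(U, V) -> 'M[K]_(\dim {:U}, \dim {:V}) :=
  mxof (vbasis {:U}) (vbasis {:V}).

Definition ltrace (V : vectType K) (f : 'End(V)) : K := \tr (lfun_mx f).

Lemma lfun_mx_comp (U V W : vectType K) (f : 'Hom(V, W)) (g : 'Hom(U, V)) :
  lfun_mx (f \o g)%VF = lfun_mx g *m lfun_mx f.
Proof. by apply: mxof_comp; apply: vbasisP. Qed.

Lemma lfun_mxK (U V : vectType K) :
  cancel (@lfun_mx U V) (hommx (vbasis {:U}) (vbasis {:V})).
Proof. by apply: mxofK; apply: vbasisP. Qed.

Lemma lfun_mxVK (U V : vectType K) :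
  cancel (hommx (vbasis {:U}) (vbasis {:V})) (@lfun_mx U V).
Proof. by apply: hommxK; apply: vbasisP. Qed.

Lemma lfun_mx1 (V : vectType K) : lfun_mx (\1%VF : 'End(V)) = 1%:M.
Proof. by apply: mxof1; apply: basis_free (vbasisP _). Qed.

Lemma ltraceC (U V : vectType K) (f : 'Hom(U, V)) (g : 'Hom(V, U)) :
  ltrace (f \o g)%VF = ltrace (g \o f)%VF.
Proof. by rewrite /ltrace !lfun_mx_comp mxtrace_mulC. Qed.

Lemma ltrace_is_linear (V : vectType K) : linear_for *%R (@ltrace V).
Proof. by move=> a f g; rewrite /ltrace /lfun_mx linearP /= mxtraceD mxtraceZ. Qed.

HB.instance Definition _ (V : vectType K) := GRing.isSemilinear.Build K 'End(V) K _ (@ltrace V)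
  (GRing.semilinear_linear (@ltrace_is_linear V)).

Lemma ltrace1 (V : vectType K) : ltrace (\1%VF : 'End(V)) = (\dim {:V})%:R.
Proof. by rewrite /ltrace lfun_mx1 mxtrace1. Qed.

Lemma ltrace_coord (V : vectType K) (f : 'End(V)) :
  ltrace f = \sum_i coord (vbasis {:V}) i (f (vbasis {:V})`_i).
Proof. by apply: eq_bigr => i _; rewrite mxE /= vecof_delta mxE. Qed.

Definition lcomm (V : vectType K) (f g : 'End(V)) : 'End(V) := ((f \o g) - (g \o f))%VF.

Lemma lcommE (V : vectType K) (f g : 'End(V)) v : lcomm f g v = f (g v) - g (f v).
Proof. by rewrite add_lfunE opp_lfunE !comp_lfunE. Qed.

Lemma lcommDl (V : vectType K) (f g h : 'End(V)) : lcomm (f + g) h = lcomm f h + lcomm g h.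
Proof. by rewrite /lcomm comp_lfunDl comp_lfunDr opprD addrACA. Qed.

Lemma lcommZl (V : vectType K) a (f h : 'End(V)) : lcomm (a *: f) h = a *: lcomm f h.
Proof. by rewrite /lcomm -comp_lfunZl -comp_lfunZr scalerBr. Qed.

Lemma lcommC (V : vectType K) (f g : 'End(V)) : lcomm f g = - lcomm g f.
Proof. by rewrite /lcomm opprB. Qed.

Lemma lcommP (V : vectType K) a (f g h : 'End(V)) :
  lcomm (a *: f + g) h = a *: lcomm f h + lcomm g h.
Proof. by rewrite lcommDl lcommZl. Qed.

Lemma lcommPr (V : vectType K) a (f g h : 'End(V)) :
  lcomm h (a *: f + g) = a *: lcomm h f + lcomm h g.
Proof. by rewrite lcommC lcommP opprD -scalerN -!lcommC. Qed.

Lemma lcomm_jacobi (V : vectType K) (f g h : 'End(V)) :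
  lcomm f (lcomm g h) = lcomm (lcomm f g) h + lcomm g (lcomm f h).
Proof.
apply/lfunP => v; rewrite add_lfunE !lcommE !linearB /=.
move: (f (g (h v))) (f (h (g v))) (g (h (f v))) (h (g (f v))) => a b c d.
by move: (g (f (h v))) (h (f (g v))) => e k; vring.
Qed.

(** Invariance of the trace form, used to move a bracket from one factor to the other in every
    orthogonality argument below. *)
Lemma ltrace_lcomm (V : vectType K) (f g h : 'End(V)) :
  ltrace (lcomm f g \o h)%VF = ltrace (f \o lcomm g h)%VF.
Proof.
rewrite /lcomm comp_lfunDl comp_lfunDr comp_lfunNl comp_lfunNr !linearB /=.
by rewrite comp_lfunA -(comp_lfunA g) (ltraceC g) -(comp_lfunA f h).
Qed.

Lemma ltrace_lcomm0 (V : vectType K) (f g : 'End(V)) : ltrace (lcomm f g) = 0.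
Proof. by rewrite linearB /= ltraceC subrr. Qed.

Definition lnilpotent (V : vectType K) (f : 'End(V)) := exists k, forall v, iter k f v = 0.

Lemma lfun_ind_comb (V : vectType K) (T : {vspace V}) (P : V -> Prop) :
  P 0 -> (forall a u v, P u -> P v -> P (a *: u + v)) ->
  forall X : seq V, (forall x, x \in X -> P x) -> forall v, v \in <<X>>%VS -> P v.
Proof.
move=> P0 PD X PX v; rewrite -[X]in_tupleE => /coord_span ->.
elim/big_ind: _ => //= [x y Px Py|i _]; first by rewrite -[x]scale1r; apply: PD.
rewrite -[_ *: _]addr0; apply: PD => //; apply: PX.
by rewrite mem_nth // size_tuple.
Qed.
End LinearMapTrace.

Theorem jordan_conjugate (C : numClosedFieldType) (V : vectType C) (f : 'End(V)) :
  exists g : 'End(V), (ltrace (f \o g)%VF = 0 -> lnilpotent f) /\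
  forall N : {vspace 'End(V)}, (forall w, w \in N -> lcomm f w \in N) ->
    forall s, lcomm f s \in N -> lcomm g s \in N.
Proof.
set e := vbasis {:V}.
have [dV|] := posnP (\dim {:V}).
  exists 0; split=> [_|N _ s _].
    by exists 0 => v /=; apply/eqP; rewrite -memv0 -(eqP (_ : fullv == 0%VS)) ?memvf // -dimv_eq0 dV.
  by rewrite /lcomm comp_lfun0l comp_lfun0r subrr mem0v.
pose n := (\dim {:V}).-1; move=> /prednK; rewrite -/n => dV.
have [B [B1 B2]] : exists B : 'M[C]_(\dim {:V}),
  (\tr (lfun_mx f *m B) = 0 -> (lfun_mx f : 'M_(\dim {:V})) ^+ n.+1 = 0) /\
  forall N : 'M[C]_(\dim {:V}) -> Prop, N 0 ->
    (forall a u v, N u -> N v -> N (a *: u + v)) ->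
    (forall w, N w -> N (lfun_mx f *m w - w *m lfun_mx f)) ->
    forall s, N (lfun_mx f *m s - s *m lfun_mx f) -> N (B *m s - s *m B).
  move: (lfun_mx f); rewrite -dV => A; exact: jordan_conjugate_mx.
pose h : 'M_(\dim {:V}) -> 'End(V) := hommx e e.
have hM X Y : h (X *m Y) = (h Y \o h X)%VF by apply: hommx_mul; apply: vbasisP.
have hP a X Y : h (a *: X + Y) = a *: h X + h Y by rewrite /h linearP.
have hB X Y : h (X - Y) = h X - h Y by rewrite /h linearB.
have hf : h (lfun_mx f) = f by apply: lfun_mxK.
exists (h B); split=> [t0|N fN s Ns].
  exists n.+1 => v; suff : h ((lfun_mx f : 'M_(\dim {:V})) ^+ n.+1) v = 0.
    move=> <-; elim: n.+1 => [|k IHk].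
      by rewrite expr0 /h -[1](@lfun_mx1 _ V) lfun_mxK lfunE.
    by rewrite exprSr iterS IHk -mulmxE hM hf comp_lfunE.
  rewrite B1 /h ?linear0 ?lfunE // mxtrace_mulC.
  by move: t0; rewrite /ltrace lfun_mx_comp lfun_mxVK.
(* [h] reverses products, so a commutator of matrices goes to minus the commutator of the maps. *)
have -> : lcomm (h B) s = - h (B *m lfun_mx s - lfun_mx s *m B).
  by rewrite hB !hM [h (lfun_mx s)]lfun_mxK opprB.
rewrite memvN; apply: (B2 (fun X => h X \in N)).
- by rewrite /h linear0 mem0v.
- by move=> a u v uN vN; rewrite hP memvD ?memvZ.
- by move=> w /fN; rewrite -memvN hB !hM hf opprB.
- by rewrite -memvN hB !hM hf [h (lfun_mx s)]lfun_mxK opprB.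
Qed.

(** * Engel's theorem *)

Section Engel.
Variable K : fieldType.

HB.instance Definition _ (V : vectType K) (f : 'End(V)) :=
  GRing.isSemilinear.Build K 'End(V) 'End(V) _ (lcomm f)
    (GRing.semilinear_linear (fun a u v => lcommPr a u v f)).

Definition lad_fun (V : vectType K) (f : 'End(V)) : 'End('End(V)) := linfun (lcomm f).

Lemma lad_fun_is_linear (V : vectType K) : linear (@lad_fun V).
Proof. by move=> a f g; apply/lfunP => w; rewrite add_lfunE scale_lfunE !lfunE /= lcommP. Qed.

HB.instance Definition _ (V : vectType K) :=
  GRing.isSemilinear.Build K 'End(V) 'End('End(V)) _ (@lad_fun V)
    (GRing.semilinear_linear (@lad_fun_is_linear V)).

Definition lad (V : vectType K) : 'Hom('End(V), 'End('End(V))) := linfun (@lad_fun V).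

Lemma ladE (V : vectType K) (f w : 'End(V)) : lad V f w = lcomm f w.
Proof. by rewrite /lad 2!lfunE. Qed.

(** The commutator with [f] is the difference of two commuting multiplications, so every term of its
    (k+l)-th power contains the k-th power of the left one or the l-th power of the right one. The
    induction peels off one factor and avoids the binomial formula. *)
Lemma iter_lcomm0 (V : vectType K) (f : 'End(V)) k l (w : 'End(V)) :
  (forall v, iter k f (w v) = 0) -> (forall v, w (iter l f v) = 0) ->
  iter (k + l) (lcomm f) w = 0.
Proof.
have [m] := ubnP (k + l); elim: m => // m IHm in k l w *.
have iter0 j : iter j (lcomm f) 0 = 0 by elim: j => //= j ->; rewrite linear0.
case: k => [|k] klm h1.
  by rewrite (_ : w = 0) ?iter0 //; apply/lfunP => v; rewrite zero_lfunE; apply: h1.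
case: l klm => [|l] klm h2.
  by rewrite (_ : w = 0) ?iter0 //; apply/lfunP => v; rewrite zero_lfunE; apply: h2.
move: klm; rewrite addSn addnS ltnS => klm; rewrite iterSr {1}/lcomm.
have -> j u v : iter j (lcomm f) (u - v) = iter j (lcomm f) u - iter j (lcomm f) v.
  by elim: j => //= j ->; rewrite linearB.
have -> : iter (k + l).+1 (lcomm f) (f \o w)%VF = 0.
  rewrite -addnS; apply: IHm; rewrite ?addnS // => v; rewrite comp_lfunE.
    by rewrite -iterSr h1.
  by rewrite h2 linear0.
have -> : iter (k + l).+1 (lcomm f) (w \o f)%VF = 0; last by rewrite subrr.
rewrite -addSn; apply: IHm; rewrite ?addSn // => v; rewrite comp_lfunE.
  by rewrite h1.
by rewrite -iterS h2.
Qed.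

Lemma lad_nilpotent (V : vectType K) (f : 'End(V)) : lnilpotent f -> lnilpotent (lad V f).
Proof.
case=> k fk; exists (k + k)%N => w; rewrite (eq_iter (ladE f)).
by apply: iter_lcomm0 => v; rewrite fk ?linear0.
Qed.

(** This is Engel's theorem for the action on Y2/Y1, stated without forming the quotient. The pair
    of subspaces lets the induction apply the statement to the adjoint action, with a subalgebra as
    [Y1] and the whole algebra as [Y2]. *)
Theorem engel (V : vectType K) (I : {vspace 'End(V)}) :
  (forall f g, f \in I -> g \in I -> lcomm f g \in I) ->
  (forall f, f \in I -> lnilpotent f) ->
  forall (Z : vectType K) (phi : 'Hom('End(V), 'End(Z))),
  (forall f, f \in I -> lnilpotent (phi f)) ->
  (forall f g, f \in I -> g \in I -> phi (lcomm f g) = lcomm (phi f) (phi g)) ->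
  forall Y1 Y2 : {vspace Z}, (Y1 <= Y2)%VS -> Y1 != Y2 ->
  (forall f y, f \in I -> y \in Y1 -> phi f y \in Y1) ->
  (forall f y, f \in I -> y \in Y2 -> phi f y \in Y2) ->
  exists v, [/\ v \in Y2, v \notin Y1 & forall f, f \in I -> phi f v \in Y1].
Proof.
have [n] := ubnP (\dim I); elim: n => // n IHn in I *; rewrite ltnS => dIn Iclosed Inil.
move=> Z phi phinil phiM Y1 Y2 Y12 Yneq Y1s Y2s.
have [I0|I0] := eqVneq I 0%VS.
  have /subvPn[v v2 v1] : ~~ (Y2 <= Y1)%VS by apply: contraNN Yneq => Y21; rewrite eqEsubv Y12.
  exists v; split=> // f; rewrite I0 memv0 => /eqP->.
  by rewrite linear0 zero_lfunE mem0v.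
(* A proper subalgebra is normalized by some element outside it: the induction hypothesis for the
   adjoint action of J on I/J. *)
have stepJ (J : {vspace 'End(V)}) : (J <= I)%VS -> J != I ->
    (forall f g, f \in J -> g \in J -> lcomm f g \in J) ->
    exists x, [/\ x \in I, x \notin J & forall f, f \in J -> lcomm f x \in J].
  move=> JI JneqI Jcl.
  have dJ : (\dim J < n)%N.
    rewrite (leq_trans _ dIn) // ltn_neqAle dimvS // andbT.
    by apply: contraNneq JneqI => dJI; rewrite eqEdim JI dJI leqnn.
  have JI' := subvP JI.
  have [x [xI xJ xP]] : exists x, [/\ x \in I, x \notin J & forall f, f \in J -> lad V f x \in J].
    apply: (IHn J) => //.
    - by move=> f /JI'/Inil.
    - by move=> f /JI'/Inil/lad_nilpotent.
    - move=> f g _ _; apply/lfunP => w.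
      by rewrite {1}lcommE !ladE lcomm_jacobi addrK.
    - by move=> f y fJ yJ; rewrite ladE Jcl.
    - by move=> f y /JI' fI yI; rewrite ladE Iclosed.
  by exists x; split=> // f /xP; rewrite ladE.
have extJ (J : {vspace 'End(V)}) x : x \notin J ->
    (forall f g, f \in J -> g \in J -> lcomm f g \in J) ->
    (forall f, f \in J -> lcomm f x \in J) ->
    (forall f g, f \in (J + <[x]>)%VS -> g \in (J + <[x]>)%VS -> lcomm f g \in J).
  move=> xJ Jcl Jx f g /memv_addP[f1 f1J [_ /vlineP[a ->] ->]].
  move=> /memv_addP[g1 g1J [_ /vlineP[b ->] ->]].
  have -> : lcomm (f1 + a *: x) (g1 + b *: x) =
      lcomm f1 g1 + b *: lcomm f1 x - a *: lcomm g1 x.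
    have xx : lcomm x x = 0 by rewrite /lcomm subrr.
    rewrite [f1 + _]addrC [g1 + _]addrC lcommP !lcommPr xx scaler0 add0r.
    by rewrite [lcomm x g1]lcommC scalerN addrC [_ *: _ + lcomm f1 g1]addrC.
  by apply: memvB; [apply: memvD; [apply: Jcl|apply: memvZ; apply: Jx]|apply: memvZ; apply: Jx].
(* Adjoining normalizing elements one by one gives subalgebras of every dimension below that of [I],
   in particular one of codimension 1. *)
have [J [JI Jcl dJ]] : exists J : {vspace 'End(V)}, [/\ (J <= I)%VS,
    forall f g, f \in J -> g \in J -> lcomm f g \in J & (\dim J).+1 = \dim I].
  have : ((\dim I).-1 < \dim I)%N by rewrite prednK // lt0n dimv_eq0.
  suff exJ k : (k < \dim I)%N -> exists J : {vspace 'End(V)}, [/\ (J <= I)%VS,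
      forall f g, f \in J -> g \in J -> lcomm f g \in J & \dim J = k].
    move=> /exJ[J [JI Jcl dJ]]; exists J; split=> //.
    by rewrite dJ prednK // lt0n dimv_eq0.
  elim: k => [_|k IHk kI].
    exists 0%VS; rewrite sub0v dimv0; split=> // f g; rewrite !memv0 => /eqP-> /eqP->.
    by rewrite linear0.
  have [J [JI Jcl dJ]] := IHk (ltnW kI).
  have JneqI : J != I by apply: contraTneq kI => <-; rewrite dJ ltnNge leqnSn.
  have [x [xI xJ xP]] := stepJ J JI JneqI Jcl.
  exists (J + <[x]>)%VS; split.
  - by rewrite subv_add JI -memvE.
  - by move=> f g fJ gJ; rewrite (subvP (addvSl _ _)) // (extJ J x).
  - rewrite dimv_disjoint_sum ?dim_vline ?dJ; last first.
      apply/eqP; rewrite -subv0; apply/subvP => z /memv_capP[yJ /vlineP[a ya]].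
      rewrite memv0 ya; move: yJ; rewrite ya; have [->|a0] := eqVneq a 0; first by rewrite scale0r.
      by move=> /(memvZ a^-1); rewrite scalerA mulVf // scale1r (negPf xJ).
    by have -> : x != 0; rewrite ?addn1 //; apply: contraNneq xJ => ->; rewrite mem0v.
have JneqI : J != I by apply/eqP => JE; rewrite JE in dJ; elim: (\dim I) dJ => // k IHk [].
have [x [xI xJ xP]] := stepJ J JI JneqI Jcl.
have defI : (J + <[x]> = I)%VS.
  apply/eqP; rewrite eqEdim subv_add JI -memvE xI -dJ /=.
  rewrite ltnNge; apply: contraNN xJ => le_d.
  have /eqP -> : J == (J + <[x]>)%VS by rewrite eqEdim addvSl.
  by rewrite (subvP (addvSr _ _)) ?memv_line.
have JI' := subvP JI.
(* J annihilates [y] modulo [Y1], and then all iterates of [y] under [x], because [J,x] lies in J.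
   The last iterate outside [Y1] is the vector sought. *)
have [y [y2 y1 yP]] : exists v, [/\ v \in Y2, v \notin Y1 & forall f, f \in J -> phi f v \in Y1].
  apply: (IHn J) => //; first by rewrite -ltnS dJ.
  - by move=> f /JI'/Inil.
  - by move=> f /JI'/phinil.
  - by move=> f g /JI' fI /JI' gI; apply: phiM.
  - by move=> f v /JI' fI; apply: Y1s.
  - by move=> f v /JI' fI; apply: Y2s.
have [k kP] := phinil x xI.
have [j [j1 jS]] : exists j, iter j (phi x) y \notin Y1 /\ iter j.+1 (phi x) y \in Y1.
  have : iter k (phi x) y \in Y1 by rewrite kP mem0v.
  elim: k {kP} => [|k IHk] kY; first by rewrite kY in y1.
  by have [/IHk//|kN] := boolP (iter k (phi x) y \in Y1); exists k.
have yj i : iter i (phi x) y \in Y2 /\ forall f, f \in J -> phi f (iter i (phi x) y) \in Y1.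
  elim: i => [//|i [IH2 IHJ]]; split=> [|f fJ]; first exact: Y2s.
  have -> : phi f (iter i.+1 (phi x) y) =
      phi (lcomm f x) (iter i (phi x) y) + phi x (phi f (iter i (phi x) y)).
    by rewrite phiM // ?(JI' f) // lcommE subrK.
  by rewrite memvD // ?IHJ ?xP // Y1s // IHJ.
exists (iter j (phi x) y); split; [by case: (yj j)|by []|].
move=> f; rewrite -defI => /memv_addP[g gJ [_ /vlineP[a ->] ->]].
rewrite linearD linearZ add_lfunE scale_lfunE memvD ?memvZ //.
by case: (yj j) => _; apply.
Qed.
End Engel.

(** * Families of operators: stable subspaces, complements, Schur's lemma *)

Section OperatorFamilies.
Variables (K : fieldType) (V : vectType K) (I : Type).
Implicit Types (rho : I -> 'End(V)) (U W : {vspace V}).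

Definition stable rho U := forall i v, v \in U -> rho i v \in U.

(** Complete reducibility as existence of stable complements. Any index type is allowed, so that Lie
    algebras, their images and their subspaces share one notion. *)
Definition semisimple rho := forall U, stable rho U ->
  exists W, [/\ stable rho W, (U + W)%VS = fullv & (U :&: W)%VS = 0%VS].

Definition irreducible_family rho :=
  (fullv : {vspace V}) != 0%VS /\
  forall U, stable rho U -> U = 0%VS \/ U = fullv.

Lemma stable0 rho : stable rho 0%VS.
Proof. by move=> i v; rewrite !memv0 => /eqP->; rewrite linear0. Qed.

Lemma stablef rho : stable rho fullv.
Proof. by move=> i v _; rewrite memvf. Qed.

Lemma stableD rho U W : stable rho U -> stable rho W -> stable rho (U + W)%VS.
Proof.
move=> sU sW i _ /memv_addP[u uU [w wW ->]].
by rewrite linearD memv_add ?sU ?sW.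
Qed.

Lemma stableI rho U W : stable rho U -> stable rho W -> stable rho (U :&: W)%VS.
Proof. by move=> sU sW i v /memv_capP[vU vW]; rewrite memv_cap sU ?sW. Qed.

Lemma irreducible_semisimple rho : irreducible_family rho -> semisimple rho.
Proof.
move=> [_ irr] U /irr[]->.
  by exists fullv; split; [apply: stablef|rewrite add0v|rewrite cap0v].
by exists 0%VS; split; [apply: stable0|rewrite addv0|rewrite capv0].
Qed.
End OperatorFamilies.

(** For an eigenvalue a of [f] the kernel of f - a is stable and nonzero, hence the whole space. *)
Lemma schur_scalar (C : numClosedFieldType) (V : vectType C) (I : Type)
    (rho : I -> 'End(V)) (f : 'End(V)) :
  irreducible_family rho -> (forall i v, f (rho i v) = rho i (f v)) ->
  exists a, f = a *: \1%VF.
Proof.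
move=> [V0 irr] fC.
have dV : (0 < \dim {:V})%N by rewrite lt0n dimv_eq0.
have [a /eigenvalueP[u uf u0]] := eigenvalue_closed (lfun_mx f) dV.
exists a; have [i v|E|E] := irr (lker (f - a *: \1%VF)).
- rewrite !memv_ker !(add_lfunE, opp_lfunE, scale_lfunE, id_lfunE) fC -linearZ -linearB.
  by move=> /eqP->; rewrite linear0.
- case/negP: u0; rewrite -(vecof_eq0 (e := vbasis fullv) (vbasisP _)) -memv0 -E memv_ker.
  rewrite !(add_lfunE, opp_lfunE, scale_lfunE, id_lfunE).
  rewrite (hom_vecof _ (vbasisP _)) -[mxof _ _ _]/(lfun_mx f) uf linearZ.
  by rewrite subrr.
- apply/lfunP => v; have : v \in lker (f - a *: \1%VF) by rewrite E memvf.
  by rewrite memv_ker add_lfunE opp_lfunE subr_eq0 => /eqP.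
Qed.

(** * Cartan's criterion *)

Section Brackets.
Variables (K : fieldType) (V : vectType K).
Implicit Types (S N T : {vspace 'End(V)}).

Definition lbr N S : {vspace 'End(V)} :=
  <<[seq lcomm n s | n <- vbasis N, s <- vbasis S]>>%VS.

Lemma lcomm_closed_basis N S T :
  {in vbasis N & vbasis S, forall n s, lcomm n s \in T} ->
  {in N & S, forall n s, lcomm n s \in T}.
Proof.
move=> h n s nN sS; rewrite (coord_vbasis nN) (coord_vbasis sS).
rewrite linear_sum; apply: memv_suml => j _; rewrite linearZ; apply: memvZ => /=.
rewrite lcommC memvN linear_sum; apply: memv_suml => i _; rewrite linearZ; apply: memvZ => /=.
by rewrite lcommC memvN h ?memt_nth ?mem_nth ?size_tuple.
Qed.

Lemma mem_lbr N S : {in N & S, forall n s, lcomm n s \in lbr N S}.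
Proof.
apply: lcomm_closed_basis => n s nN sS; apply: memv_span.
by apply/allpairsP; exists (n, s).
Qed.

Lemma lbr_ind N S (P : 'End(V) -> Prop) :
  P 0 -> (forall a u v, P u -> P v -> P (a *: u + v)) ->
  {in N & S, forall n s, P (lcomm n s)} -> {in lbr N S, forall f, P f}.
Proof.
move=> P0 PD PC; apply: lfun_ind_comb => // f /allpairsP[[n s] /= [nN sS ->]].
by apply: PC; apply: vbasis_mem.
Qed.

Lemma lbr_sub N S T : {in N & S, forall n s, lcomm n s \in T} -> (lbr N S <= T)%VS.
Proof.
move=> h; apply/subvP; apply: lbr_ind => // [|a u v uT vT]; first exact: mem0v.
by rewrite memvD ?memvZ.
Qed.

Definition lkers S : {vspace V} := (\bigcap_(i < \dim S) lker (vbasis S)`_i)%VS.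

Lemma lkersP S v : reflect (forall f, f \in S -> f v = 0) (v \in lkers S).
Proof.
rewrite /lkers memvE; apply: (iffP subv_bigcapP) => h.
  move=> f fS; rewrite (coord_vbasis fS) sum_lfunE big1 // => i _.
  by have := h i isT; rewrite scale_lfunE -memvE memv_ker => /eqP->; rewrite scaler0.
move=> i _; rewrite -memvE memv_ker h //; apply: vbasis_mem.
by rewrite mem_nth ?size_tuple.
Qed.
End Brackets.

(** Cartan's criterion for a completely reducible action. Elements f of [N,S] are nilpotent: with g
    the conjugate attached to f, tr(f g) is a combination of traces tr(n [s,g]) with [s,g] in N. The
    common kernel of [N,S] has a stable complement, which Engel's theorem forces to be zero, so
    [N,S] = 0. *)
Lemma isotropic_ideal_central (C : numClosedFieldType) (V : vectType C)
    (S N : {vspace 'End(V)}) :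
  semisimple (fun s : subvs_of S => vsval s) ->
  (N <= S)%VS -> {in N & S, forall n s, lcomm n s \in N} ->
  {in N &, forall m n, ltrace (m \o n)%VF = 0} ->
  {in N & S, forall n s, lcomm n s = 0}.
Proof.
move=> ssS NS Nideal Niso; pose I := lbr N S.
have IN : (I <= N)%VS by apply: lbr_sub.
have Icl f s : f \in I -> s \in S -> lcomm f s \in I.
  by move=> /(subvP IN) fN sS; apply: mem_lbr.
have Inil f : f \in I -> lnilpotent f.
  move=> fI; have fN := subvP IN _ fI.
  have [g [g1 g2]] := jordan_conjugate f; apply: g1; move: f fI {fN} g2 => f0 f0I g2.
  (* N is stable under bracketing with f0 and contains [f0,s], so the conjugate inherits the second
     property. *)
  have gN s : s \in S -> lcomm g s \in N.
    move=> sS; apply: g2 => [w wN|]; last by apply: Nideal => //; apply: (subvP IN).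
    by rewrite lcommC memvN; apply: Nideal => //; apply: (subvP NS); apply: (subvP IN).
  have : {in I, forall f, ltrace (f \o g)%VF = 0}; last exact.
  apply: lbr_ind => [|a u v u0 v0|n s nN sS].
  - by rewrite comp_lfun0l linear0.
  - by rewrite comp_lfunDl -comp_lfunZl linearP /= u0 v0 mulr0 addr0.
  - by rewrite ltrace_lcomm lcommC comp_lfunNr linearN /= Niso ?oppr0 ?gN.
have [W [sW KW1 KW0]] : exists W, [/\ stable (fun s : subvs_of S => vsval s) W,
    (lkers I + W)%VS = fullv & (lkers I :&: W)%VS = 0%VS].
  apply: ssS => s v /lkersP Iv; apply/lkersP => f fI.
  have := Iv _ (Icl f (vsval s) fI (subvsP s)).
  by rewrite lcommE (Iv f) // linear0 subr0.
have [W0|W0] := eqVneq W 0%VS; last first.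
  have [v [vW v0 vI]] : exists v, [/\ v \in W, v \notin 0%VS &
      forall f, f \in I -> (\1%VF : 'Hom('End(V), 'End(V))) f v \in 0%VS].
    apply: (@engel _ V I) => //.
    - by move=> f g fI /(subvP IN)/(subvP NS); apply: Icl.
    - by move=> f fI; rewrite id_lfunE; apply: Inil.
    - by move=> f g _ _; rewrite !id_lfunE.
    - exact: sub0v.
    - by rewrite eq_sym.
    - by move=> f v fI; rewrite !memv0 => /eqP->; rewrite linear0.
    - move=> f v /(subvP IN)/(subvP NS) fS vW; rewrite id_lfunE.
      by rewrite -(vsprojK fS); apply: sW.
  case/negP: v0; rewrite -KW0 memv_cap vW andbT; apply/lkersP => f /vI.
  by rewrite id_lfunE memv0 => /eqP.
move=> n s nN sS; apply/lfunP => v; rewrite zero_lfunE.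
have : v \in lkers I by rewrite W0 addv0 in KW1; rewrite KW1 memvf.
by move/lkersP; apply; apply: mem_lbr.
Qed.

(** * Dual bases, the Casimir tensor and orthogonal complements *)

Section DualBases.
Variables (K : fieldType) (E : vectType K) (k : {vspace E}).
Variable tau : E -> E -> K.
Hypothesis tauC : forall x y, tau x y = tau y x.
Hypothesis tauP : forall a x y z, tau (a *: x + y) z = a * tau x z + tau y z.
Hypothesis tau_nondeg : forall x, x \in k -> (forall y, y \in k -> tau x y = 0) -> x = 0.

Let tau_sum (I : Type) (r : seq I) (P : pred I) (F : I -> E) (a : I -> K) z :
  tau (\sum_(i <- r | P i) a i *: F i) z = \sum_(i <- r | P i) a i * tau (F i) z.
Proof.
elim/big_rec2: _ => [|i y1 y2 _ <-]; last exact: tauP.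
by have := tauP (-1) 0 0 z; rewrite scaler0 addr0 mulN1r addNr.
Qed.

Lemma dual_bases : exists x y : 'I_(\dim k) -> E,
  [/\ forall i, x i \in k /\ y i \in k,
      forall i, tau (x i) (y i) = 1,
      forall u, u \in k -> u = \sum_i tau u (y i) *: x i &
      forall u, u \in k -> u = \sum_i tau (x i) u *: y i].
Proof.
pose x (i : 'I_(\dim k)) := (vbasis k)`_i.
have xk i : x i \in k by apply: vbasis_mem; rewrite mem_nth ?size_tuple.
pose G : 'M[K]_(\dim k) := \matrix_(i, j) tau (x i) (x j).
have Gu : G \in unitmx.
  rewrite -row_free_unit -kermx_eq0 -submx0; apply/rV_subP => v /sub_kermxP vG.
  rewrite (_ : v = 0) ?sub0mx //.
  have v0 : \sum_i v 0 i *: x i = 0.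
    apply: tau_nondeg => [|y yk]; first by apply: memv_suml => i _; apply: memvZ.
    rewrite (coord_vbasis yk) tauC tau_sum big1 // => j _.
    move/rowP/(_ j): vG; rewrite !mxE => vGj.
    rewrite tauC tau_sum; under eq_bigr => i _ do rewrite -(mxE matrix_key (fun i j => tau (x i) (x j))).
    by rewrite vGj mulr0.
  apply/rowP => i; rewrite mxE; have /freeP := basis_free (vbasisP k).
  by move=> /(_ (fun i => v 0 i) v0 i).
pose y j := \sum_i invmx G i j *: x i.
have yk j : y j \in k by apply: memv_suml => i _; apply: memvZ.
have xy i j : tau (x i) (y j) = (i == j)%:R.
  rewrite tauC tau_sum; have <- : (G *m invmx G) i j = (i == j)%:R by rewrite mulmxV // mxE.
  by rewrite mxE; apply: eq_bigr => l _; rewrite mxE mulrC tauC.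
exists x, y; split=> // [i|u uk|u uk]; first by rewrite xy eqxx.
  rewrite {1}(coord_vbasis uk); apply: eq_bigr => i _; congr (_ *: _).
  rewrite {2}(coord_vbasis uk) tau_sum (bigD1 i) //= xy eqxx mulr1 big1 ?addr0 // => j ji.
  by rewrite xy (negPf ji) mulr0.
apply/eqP; rewrite -subr_eq0; apply/eqP; apply: tau_nondeg => [|z zk].
  by rewrite memvB //; apply: memv_suml => i _; apply: memvZ.
rewrite (coord_vbasis zk) tauC tau_sum big1 // => i _; rewrite -[(vbasis k)`_i]/(x i).
rewrite tauC addrC -scaleN1r tauP tau_sum (bigD1 i) //= [tau (y i) _]tauC xy eqxx mulr1.
rewrite big1 ?addr0 => [|j ji]; first by rewrite mulN1r tauC addNr mulr0.
by rewrite [tau (y j) _]tauC xy eq_sym (negPf ji) mulr0.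
Qed.

(** The tensor sum x_i (x) y_i is killed by an operator [D] that is skew for [tau]: once D x_i and D
    y_i are expanded, the coefficients cancel in pairs. The bilinear [B] stands for the tensor
    product, so that the same lemma serves the Casimir operator and the primitive of a cocycle. *)
Lemma casimir_invariant (D : E -> E) (U : lmodType K) (B : E -> E -> U) x y :
  (forall u, u \in k -> u = \sum_(i < \dim k) tau u (y i) *: x i) ->
  (forall u, u \in k -> u = \sum_(i < \dim k) tau (x i) u *: y i) ->
  (forall i, D (x i) \in k /\ D (y i) \in k) ->
  (forall i j, tau (D (x i)) (y j) = - tau (x i) (D (y j))) ->
  (forall a u v w, B (a *: u + v) w = a *: B u w + B v w) ->
  (forall a u v w, B w (a *: u + v) = a *: B w u + B w v) ->
  \sum_i (B (D (x i)) (y i) + B (x i) (D (y i))) = 0.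
Proof.
move=> xP yP Dk Dtau Bl Br.
have Bsl (I : Type) (r : seq I) (F : I -> E) (a : I -> K) z :
    B (\sum_(i <- r) a i *: F i) z = \sum_(i <- r) a i *: B (F i) z.
  elim/big_rec2: _ => [|i y1 y2 _ <-]; last exact: Bl.
  by have := Bl (-1) 0 0 z; rewrite scaler0 addr0 scaleN1r addNr.
have Bsr (I : Type) (r : seq I) (F : I -> E) (a : I -> K) z :
    B z (\sum_(i <- r) a i *: F i) = \sum_(i <- r) a i *: B z (F i).
  elim/big_rec2: _ => [|i y1 y2 _ <-]; last exact: Br.
  by have := Br (-1) 0 0 z; rewrite scaler0 addr0 scaleN1r addNr.
rewrite big_split /=.
under eq_bigr => i _ do rewrite (xP _ (proj1 (Dk i))) Bsl.
under [X in _ + X]eq_bigr => i _ do rewrite (yP _ (proj2 (Dk i))) Bsr.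
rewrite [X in _ + X]exchange_big /= -big_split big1 // => i _ /=.
by rewrite -big_split big1 // => j _ /=; rewrite Dtau scaleNr addNr.
Qed.
End DualBases.

Section Perp.
Variables (K : fieldType) (V : vectType K).
Implicit Types (S k : {vspace 'End(V)}).

Definition trace_row k (s : 'End(V)) : 'rV[K]_(\dim k) :=
  \row_i ltrace (s \o (vbasis k)`_i)%VF.

Lemma trace_row_is_linear k : linear (trace_row k).
Proof.
move=> a u v; apply/rowP => i; rewrite !mxE comp_lfunDl -comp_lfunZl.
by rewrite linearP.
Qed.

HB.instance Definition _ k := GRing.isSemilinear.Build K 'End(V) _ _ (trace_row k)
  (GRing.semilinear_linear (trace_row_is_linear k)).

Definition perp S k := (S :&: lker (linfun (trace_row k)))%VS.

Lemma perpP S k s : reflect (s \in S /\ forall n, n \in k -> ltrace (s \o n)%VF = 0)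
  (s \in perp S k).
Proof.
apply: (iffP memv_capP) => -[sS h]; split=> //.
  move=> n nk; rewrite (coord_vbasis nk) ltraceC.
  rewrite (big_morph (fun f => f \o s)%VF (fun f g => comp_lfunDl f g s) (comp_lfun0l _ s)).
  rewrite linear_sum big1 // => i _; rewrite -comp_lfunZl linearZ /= ltraceC.
  move: h; rewrite memv_ker lfunE => /eqP/rowP/(_ i); rewrite !mxE => ->.
  by rewrite mulr0.
rewrite memv_ker lfunE; apply/eqP/rowP => i; rewrite !mxE h //.
by apply: vbasis_mem; rewrite mem_nth ?size_tuple.
Qed.

Lemma dimv_perp S k : (\dim S <= \dim k + \dim (perp S k))%N.
Proof.
rewrite -(limg_ker_dim (linfun (trace_row k)) S) addnC leq_add2r.
apply: leq_trans (dimvS (subvf _)) _.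
by rewrite dimvf /dim /= mul1n.
Qed.
End Perp.

(** * Centerless Lie algebras and Whitehead's lemma for irreducible modules *)

Section CenterlessLieAlgebra.
Variables (C : numClosedFieldType) (V : vectType C) (S : {vspace 'End(V)}).
Hypothesis S_lie : {in S &, forall f g, lcomm f g \in S}.
Hypothesis S_semisimple : semisimple (fun s : subvs_of S => vsval s).
Hypothesis S_centerless : {in S, forall s, {in S, forall t, lcomm s t = 0} -> s = 0}.

Definition lie_ideal (k : {vspace 'End(V)}) :=
  (k <= S)%VS /\ {in k & S, forall n s, lcomm n s \in k}.

Lemma lie_ideal_perp k : lie_ideal k -> lie_ideal (perp S k).
Proof.
move=> [kS kI]; split; first exact: capvSl.
move=> n s /perpP[nS nk] sS; apply/perpP; split=> [|t tk]; first exact: S_lie.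
by rewrite ltrace_lcomm lcommC comp_lfunNr linearN /= nk ?oppr0 ?kI.
Qed.

(** An ideal meets its orthogonal in an isotropic ideal, which is central by Cartan's criterion and
    hence zero. *)
Lemma ideal_perp0 k f : lie_ideal k -> f \in k -> f \in perp S k -> f = 0.
Proof.
move=> kI fk fp; apply: S_centerless; first exact: (subvP kI.1).
move=> t tS; have [kS kl] := kI; have [_ pl] := lie_ideal_perp kI.
apply: (@isotropic_ideal_central _ _ S (k :&: perp S k)%VS) => //.
- exact: subv_trans (capvSl _ _) kS.
- by move=> n s /memv_capP[nk np] sS; rewrite memv_cap kl ?pl.
- by move=> m n /memv_capP[_ /perpP[_ mp]] /memv_capP[nk _]; apply: mp.
- by rewrite memv_cap fk fp.
Qed.

Lemma ideal_perp_sum k : lie_ideal k -> (k + perp S k)%VS = S.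
Proof.
move=> kI; apply/eqP; rewrite eqEdim subv_add kI.1 capvSl /=.
rewrite dimv_disjoint_sum ?dimv_perp //.
apply/eqP; rewrite -subv0; apply/subvP => f /memv_capP[fk fp].
by rewrite memv0 (ideal_perp0 kI fk fp).
Qed.

(** If f is orthogonal to [S,S], then [f,t] is orthogonal to S by invariance of the trace form,
    hence zero; so f is central. *)
Lemma lbr_perfect : lbr S S = S.
Proof.
have SI : lie_ideal S by split.
apply/eqP; rewrite eqEdim lbr_sub //= (leq_trans (dimv_perp S (lbr S S))) //.
suff -> : perp S (lbr S S) = 0%VS by rewrite dimv0 addn0.
apply/eqP; rewrite -subv0; apply/subvP => f /perpP[fS fp]; rewrite memv0; apply/eqP.
apply: S_centerless => // t tS; apply: (ideal_perp0 SI); first exact: S_lie.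
apply/perpP; split=> [|u uS]; first exact: S_lie.
by rewrite ltrace_lcomm fp // mem_lbr.
Qed.

Section Module.
Variables (M : vectType C) (phi : 'Hom('End(V), 'End(M))).
Hypothesis phi_lie : {in S &, forall f g, phi (lcomm f g) = lcomm (phi f) (phi g)}.

(** With trivial action the cocycle identity makes [d] vanish on brackets, and these span [S]. *)
Lemma cocycle_trivial_action (d : 'Hom('End(V), M)) :
  {in S &, forall f g, d (lcomm f g) = phi f (d g) - phi g (d f)} ->
  {in S, forall s, phi s = 0} -> {in S, forall s, d s = 0}.
Proof.
move=> dS phi0 s; rewrite -lbr_perfect; move: s; apply: lbr_ind => [|a u v u0 v0|n s nS sS].
- by rewrite linear0.
- by rewrite linearP /= u0 v0 scaler0 addr0.
- by rewrite dS // !phi0 // !zero_lfunE subrr.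
Qed.

(* The Casimir element is taken for the trace form of M on the ideal k that is
   orthogonal, for the trace form of V, to the kernel of the action on M; it
   acts on M by dim k / dim M, which vanishes only if S acts by 0. *)
Lemma cocycle_irreducible (d : 'Hom('End(V), M)) :
  irreducible_family (fun s : subvs_of S => phi (vsval s)) ->
  {in S &, forall f g, d (lcomm f g) = phi f (d g) - phi g (d f)} ->
  exists m, {in S, forall s, d s = phi s m}.
Proof.
move=> irr dS.
pose k' := (S :&: lker phi)%VS; pose k := perp S k'.
have k'I : lie_ideal k'.
  split=> [|n s /memv_capP[nS]]; first exact: capvSl.
  rewrite memv_ker => /eqP n0 sS; rewrite memv_cap S_lie //= memv_ker phi_lie //.
  by rewrite n0 /lcomm comp_lfun0l comp_lfun0r subrr.
have [kS kl] := lie_ideal_perp k'I; rewrite -/k in kS kl.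
have kS' := subvP kS.
have S_sum := ideal_perp_sum k'I; rewrite -/k in S_sum.
pose tau x y := ltrace (phi x \o phi y)%VF.
have tauC x y : tau x y = tau y x by apply: ltraceC.
have tauP a x y z : tau (a *: x + y) z = a * tau x z + tau y z.
  by rewrite /tau linearP comp_lfunDl -comp_lfunZl linearP.
have tau_inv x y z : x \in S -> y \in S -> z \in S -> tau (lcomm x y) z = tau x (lcomm y z).
  by move=> xS yS zS; rewrite /tau !phi_lie // ltrace_lcomm.
(* The radical of the trace form on [phi @: S] is an isotropic ideal, hence central by Cartan's
   criterion. It contains phi x because S = k + k' and phi kills k'. So [x,t] lies in both k and k',
   and is zero for every t. *)
have tau_nd x : x \in k -> (forall y, y \in k -> tau x y = 0) -> x = 0.
  move=> xk xy; apply: S_centerless => [|t tS]; first exact: kS'.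
  apply: (ideal_perp0 k'I); last by apply: kl.
  apply/memv_capP; split; [exact: S_lie (kS' _ xk) tS|rewrite memv_ker (phi_lie (kS' _ xk) tS); apply/eqP].
  have SM f g : f \in (phi @: S)%VS -> g \in (phi @: S)%VS -> lcomm f g \in (phi @: S)%VS.
    move=> /memv_imgP[f1 f1S ->] /memv_imgP[g1 g1S ->].
    by rewrite -phi_lie // memv_img // S_lie.
  apply: (@isotropic_ideal_central _ _ (phi @: S)%VS (perp (phi @: S) (phi @: S))%VS).
  - apply: irreducible_semisimple; split; first exact: irr.1.
    move=> U sU; apply: irr.2 => s v vU.
    have pS : phi (vsval s) \in (phi @: S)%VS by rewrite memv_img // subvsP.
    by rewrite -(vsprojK pS); apply: sU.
  - exact: capvSl.
  - move=> n s /perpP[nS nP] sS; apply/perpP; split=> [|u uS]; first exact: SM.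
    by rewrite ltrace_lcomm nP // SM.
  - by move=> m n /perpP[_ mP] /perpP[nS _]; apply: mP.
  - apply/perpP; split=> [|_ /memv_imgP[y yS ->]]; first by rewrite memv_img // kS'.
    move: yS; rewrite -S_sum => /memv_addP[y1 /memv_capP[_ y1k] [y2 y2k ->]].
    have -> : phi (y1 + y2) = phi y2; last exact: xy.
    by move: y1k; rewrite memv_ker linearD /= => /eqP->; rewrite add0r.
  - by rewrite memv_img.
have [x [y [xyk xy1 xP yP]]] := dual_bases tauC tauP tau_nd.
have xk i := (xyk i).1; have yk i := (xyk i).2.
have casimir (U : lmodType C) (B : 'End(V) -> 'End(V) -> U) s : s \in S ->
   (forall a u v w, B (a *: u + v) w = a *: B u w + B v w) ->
   (forall a u v w, B w (a *: u + v) = a *: B w u + B w v) ->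
   \sum_i (B (lcomm s (x i)) (y i) + B (x i) (lcomm s (y i))) = 0.
  move=> sS Bl Br; apply: (casimir_invariant xP yP) => // [i|i j].
    by rewrite lcommC memvN kl // [lcomm s (y i)]lcommC memvN kl.
  rewrite lcommC; have -> : tau (- lcomm (x i) s) (y j) = - tau (lcomm (x i) s) (y j).
    by rewrite /tau linearN comp_lfunNl linearN.
  by rewrite (tau_inv _ _ _ (kS' _ (xk i)) sS (kS' _ (yk j))).
have [k0|k0] := eqVneq k 0%VS.
  exists 0 => s sS; rewrite linear0; apply: cocycle_trivial_action => // t.
  by rewrite -S_sum k0 addv0 => /memv_capP[_]; rewrite memv_ker => /eqP.
pose cas := \sum_i (phi (x i) \o phi (y i))%VF.
have casC s v : s \in S -> cas (phi s v) = phi s (cas v).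
  move=> sS; have Bl a u w z : phi (a *: u + w) (phi z v) = a *: phi u (phi z v) + phi w (phi z v).
    by rewrite linearP add_lfunE scale_lfunE.
  have Br a u w z : phi z (phi (a *: u + w) v) = a *: phi z (phi u v) + phi z (phi w v).
    by rewrite [phi (_ + _)]linearP add_lfunE scale_lfunE linearP.
  have := casimir _ (fun u w => phi u (phi w v)) s sS Bl Br.
  rewrite /cas !sum_lfunE linear_sum /= => c0.
  apply/eqP; rewrite eq_sym -subr_eq0 -sumrB -[X in _ == X]c0; apply/eqP.
  apply: eq_bigr => i _; rewrite (phi_lie sS (kS' _ (xk i))) (phi_lie sS (kS' _ (yk i))) !lcommE !comp_lfunE.
  by rewrite linearB addrA subrK.
have [a casE] := schur_scalar irr (fun s v => casC (vsval s) v (subvsP s)).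
(* Taking traces gives a * dim M = dim k, and dim k is nonzero in characteristic 0. *)
have a0 : a != 0.
  have : ltrace cas = (\dim k)%:R.
    rewrite /cas linear_sum /= (eq_bigr (fun=> 1)) ?sumr_const ?card_ord // => i _.
    exact: xy1.
  rewrite casE linearZ /= ltrace1; apply: contra_eq_neq => ->.
  by rewrite mul0r eq_sym pnatr_eq0 dimv_eq0.
(* Invariance of the Casimir tensor, applied to (u, w) |-> phi u (d w) and combined with the cocycle
   identity, says that phi s sends the sum of the phi x_i (d y_i) to the Casimir operator applied to
   d s, which is a times d s. *)
exists (a^-1 *: \sum_i phi (x i) (d (y i))) => s sS.
have Bl c u w z : phi (c *: u + w) (d z) = c *: phi u (d z) + phi w (d z).
  by rewrite linearP add_lfunE scale_lfunE.
have Br c u w z : phi z (d (c *: u + w)) = c *: phi z (d u) + phi z (d w).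
  by rewrite [d _]linearP linearP.
have c0 := casimir _ (fun u w => phi u (d w)) s sS Bl Br.
have cds : cas (d s) = a *: d s by rewrite casE scale_lfunE id_lfunE.
rewrite linearZ /= -[LHS]scale1r -(mulVf a0) -scalerA; congr (_ *: _).
rewrite -cds /cas sum_lfunE linear_sum; apply/eqP; rewrite eq_sym -subr_eq0 -sumrB -[X in _ == X]c0.
apply/eqP; apply: eq_bigr => i _; rewrite (phi_lie sS (kS' _ (xk i))) (dS _ _ sS (kS' _ (yk i))) !lcommE ?comp_lfunE.
rewrite linearB /= addrA subrK.
by [].
Qed.
End Module.
End CenterlessLieAlgebra.

(** * Actions on Hom, on subspaces and on quotients *)

Section HomAction.
Variables (K : fieldType) (E : vectType K).

Definition hom_act_fun (A B : vectType K) (a : 'End(A)) (b : 'End(B)) (f : 'Hom(A, B)) :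
  'Hom(A, B) := ((b \o f) - (f \o a))%VF.

Lemma hom_act_fun_is_linear (A B : vectType K) (a : 'End(A)) (b : 'End(B)) :
  linear (hom_act_fun a b).
Proof.
move=> c f g; rewrite /hom_act_fun comp_lfunDl comp_lfunDr -comp_lfunZl -comp_lfunZr.
by rewrite scalerBr opprD addrACA.
Qed.

HB.instance Definition _ (A B : vectType K) (a : 'End(A)) (b : 'End(B)) :=
  GRing.isSemilinear.Build K _ _ _ (hom_act_fun a b)
    (GRing.semilinear_linear (hom_act_fun_is_linear a b)).

Variables (A B : vectType K) (phiA : 'Hom(E, 'End(A))) (phiB : 'Hom(E, 'End(B))).

Definition hom_act1 (x : E) : 'End('Hom(A, B)) := linfun (hom_act_fun (phiA x) (phiB x)).

Lemma hom_act1_is_linear : linear hom_act1.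
Proof.
move=> c x y; apply/lfunP => f; rewrite add_lfunE scale_lfunE !lfunE /=.
rewrite /hom_act_fun !linearP /= comp_lfunDl comp_lfunDr -comp_lfunZl -comp_lfunZr.
by rewrite scalerBr opprD addrACA.
Qed.

HB.instance Definition _ :=
  GRing.isSemilinear.Build K _ _ _ hom_act1 (GRing.semilinear_linear hom_act1_is_linear).

Definition hom_act : 'Hom(E, 'End('Hom(A, B))) := linfun hom_act1.

Lemma hom_actE x f : hom_act x f = ((phiB x \o f) - (f \o phiA x))%VF.
Proof. by rewrite /hom_act lfunE /hom_act1 lfunE. Qed.

Lemma hom_act_applyE x f v : hom_act x f v = phiB x (f v) - f (phiA x v).
Proof. by rewrite hom_actE add_lfunE opp_lfunE !comp_lfunE. Qed.

Lemma hom_act_lie x y z : phiA z = lcomm (phiA x) (phiA y) ->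
  phiB z = lcomm (phiB x) (phiB y) -> hom_act z = lcomm (hom_act x) (hom_act y).
Proof.
move=> zA zB; apply/lfunP => f; apply/lfunP => v.
rewrite lcommE add_lfunE opp_lfunE !hom_act_applyE zA zB !lcommE linearB /=.
rewrite (linearB (phiB x)) (linearB (phiB y)) /=.
move: (phiB x (phiB y (f v))) (phiB y (phiB x (f v))) (f (phiA x (phiA y v))) => a b c.
move: (f (phiA y (phiA x v))) (phiB x (f (phiA y v))) (phiB y (f (phiA x v))) => d e k.
by vring.
Qed.
End HomAction.

Section Compression.
Variable K : fieldType.

Definition compress_fun (A B A' B' : vectType K) (p : 'Hom(B, B')) (i : 'Hom(A', A))
  (f : 'Hom(A, B)) : 'Hom(A', B') := (p \o (f \o i))%VF.

Lemma compress_fun_is_linear (A B A' B' : vectType K) (p : 'Hom(B, B')) (i : 'Hom(A', A)) :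
  linear (compress_fun p i).
Proof. by move=> c f g; apply/lfunP => v; rewrite /compress_fun; lfun_expand. Qed.

HB.instance Definition _ (A B A' B' : vectType K) (p : 'Hom(B, B')) (i : 'Hom(A', A)) :=
  GRing.isSemilinear.Build K _ _ _ (compress_fun p i)
    (GRing.semilinear_linear (compress_fun_is_linear p i)).

Fact compress_key : unit. Proof. by []. Qed.
(** Locked, like several later definitions, so that it is only handled through its evaluation
    lemma. *)
Definition compress (A B A' B' : vectType K) (p : 'Hom(B, B')) (i : 'Hom(A', A)) :
  'Hom('Hom(A, B), 'Hom(A', B')) :=
  locked_with compress_key (linfun (compress_fun p i)).

Lemma compressE (A B A' B' : vectType K) (p : 'Hom(B, B')) (i : 'Hom(A', A)) f v :
  compress p i f v = p (f (i v)).
Proof. by rewrite /compress locked_withE lfunE /= /compress_fun !comp_lfunE. Qed.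

Definition lfun_eval (A B : vectType K) (v : A) (f : 'Hom(A, B)) := f v.

Lemma lfun_eval_is_linear (A B : vectType K) (v : A) : linear (@lfun_eval A B v).
Proof. by move=> c f g; rewrite /lfun_eval add_lfunE scale_lfunE. Qed.

HB.instance Definition _ (A B : vectType K) (v : A) :=
  GRing.isSemilinear.Build K _ _ _ (@lfun_eval A B v)
    (GRing.semilinear_linear (@lfun_eval_is_linear A B v)).

Variables (M : vectType K) (U W : {vspace M}).

Definition sub_incl : 'Hom(subvs_of U, M) := linfun vsval.
Fact sub_proj_key : unit. Proof. by []. Qed.
Definition sub_proj : 'Hom(M, subvs_of U) :=
  locked_with sub_proj_key (linfun (vsproj U) \o daddv_pi U W)%VF.

Lemma sub_inclE u : sub_incl u = vsval u. Proof. exact: lfunE. Qed.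

Lemma sub_incl_mem u : sub_incl u \in U. Proof. by rewrite sub_inclE subvsP. Qed.

Lemma sub_incl_ex m : m \in U -> exists u, m = sub_incl u.
Proof. by move=> mU; exists (vsproj U m); rewrite sub_inclE vsprojK. Qed.

Hypothesis UW0 : (U :&: W)%VS = 0%VS.

Lemma sub_incl_projE m : sub_incl (sub_proj m) = daddv_pi U W m.
Proof. by rewrite sub_inclE /sub_proj locked_withE comp_lfunE lfunE /= vsprojK // memv_pi. Qed.

Lemma sub_proj_inclK u : sub_proj (sub_incl u) = u.
Proof. by apply: subvs_inj; rewrite -!sub_inclE sub_incl_projE daddv_pi_id // sub_incl_mem. Qed.

Lemma sub_incl_projK m : m \in U -> sub_incl (sub_proj m) = m.
Proof. by rewrite sub_incl_projE; apply: daddv_pi_id. Qed.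
End Compression.

Section Complements.
Variables (K : fieldType) (M : vectType K) (U W : {vspace M}).
Hypotheses (UW0 : (U :&: W)%VS = 0%VS) (UW1 : (U + W)%VS = fullv).

Lemma sub_proj_decomp m :
  sub_incl U (sub_proj U W m) + sub_incl W (sub_proj W U m) = m.
Proof. by rewrite !sub_incl_projE daddv_pi_add ?UW1 ?memvf. Qed.

Lemma sub_proj_other m : m \in W -> sub_proj U W m = 0.
Proof.
move=> mW; have WU0 : (W :&: U)%VS = 0%VS by rewrite capvC.
apply: subvs_inj; rewrite -!sub_inclE linear0; apply/eqP.
by rewrite -(inj_eq (addIr (sub_incl W (sub_proj W U m)))) sub_proj_decomp add0r sub_incl_projK.
Qed.
End Complements.

Lemma reducible_stable (K : fieldType) (V : vectType K) (I : Type) (rho : I -> 'End(V)) :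
  (fullv : {vspace V}) != 0%VS -> ~ irreducible_family rho ->
  exists U, [/\ stable rho U, U != 0%VS & U != fullv].
Proof.
move=> V0 nirr; apply: contrapT => nU; apply: nirr; split=> // U sU.
have [->|U0] := eqVneq U 0%VS; first by left.
by right; apply/eqP; apply: contrapT => /negP U1; apply: nU; exists U.
Qed.

Lemma compl_disjoint (K : fieldType) (V : vectType K) (U : {vspace V}) : (U^C :&: U)%VS = 0%VS.
Proof. by rewrite capvC capv_compl. Qed.

Section CompressRep.
Variables (K : fieldType) (E M : vectType K) (phi : 'Hom(E, 'End(M))).

Fact compress_rep_key : unit. Proof. by []. Qed.

Definition compress_rep (A : vectType K) (p : 'Hom(M, A)) (i : 'Hom(A, M)) : 'Hom(E, 'End(A)) :=
  locked_with compress_rep_key (compress p i \o phi)%VF.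

Lemma compress_repE (A : vectType K) (p : 'Hom(M, A)) (i : 'Hom(A, M)) x a :
  compress_rep p i x a = p (phi x (i a)).
Proof. by rewrite /compress_rep locked_withE comp_lfunE compressE. Qed.

Lemma compress_rep_lie (A : vectType K) (p : 'Hom(M, A)) (i : 'Hom(A, M)) x y z :
  phi z = lcomm (phi x) (phi y) ->
  (forall a, p (phi x (i (p (phi y (i a))))) = p (phi x (phi y (i a)))) ->
  (forall a, p (phi y (i (p (phi x (i a))))) = p (phi y (phi x (i a)))) ->
  compress_rep p i z = lcomm (compress_rep p i x) (compress_rep p i y).
Proof.
move=> zE hx hy; apply/lfunP => a.
rewrite lcommE !compress_repE hx hy zE.
by rewrite lcommE linearB.
Qed.
End CompressRep.

(** * Complete reducibility of modules over a centerless algebra *)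

Section CenterlessModules.
Variables (C : numClosedFieldType) (V : vectType C) (S : {vspace 'End(V)}).
Hypothesis S_lie : {in S &, forall f g, lcomm f g \in S}.
Hypothesis S_semisimple : semisimple (fun s : subvs_of S => vsval s).
Hypothesis S_centerless : {in S, forall s, {in S, forall t, lcomm s t = 0} -> s = 0}.

(** Whitehead's first lemma by devissage along a stable U: solve modulo U, which is done on a linear
    complement; subtract that coboundary; then solve for the remaining cocycle, which has values in
    U. *)
Lemma cocycle_coboundary (M : vectType C) (phi : 'Hom('End(V), 'End(M))) (d : 'Hom('End(V), M)) :
  {in S &, forall f g, phi (lcomm f g) = lcomm (phi f) (phi g)} ->
  {in S &, forall f g, d (lcomm f g) = phi f (d g) - phi g (d f)} ->
  exists m, {in S, forall s, d s = phi s m}.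
Proof.
have [n] := ubnP (\dim {:M}); elim: n => // n IHn in M phi d *; rewrite ltnS => dM phi_lie dS.
have [M0|M0] := eqVneq (fullv : {vspace M}) 0%VS.
  exists 0 => s sS; rewrite linear0; apply/eqP.
  by rewrite -memv0 -M0 memvf.
have [irr|] := pselect (irreducible_family (fun s : subvs_of S => phi (vsval s))).
  exact: (cocycle_irreducible S_lie S_semisimple S_centerless phi_lie irr dS).
move=> /(reducible_stable M0)[U [sU U0 U1]].
have {}sU s u : s \in S -> u \in U -> phi s u \in U.
  by move=> sS uU; rewrite -(vsprojK sS); apply: sU.
pose W := (U^C)%VS.
have UW0 : (U :&: W)%VS = 0%VS := capv_compl U.
have WU0 : (W :&: U)%VS = 0%VS := compl_disjoint U.
have UW1 : (U + W)%VS = fullv := addv_complf U.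
have WU1 : (W + U)%VS = fullv by rewrite addvC.
pose iU := sub_incl U; pose pU := sub_proj U W; pose iW := sub_incl W; pose pW := sub_proj W U.
have dU : (\dim {: subvs_of U} < n)%N.
  rewrite (leq_trans _ dM) // dimvf /dim /= ltn_neqAle dimvS ?subvf // andbT.
  by apply: contraNneq U1 => dE; rewrite eqEdim subvf dE leqnn.
have dW : (\dim {: subvs_of W} < n)%N.
  rewrite (leq_trans _ dM) // dimvf /dim /= dimv_compl ltn_subrL !lt0n !dimv_eq0 U0.
  by apply: contraNneq U0 => E; rewrite -subv0 -E subvf.
have pWs s m : s \in S -> pW (phi s (iW (pW m))) = pW (phi s m).
  move=> sS; rewrite -[in RHS](sub_proj_decomp UW0 UW1 m) !linearD /=.
  rewrite [X in _ = X + _](sub_proj_other WU0 WU1) ?add0r //.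
  by rewrite sU // sub_incl_mem.
have iUs s u : s \in S -> iU (pU (phi s (iU u))) = phi s (iU u).
  by move=> sS; rewrite sub_incl_projK // sU // sub_incl_mem.
have [|f g fS gS|mW mWP] := IHn _ (compress_rep phi pW iW) (pW \o d)%VF dW.
- move=> f g fS gS; apply: compress_rep_lie; first exact: phi_lie.
    by move=> a; rewrite pWs.
  by move=> a; rewrite pWs.
- by rewrite !comp_lfunE dS // linearB /= !compress_repE !pWs.
pose d' := (d - (linfun (@lfun_eval _ _ _ (iW mW)) \o phi))%VF.
have d'E s : d' s = d s - phi s (iW mW) by rewrite /d' add_lfunE opp_lfunE comp_lfunE lfunE.
have d'U s : s \in S -> iU (pU (d' s)) = d' s.
  move=> sS; rewrite -[RHS](sub_proj_decomp UW0 UW1); rewrite -/iU -/pU -/iW -/pW.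
  suff -> : pW (d' s) = 0 by rewrite [iW 0]linear0 addr0.
  by rewrite d'E linearB /=; have := mWP s sS; rewrite comp_lfunE compress_repE => ->; rewrite subrr.
have d'S f g : f \in S -> g \in S -> d' (lcomm f g) = phi f (d' g) - phi g (d' f).
  move=> fS gS; rewrite !d'E dS // phi_lie // {1}lcommE !linearB /=.
  by rewrite addrACA.
have [|f g fS gS|mU mUP] := IHn _ (compress_rep phi pU iU) (pU \o d')%VF dU.
- move=> f g fS gS; apply: compress_rep_lie; first exact: phi_lie.
    by move=> a; rewrite iUs.
  by move=> a; rewrite iUs.
- by rewrite !comp_lfunE d'S // linearB /= !compress_repE !d'U.
exists (iU mU + iW mW) => s sS; rewrite linearD /=.
have := congr1 iU (mUP s sS); rewrite comp_lfunE compress_repE d'U // iUs // d'E.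
by move=> <-; rewrite subrK.
Qed.

(** The off-diagonal block [d] of the action, relative to U and a linear complement W, is a cocycle
    with values in Hom(W,U). If it is the coboundary of [f], then the graph of -f over W is a stable
    complement. *)
Theorem centerless_semisimple (M : vectType C) (phi : 'Hom('End(V), 'End(M))) :
  {in S &, forall f g, phi (lcomm f g) = lcomm (phi f) (phi g)} ->
  semisimple (fun s : subvs_of S => phi (vsval s)).
Proof.
move=> phi_lie U sU'.
have {sU'} sU s u : s \in S -> u \in U -> phi s u \in U.
  by move=> sS uU; rewrite -(vsprojK sS); apply: sU'.
pose W := (U^C)%VS.
have UW0 : (U :&: W)%VS = 0%VS := capv_compl U.
have WU0 : (W :&: U)%VS = 0%VS := compl_disjoint U.
have UW1 : (U + W)%VS = fullv := addv_complf U.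
have WU1 : (W + U)%VS = fullv by rewrite addvC.
pose iU := sub_incl U; pose pU := sub_proj U W; pose iW := sub_incl W; pose pW := sub_proj W U.
have iUpW m : iU (pU m) + iW (pW m) = m by apply: sub_proj_decomp.
have pWU m : m \in U -> pW m = 0 by apply: sub_proj_other.
have pWs s m : s \in S -> pW (phi s (iW (pW m))) = pW (phi s m).
  move=> sS; rewrite -[in RHS](iUpW m) !linearD /= [X in _ = X + _]pWU ?add0r //.
  by rewrite sU // sub_incl_mem.
have iUs s u : s \in S -> iU (pU (phi s (iU u))) = phi s (iU u).
  by move=> sS; rewrite [LHS]sub_incl_projK // sU // sub_incl_mem.
pose psiU := compress_rep phi pU iU; pose psiW := compress_rep phi pW iW.
pose psi := hom_act psiW psiU.
have psi_lie : {in S &, forall f g, psi (lcomm f g) = lcomm (psi f) (psi g)}.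
  move=> f g fS gS; apply: hom_act_lie; apply: compress_rep_lie; rewrite ?phi_lie //.
  - by move=> a; rewrite pWs.
  - by move=> a; rewrite pWs.
  - by move=> a; rewrite iUs.
  - by move=> a; rewrite iUs.
have [d dE] : exists d : 'Hom('End(V), 'Hom(subvs_of W, subvs_of U)),
    forall s w, d s w = pU (phi s (iW w)).
  by exists (compress pU iW \o phi)%VF => s w; rewrite comp_lfunE compressE.
have [|f fP] := cocycle_coboundary psi_lie (d := d).
  move=> s t sS tS; apply/lfunP => w; rewrite dE phi_lie //.
  rewrite /psi lcommE add_lfunE opp_lfunE !hom_act_applyE !dE.
  rewrite !compress_repE -/pU -/pW -/iU -/iW.
  have key r m : pU (phi r m) = pU (phi r (iU (pU m))) + pU (phi r (iW (pW m))).
    by rewrite -[in LHS](iUpW m) !linearD.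
  rewrite linearB /= (key s (phi t _)) (key t (phi s (iW w))) opprB [RHS]addrACA opprD.
  by congr (_ + _); rewrite addrC.
pose j := (iW - (iU \o f))%VF.
have jE w : j w = iW w - iU (f w) by rewrite /j add_lfunE opp_lfunE comp_lfunE.
have js s w : s \in S -> phi s (j w) = j (pW (phi s (iW w))).
  move=> sS; have := congr1 (fun h : 'Hom(_, _) => iU (h w)) (fP s sS).
  rewrite /psi dE hom_act_applyE linearB /= !compress_repE -/pW -/iW.
  rewrite -/iU -/pU iUs // => e1.
  rewrite !jE linearB /= -[X in X - _ = _]iUpW e1.
  by rewrite addrAC addrC addrAC subrr sub0r addrC.
have pWj w : pW (j w) = w.
  by rewrite jE linearB /= [pW (iU _)]pWU ?subr0 ?sub_incl_mem // [LHS]sub_proj_inclK.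
exists (limg j); split.
- move=> s _ /memv_imgP[w _ ->]; rewrite js ?subvsP //.
  by apply: memv_img; rewrite memvf.
- apply/eqP; rewrite eqEsubv subvf; apply/subvP => m _.
  have -> : m = iU (pU m + f (pW m)) + j (pW m).
    by rewrite jE linearD /= addrACA subrr addr0 iUpW.
  by rewrite memv_add ?sub_incl_mem // memv_img // memvf.
- apply/eqP; rewrite -subv0; apply/subvP => m /memv_capP[mU /memv_imgP[w _ mE]].
  by rewrite memv0 mE -(pWj w) -mE pWU // linear0.
Qed.
End CenterlessModules.

(** * Subobjects, quotients and direct sums of semisimple families *)

Section SemisimpleClosure.
Variables (K : fieldType) (I : Type).

Lemma semisimple_stable_iff (J : Type) (M : vectType K) (r : I -> 'End(M)) (s : J -> 'End(M)) :
  (forall U, stable r U <-> stable s U) -> semisimple r -> semisimple s.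
Proof.
by move=> rs ssr U /rs/ssr[W [/rs sW UW1 UW0]]; exists W.
Qed.

Variables (A B M : vectType K) (rA : I -> 'End(A)) (rB : I -> 'End(B)) (rM : I -> 'End(M)).

Lemma semisimple_sub (i : 'Hom(A, M)) :
  (forall a, i a = 0 -> a = 0) -> (forall x a, i (rA x a) = rM x (i a)) ->
  semisimple rM -> semisimple rA.
Proof.
move=> i0 ir ssM U sU.
have [|W [sW UW1 UW0]] := ssM (i @: U)%VS.
  by move=> x _ /memv_imgP[u uU ->]; rewrite -ir memv_img // sU.
exists (i @^-1: W)%VS; split.
- by move=> x a; rewrite -!memv_preim ir; apply: sW.
- apply/eqP; rewrite eqEsubv subvf; apply/subvP => a _.
  have : i a \in (i @: U + W)%VS by rewrite UW1 memvf.
  case/memv_addP => _ /memv_imgP[u uU ->] [w wW E].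
  rewrite -[a](subrK u) addrC memv_add // -memv_preim linearB /= E.
  by rewrite [i u + w]addrC addrK.
- apply/eqP; rewrite -subv0; apply/subvP => u /memv_capP[uU]; rewrite -memv_preim => iuW.
  rewrite memv0; apply/eqP/i0/eqP.
  by rewrite -memv0 -UW0 memv_cap iuW andbT memv_img.
Qed.

Lemma semisimple_quotient (p : 'Hom(M, A)) :
  (forall a, exists m, p m = a) -> (forall x m, p (rM x m) = rA x (p m)) ->
  semisimple rM -> semisimple rA.
Proof.
move=> ps pr ssM U sU.
have [|W [sW UW1 UW0]] := ssM (p @^-1: U)%VS.
  by move=> x m; rewrite -!memv_preim pr; apply: sU.
exists (p @: W)%VS; split.
- by move=> x _ /memv_imgP[w wW ->]; rewrite -pr memv_img // sW.
- apply/eqP; rewrite eqEsubv subvf; apply/subvP => a _; have [m <-] := ps a.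
  have : m \in (p @^-1: U + W)%VS by rewrite UW1 memvf.
  case/memv_addP => u uU [w wW ->]; rewrite linearD memv_add ?memv_img //.
  by rewrite -memv_preim in uU.
- apply/eqP; rewrite -subv0; apply/subvP => z /memv_capP[uU /memv_imgP[w wW E]].
  rewrite memv0 E; suff : w \in 0%VS by rewrite memv0 => /eqP->; rewrite linear0.
  by rewrite -UW0 memv_cap wW andbT -memv_preim -E.
Qed.

(** A complement of U is obtained by adding a complement in A of the intersection of U with A and a
    complement in B of the projection of U. *)
Lemma semisimple_direct_sum (iA : 'Hom(A, M)) (pA : 'Hom(M, A)) (iB : 'Hom(B, M)) (pB : 'Hom(M, B)) :
  (forall m, iA (pA m) + iB (pB m) = m) -> (forall a, pB (iA a) = 0) -> (forall b, pB (iB b) = b) ->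
  (forall a, pA (iA a) = a) ->
  (forall x a, iA (rA x a) = rM x (iA a)) -> (forall x b, iB (rB x b) = rM x (iB b)) ->
  semisimple rA -> semisimple rB -> semisimple rM.
Proof.
move=> decomp pBiA pBiB pAiA irA irB ssA ssB U sU.
have pBr x m : pB (rM x m) = rB x (pB m).
  by rewrite -[in LHS](decomp m) !linearD /= -irA -irB pBiA pBiB add0r.
have [|C1 [sC1 U1 U10]] := ssA (iA @^-1: U)%VS.
  by move=> x a; rewrite -!memv_preim irA; apply: sU.
have [|C2 [sC2 U2 U20]] := ssB (pB @: U)%VS.
  by move=> x _ /memv_imgP[u uU ->]; rewrite -pBr memv_img // sU.
exists (iA @: C1 + iB @: C2)%VS; split.
- by apply: stableD => x _ /memv_imgP[c cC ->]; rewrite -?irA -?irB memv_img // ?sC1 ?sC2.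
- apply/eqP; rewrite eqEsubv subvf; apply/subvP => m _.
  have : pB m \in (pB @: U + C2)%VS by rewrite U2 memvf.
  case/memv_addP => _ /memv_imgP[u uU ->] [c2 c2C mE].
  have : pA (m - u) \in (iA @^-1: U + C1)%VS by rewrite U1 memvf.
  case/memv_addP => a; rewrite -memv_preim => aU [c1 c1C aE].
  have -> : m = (u + iA a) + (iA c1 + iB c2).
    rewrite -addrA [iA a + _]addrA -linearD -aE -[c2](addKr (pB u)) -mE addrC.
    by rewrite [_ + pB m]addrC -linearB decomp subrK.
  by apply: memv_add; [apply: memvD|apply: memv_add; apply: memv_img].
- apply/eqP; rewrite -subv0; apply/subvP => m /memv_capP[mU] /memv_addP.
  case=> _ /memv_imgP[c1 c1C ->] [_ /memv_imgP[c2 c2C ->] mE].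
  have c20 : c2 = 0.
    apply/eqP; rewrite -memv0 -U20 memv_cap c2C andbT.
    by have := memv_img pB mU; rewrite mE linearD /= pBiA pBiB add0r.
  rewrite mE c20 linear0 addr0; suff -> : c1 = 0 by rewrite linear0 mem0v.
  apply/eqP; rewrite -memv0 -U10 memv_cap c1C andbT -memv_preim.
  by rewrite mE c20 linear0 addr0 in mU.
Qed.
End SemisimpleClosure.

(** * Chevalley's theorem *)

Section Traceless.
Variables (K : fieldType) (V : vectType K).

Definition traceless_fun (f : 'End(V)) : 'End(V) :=
  f - (ltrace f / (\dim {:V})%:R) *: \1%VF.

Lemma traceless_fun_is_linear : linear traceless_fun.
Proof.
move=> a f g; rewrite /traceless_fun linearP /= mulrDl scalerDl scalerBr scalerA -mulrA.
by rewrite opprD addrACA.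
Qed.

HB.instance Definition _ := GRing.isSemilinear.Build K _ _ _ traceless_fun
  (GRing.semilinear_linear traceless_fun_is_linear).

Fact traceless_key : unit. Proof. by []. Qed.
Definition traceless : 'End('End(V)) := locked_with traceless_key (linfun traceless_fun).

Lemma tracelessE f v : traceless f v = f v - (ltrace f / (\dim {:V})%:R) *: v.
Proof. by rewrite /traceless locked_withE lfunE /= /traceless_fun add_lfunE opp_lfunE scale_lfunE id_lfunE. Qed.

Lemma traceless_lcomm f g : traceless (lcomm f g) = lcomm (traceless f) (traceless g).
Proof.
have E h : traceless h = (- (ltrace h / (\dim {:V})%:R)) *: \1%VF + h.
  by apply/lfunP => v; rewrite tracelessE add_lfunE scale_lfunE id_lfunE scaleNr addrC.
have C1 h : lcomm \1%VF h = 0 by rewrite /lcomm comp_lfun1l comp_lfun1r subrr.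
rewrite !E ltrace_lcomm0 mul0r oppr0 scale0r add0r lcommP C1 scaler0 add0r.
by rewrite lcommPr [lcomm f \1%VF]lcommC C1 oppr0 scaler0 add0r.
Qed.
End Traceless.

Lemma ltrace_traceless (C : numClosedFieldType) (V : vectType C) (f : 'End(V)) :
  (fullv : {vspace V}) != 0%VS -> ltrace (traceless V f) = 0.
Proof.
move=> V0; rewrite /traceless locked_withE lfunE /= linearB linearZ /= ltrace1 divfK ?subrr //.
by rewrite pnatr_eq0 dimv_eq0.
Qed.

Section RestrictedFamily.
Variables (K : fieldType) (E V : vectType K) (L : {vspace E}).
Implicit Type phi : 'Hom(E, 'End(V)).

Definition restr_family phi (x : subvs_of L) : 'End(V) :=
  phi (vsval x).

Lemma restr_stableP phi U :
  stable (@restr_family phi : subvs_of L -> _) U <-> forall x u, x \in L -> u \in U -> phi x u \in U.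
Proof.
split=> [sU x u xL uU|sU x u uU]; last by apply: sU => //; apply: subvsP.
by rewrite -(vsprojK xL); apply: sU.
Qed.

End RestrictedFamily.
Arguments restr_family {K E V} L phi x.

Section HomSemisimple.
Variables (C : numClosedFieldType) (E : vectType C) (L : {vspace E}) (br : E -> E -> E).
Hypothesis br_closed : forall x y, x \in L -> y \in L -> br x y \in L.

(** [br] may be any operation on [E]: only its effect through representations matters, so the even
    part of a Lie superalgebra is used without being packaged as a Lie algebra. *)
Definition lie_rep (V : vectType C) (phi : 'Hom(E, 'End(V))) :=
  {in L &, forall x y, phi (br x y) = lcomm (phi x) (phi y)}.

(** Removing traces changes the family by scalars only, so Schur's lemma still applies; and a scalar
    of trace zero on a nonzero space is zero in characteristic 0. *)
Lemma schur_traceless (V : vectType C) (phi : 'Hom(E, 'End(V))) (f : 'End(V)) :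
  irreducible_family (restr_family L phi) ->
  (forall x, x \in L -> lcomm f (traceless V (phi x)) = 0) -> ltrace f = 0 -> f = 0.
Proof.
move=> irr fC tr0; have [|a fa] := schur_scalar irr (f := f).
  move=> x v; have /lfunP/(_ v) := fC _ (subvsP x).
  rewrite lcommE !tracelessE zero_lfunE linearB linearZ /=.
  by rewrite subrACA subrr subr0 => /eqP; rewrite subr_eq0 => /eqP.
move: tr0; rewrite fa linearZ /= ltrace1 => /eqP; rewrite mulf_eq0 pnatr_eq0 dimv_eq0.
by rewrite (negPf irr.1) orbF => /eqP->; rewrite scale0r.
Qed.

(** Taking one image in End(V x W), and not one image for each factor, makes V and W modules over
    the same centerless algebra, so that Hom(V,W) is a module over it as well. *)
Lemma hom_act_irreducible_semisimple (V W : vectType C)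
    (phiV : 'Hom(E, 'End(V))) (phiW : 'Hom(E, 'End(W))) :
  lie_rep phiV -> lie_rep phiW ->
  irreducible_family (restr_family L phiV) -> irreducible_family (restr_family L phiW) ->
  semisimple (restr_family L (hom_act phiV phiW)).
Proof.
move=> lieV lieW irrV irrW; pose X := (V * W)%type.
have [iV [pV [iW [pW [iVE pVE iWE pWE]]]]] : exists (iV : 'Hom(V, X)) (pV : 'Hom(X, V))
    (iW : 'Hom(W, X)) (pW : 'Hom(X, W)),
    [/\ forall v, iV v = (v, 0), forall z, pV z = z.1, forall w, iW w = (0, w) & forall z, pW z = z.2].
  have lV : linear (fun v : V => (v, 0) : X).
    by move=> a u v; apply: injective_projections; rewrite /= ?scaler0 ?addr0.
  have lW : linear (fun w : W => (0, w) : X).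
    by move=> a u v; apply: injective_projections; rewrite /= ?scaler0 ?addr0.
  pose fV := GRing.isLinear.Build C V X _ _ lV.
  pose fW := GRing.isLinear.Build C W X _ _ lW.
  pose gV : {linear V -> X} := HB.pack (fun v : V => (v, 0) : X) fV.
  pose gW : {linear W -> X} := HB.pack (fun w : W => (0, w) : X) fW.
  exists (linfun gV), (linfun fst), (linfun gW), (linfun snd).
  by split=> z; rewrite lfunE.
have decomp z : iV (pV z) + iW (pW z) = z.
  by rewrite iVE iWE pVE pWE; apply: injective_projections; rewrite /= ?addr0 ?add0r.
have pVV v : pV (iV v) = v by rewrite iVE pVE.
have pWW v : pW (iW v) = v by rewrite iWE pWE.
have pVW v : pV (iW v) = 0 by rewrite iWE pVE.
have pWV v : pW (iV v) = 0 by rewrite iVE pWE.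
have [sX sXE] : exists sX : 'Hom(E, 'End(X)), forall x z,
    sX x z = iV (traceless V (phiV x) (pV z)) + iW (traceless W (phiW x) (pW z)).
  exists ((compress iV pV \o (traceless V \o phiV)) + (compress iW pW \o (traceless W \o phiW)))%VF.
  by move=> x z; rewrite !add_lfunE !comp_lfunE !compressE.
have pVs x z : pV (sX x z) = traceless V (phiV x) (pV z).
  by rewrite sXE linearD /= pVV pVW addr0.
have pWs x z : pW (sX x z) = traceless W (phiW x) (pW z).
  by rewrite sXE linearD /= pWW pWV add0r.
have sX_lie x y : x \in L -> y \in L -> sX (br x y) = lcomm (sX x) (sX y).
  move=> xL yL; apply/lfunP => z; rewrite -[RHS]decomp sXE; congr (iV _ + iW _).
    rewrite lieV // traceless_lcomm !lcommE.
    by rewrite [RHS]linearB /= !pVs.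
  rewrite lieW // traceless_lcomm !lcommE.
  by rewrite [RHS]linearB /= !pWs.
pose S := (sX @: L)%VS.
have S_lie : {in S &, forall f g, lcomm f g \in S}.
  move=> _ _ /memv_imgP[x xL ->] /memv_imgP[y yL ->].
  by rewrite -sX_lie // memv_img // br_closed.
have stable_shift (M : vectType C) (U : {vspace M}) (f g : 'End(M)) (c : C) :
    (forall m, f m = g m - c *: m) -> (forall u, u \in U -> f u \in U) ->
    forall u, u \in U -> g u \in U.
  by move=> fg fU u uU; rewrite -[g u](subrK (c *: u)) -fg memvD ?fU ?memvZ.
have irr_tr (M : vectType C) (phi : 'Hom(E, 'End(M))) (p : 'Hom(X, M)) (i : 'Hom(M, X)) :
    (forall x v, p (sX x (i v)) = traceless M (phi x) v) ->
    irreducible_family (restr_family L phi) ->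
    semisimple (fun s : subvs_of S => compress p i (vsval s)).
  move=> pis irr; apply: irreducible_semisimple; split=> [|U sU]; first exact: irr.1.
  apply: irr.2; apply/restr_stableP => x u xL.
  apply: (stable_shift _ _ (traceless M (phi x))) => [m|{}u uU]; first exact: tracelessE.
  have xS : sX x \in S by rewrite memv_img.
  by rewrite -pis -compressE -(vsprojK xS); apply: sU.
have sX_ss : semisimple (fun s : subvs_of S => vsval s).
  apply: (semisimple_direct_sum (iA := iV) (pA := pV) (iB := iW) (pB := pW)
    (rA := fun s : subvs_of S => compress pV iV (vsval s))
    (rB := fun s : subvs_of S => compress pW iW (vsval s))) => //.
  - move=> [s /= /memv_imgP[x xL ->]] v.
    by rewrite compressE -[RHS]decomp pWs pWV linear0 linear0 addr0.
  - move=> [s /= /memv_imgP[x xL ->]] v.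
    by rewrite compressE -[RHS]decomp pVs pVW linear0 linear0 add0r.
  - by apply: irr_tr irrV => x v; rewrite pVs pVV.
  - by apply: irr_tr irrW => x v; rewrite pWs pWW.
(* A central element commutes, block by block, with two irreducible families, and both of its blocks
   are traceless. *)
have S_cent : {in S, forall s, {in S, forall t, lcomm s t = 0} -> s = 0}.
  move=> _ /memv_imgP[x xL ->] xC.
  have xC' y z : y \in L -> sX x (sX y z) = sX y (sX x z).
    move=> yL; have /lfunP/(_ z) := xC _ (memv_img sX yL).
    by rewrite lcommE zero_lfunE => /eqP; rewrite subr_eq0 => /eqP.
  have V0 : traceless V (phiV x) = 0.
    apply: (schur_traceless irrV) => [y yL|]; last exact: ltrace_traceless irrV.1.
    apply/lfunP => v; rewrite lcommE zero_lfunE.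
    by rewrite -{1 2}(pVV v) -!pVs xC' // subrr.
  have W0 : traceless W (phiW x) = 0.
    apply: (schur_traceless irrW) => [y yL|]; last exact: ltrace_traceless irrW.1.
    apply/lfunP => v; rewrite lcommE zero_lfunE.
    by rewrite -{1 2}(pWW v) -!pWs xC' // subrr.
  by apply/lfunP => z; rewrite sXE V0 W0 !zero_lfunE !linear0 addr0.
have compr_lie (M : vectType C) (phi : 'Hom(E, 'End(M))) (p : 'Hom(X, M)) (i : 'Hom(M, X)) :
    (forall x z, p (sX x z) = traceless M (phi x) (p z)) -> (forall m, p (i m) = m) ->
    {in S &, forall f g, compress p i (lcomm f g) = lcomm (compress p i f) (compress p i g)}.
  move=> ps pii _ _ /memv_imgP[x xL ->] /memv_imgP[y yL ->]; apply/lfunP => m.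
  rewrite lcommE !compressE add_lfunE opp_lfunE !comp_lfunE.
  by rewrite linearB /= !ps !pii.
apply: (@semisimple_stable_iff _ _ _ _
  (fun s : subvs_of S => hom_act (compress pV iV) (compress pW iW) (vsval s))); last first.
  apply: centerless_semisimple => // f g fS gS.
  by apply: hom_act_lie; [apply: (compr_lie V phiV)|apply: (compr_lie W phiW)].
move=> U.
have actE x f : hom_act (compress pV iV) (compress pW iW) (sX x) f = hom_act phiV phiW x f -
    (ltrace (phiW x) / (\dim {:W})%:R - ltrace (phiV x) / (\dim {:V})%:R) *: f.
  apply/lfunP => v; rewrite add_lfunE opp_lfunE scale_lfunE !hom_act_applyE.
  rewrite !compressE pWs pVs pVV pWW !tracelessE (linearB f) [X in _ - (_ - X)]linearZ /= scalerBl.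
  by rewrite subrACA.
rewrite restr_stableP; split=> [sU x u xL|sU [s /= /memv_imgP[x xL ->]] u uU].
  apply: (stable_shift _ _ (hom_act (compress pV iV) (compress pW iW) (sX x)) _ _ (actE x)) => v vU.
  have xS : sX x \in S by rewrite memv_img.
  by rewrite -(vsprojK xS); apply: sU.
by rewrite actE memvB ?memvZ ?sU.
Qed.

(** Hom is additive in each argument, so a proper decomposition of W or of V lowers dim V + dim W
    until both are irreducible. *)
Theorem hom_act_semisimple (V W : vectType C)
    (phiV : 'Hom(E, 'End(V))) (phiW : 'Hom(E, 'End(W))) :
  lie_rep phiV -> lie_rep phiW ->
  semisimple (restr_family L phiV) -> semisimple (restr_family L phiW) ->
  semisimple (restr_family L (hom_act phiV phiW)).
Proof.
have [n] := ubnP (\dim {:V} + \dim {:W}); elim: n => // n IHn in V W phiV phiW *.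
rewrite ltnS => dVW lieV lieW ssV ssW.
have trivial_ss (M : vectType C) (r : subvs_of L -> 'End(M)) : (fullv : {vspace M}) = 0%VS -> semisimple r.
  move=> M0 U _; exists 0%VS; split; [exact: stable0| |by rewrite capv0].
  by apply/eqP; rewrite addv0 eqEsubv subvf M0 sub0v.
have split_rep (M : vectType C) (phi : 'Hom(E, 'End(M))) : lie_rep phi ->
    semisimple (restr_family L phi) -> (fullv : {vspace M}) != 0%VS ->
    ~ irreducible_family (restr_family L phi) ->
    exists (A B : vectType C) (iA : 'Hom(A, M)) (pA : 'Hom(M, A)) (iB : 'Hom(B, M)) (pB : 'Hom(M, B))
      (phiA : 'Hom(E, 'End(A))) (phiB : 'Hom(E, 'End(B))),
    [/\ [/\ (\dim {:A} < \dim {:M})%N, (\dim {:B} < \dim {:M})%N, lie_rep phiA & lie_rep phiB],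
      [/\ semisimple (restr_family L phiA), semisimple (restr_family L phiB),
      {in L, forall x a, iA (phiA x a) = phi x (iA a)} &
      {in L, forall x a, iB (phiB x a) = phi x (iB a)}],
      (forall m, iA (pA m) + iB (pB m) = m) &
      [/\ forall a, pB (iA a) = 0, forall b, pA (iB b) = 0,
      forall a, pA (iA a) = a & forall b, pB (iB b) = b]].
  move=> lieM ssM M0 /(reducible_stable M0)[U [sU U0 U1]].
  have [W' [sW UW1 UW0]] := ssM U sU.
  have WU0 : (W' :&: U)%VS = 0%VS by rewrite capvC.
  have WU1 : (W' + U)%VS = fullv by rewrite addvC.
  have sub_ok (T T' : {vspace M}) : (T :&: T')%VS = 0%VS -> (T + T')%VS = fullv ->
      T != fullv -> stable (restr_family L phi) T ->
      let psi := compress_rep phi (sub_proj T T') (sub_incl T) in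
      [/\ (\dim {: subvs_of T} < \dim {:M})%N, lie_rep psi, semisimple (restr_family L psi) &
        {in L, forall x a, sub_incl T (psi x a) = phi x (sub_incl T a)}].
    move=> T0 T1 Tf /restr_stableP sT psi.
    have ipsi : {in L, forall x a, sub_incl T (psi x a) = phi x (sub_incl T a)}.
      by move=> x xL a; rewrite compress_repE sub_incl_projK // sT // sub_incl_mem.
    split=> //.
    - rewrite dimvf /dim /= ltn_neqAle dimvS ?subvf // andbT.
      by apply: contraNneq Tf => dE; rewrite eqEdim subvf dE leqnn.
    - move=> x y xL yL; apply: compress_rep_lie; first exact: lieM.
        by move=> a; rewrite sub_incl_projK // sT // sub_incl_mem.
      by move=> a; rewrite sub_incl_projK // sT // sub_incl_mem.
    - apply: semisimple_sub ssM => [a a0|x a]; last exact: (ipsi _ (subvsP x)).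
      by apply: subvs_inj; rewrite linear0 -a0 sub_inclE.
  have W1 : W' != fullv by apply: contraNneq U0 => WE; rewrite -UW0 WE capvf.
  have [dA lieA ssA ipA] := sub_ok U W' UW0 UW1 U1 sU.
  have [dB lieB ssB ipB] := sub_ok W' U WU0 WU1 W1 sW.
  exists (subvs_of U), (subvs_of W'), (sub_incl U), (sub_proj U W'), (sub_incl W'), (sub_proj W' U).
  exists (compress_rep phi (sub_proj U W') (sub_incl U)), (compress_rep phi (sub_proj W' U) (sub_incl W')).
  split=> //; first by move=> m; apply: sub_proj_decomp.
  split=> a.
  - by apply: sub_proj_other => //; apply: sub_incl_mem.
  - by apply: sub_proj_other => //; apply: sub_incl_mem.
  - exact: sub_proj_inclK.
  - exact: sub_proj_inclK.
have [V0|V0] := eqVneq (fullv : {vspace V}) 0%VS.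
  apply: trivial_ss; apply/eqP; rewrite -dimv_eq0 dimvf /dim /=.
  by move/eqP: V0; rewrite -dimv_eq0 dimvf => /eqP->.
have [W0|W0] := eqVneq (fullv : {vspace W}) 0%VS.
  apply: trivial_ss; apply/eqP; rewrite -dimv_eq0 dimvf /dim /=.
  by move/eqP: W0; rewrite -dimv_eq0 dimvf => /eqP->; rewrite muln0.
have [irrV|nirrV] := pselect (irreducible_family (restr_family L phiV)).
  have [irrW|nirrW] := pselect (irreducible_family (restr_family L phiW)).
    exact: hom_act_irreducible_semisimple.
  have [A [B [iA [pA [iB [pB [pA' [pB' [[dA dB lieA lieB] [ssA ssB iAs iBs] dec
    [pBA pAB pAA pBB]]]]]]]]]] := split_rep W phiW lieW ssW W0 nirrW.
  apply: (semisimple_direct_sum (iA := compress iA \1%VF) (pA := compress pA \1%VF)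
    (iB := compress iB \1%VF) (pB := compress pB \1%VF)
    (rA := restr_family L (hom_act phiV pA')) (rB := restr_family L (hom_act phiV pB'))).
  - move=> f; apply/lfunP => v; rewrite add_lfunE !compressE !id_lfunE; exact: dec.
  - by move=> f; apply/lfunP => v; rewrite !compressE !id_lfunE pBA zero_lfunE.
  - by move=> f; apply/lfunP => v; rewrite !compressE !id_lfunE pBB.
  - by move=> f; apply/lfunP => v; rewrite !compressE !id_lfunE pAA.
  - move=> x f; apply/lfunP => v; rewrite /restr_family !(hom_act_applyE, compressE).
    by rewrite ?compressE !id_lfunE linearB /= iAs ?subvsP.
  - move=> x f; apply/lfunP => v; rewrite /restr_family !(hom_act_applyE, compressE).
    by rewrite ?compressE !id_lfunE linearB /= iBs ?subvsP.
  - by apply: IHn => //; apply: leq_trans dVW; rewrite ltn_add2l.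
  - by apply: IHn => //; apply: leq_trans dVW; rewrite ltn_add2l.
have [A [B [iA [pA [iB [pB [pA' [pB' [[dA dB lieA lieB] [ssA ssB iAs iBs] dec
    [pBA pAB pAA pBB]]]]]]]]]] := split_rep V phiV lieV ssV V0 nirrV.
have pAs x v : x \in L -> pA (phiV x v) = pA' x (pA v).
  by move=> xL; rewrite -[in LHS](dec v) !linearD /= -iAs // -iBs // pAA pAB addr0.
have pBs x v : x \in L -> pB (phiV x v) = pB' x (pB v).
  by move=> xL; rewrite -[in LHS](dec v) !linearD /= -iAs // -iBs // pBA pBB add0r.
apply: (semisimple_direct_sum (iA := compress \1%VF pA) (pA := compress \1%VF iA)
  (iB := compress \1%VF pB) (pB := compress \1%VF iB)
  (rA := restr_family L (hom_act pA' phiW)) (rB := restr_family L (hom_act pB' phiW))).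
- move=> f; apply/lfunP => v; rewrite add_lfunE !compressE !id_lfunE -linearD; congr (f _); exact: dec.
- by move=> f; apply/lfunP => v; rewrite !compressE !id_lfunE pAB linear0 zero_lfunE.
- by move=> f; apply/lfunP => v; rewrite !compressE !id_lfunE pBB.
- by move=> f; apply/lfunP => v; rewrite !compressE !id_lfunE pAA.
- move=> x f; apply/lfunP => v; rewrite /restr_family !(hom_act_applyE, compressE).
  by rewrite ?compressE !id_lfunE pAs ?subvsP.
- move=> x f; apply/lfunP => v; rewrite /restr_family !(hom_act_applyE, compressE).
  by rewrite ?compressE !id_lfunE pBs ?subvsP.
- by apply: IHn => //; apply: leq_trans dVW; rewrite ltn_add2r.
- by apply: IHn => //; apply: leq_trans dVW; rewrite ltn_add2r.
Qed.
End HomSemisimple.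

(** * Membership in F as complete reducibility over the even part *)

Section EvenSemisimple.
Variables (K : fieldType) (g : lieSuperalgebra K) (M : supermodule g).
Implicit Types U W : {vspace M}.

Definition even_family : subvs_of (lie_gr g false) -> 'End(M) :=
  restr_family (lie_gr g false) (mod_act M).

Definition graded U := (U :&: mod_gr M false + U :&: mod_gr M true)%VS = U.

Lemma even_subsupermoduleP U : even_subsupermodule U <-> graded U /\ stable even_family U.
Proof. by rewrite /even_family restr_stableP. Qed.

Lemma graded_sum U (T : bool -> {vspace M}) :
  (forall i, (T i <= mod_gr M i)%VS) -> U = (T false + T true)%VS -> graded U.
Proof.
move=> Ti UE; apply/eqP; rewrite eqEsubv subv_add !capvSl /= {1}UE.
by apply: addvS; rewrite subv_cap Ti UE ?addvSl ?addvSr.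
Qed.

Lemma graded_cap U W : graded U -> graded W -> graded (U :&: W)%VS.
Proof.
move=> gU gW; apply/eqP; rewrite eqEsubv subv_add !capvSl /=.
apply/subvP => v /memv_capP[]; rewrite -{1}gU -{1}gW.
move=> /memv_addP[u0 /memv_capP[u0U u0p] [u1 /memv_capP[u1U u1p] ->]].
move=> /memv_addP[w0 /memv_capP[w0W w0p] [w1 /memv_capP[w1W w1p] E]].
have /eqP E0 : u0 - w0 == 0.
  rewrite -memv0 -(grading_cap (mod_gr M)) memv_cap memvB //=.
  have -> : u0 - w0 = w1 - u1.
    by apply/eqP; rewrite subr_eq addrAC -subr_eq opprK E addrC.
  exact: memvB.
have uw0 : u0 = w0 by apply/eqP; rewrite -subr_eq0 E0.
have uw1 : u1 = w1 by apply: (addrI u0); rewrite E uw0.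
by apply: memv_add; rewrite !memv_cap ?u0U ?u1U ?u0p ?u1p ?uw0 ?uw1 ?w0W ?w1W.
Qed.

Lemma stable_gr i : stable even_family (mod_gr M i).
Proof.
apply/restr_stableP => x m xL mi.
by have := mod_act_deg xL mi.
Qed.

Lemma graded_sub_gr U i : (U <= mod_gr M i)%VS -> graded U.
Proof.
move=> Ui; apply: (@graded_sum _ (fun j => if j == i then U else 0%VS)).
  by move=> j; case: eqP => [->|]; rewrite ?sub0v.
by case: i {Ui}; rewrite ?add0v ?addv0.
Qed.

(** Even elements preserve parity, so the homogeneous parts of U are themselves subsupermodules; one
    of them is nonzero, hence all of U. *)
Lemma even_simple_parity U : even_simple U -> exists i, (U <= mod_gr M i)%VS.
Proof.
move=> [/even_subsupermoduleP[gU sU] U0 Usimple].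
have [i Ui] : exists i, (U :&: mod_gr M i)%VS <> 0%VS.
  apply: contrapT => nU; apply: U0; rewrite -gU.
  have U0 i : (U :&: mod_gr M i)%VS = 0%VS.
    by apply: contrapT => Ui; apply: nU; exists i.
  by rewrite !U0 addv0.
exists i; have [|||UE] := Usimple (U :&: mod_gr M i)%VS => //.
- apply/even_subsupermoduleP; split; first exact: graded_sub_gr (capvSr _ _).
  by apply: stableI => //; apply: stable_gr.
- exact: capvSl.
- by rewrite -UE capvSr.
Qed.

(** [T] need not be graded, while simplicity of the summands only tests graded subspaces. A summand
    has a single parity, so its intersection with T + W is graded anyway, hence zero unless T + W
    contains the summand. Thus W can grow by a summand until T + W is everything. *)
Lemma in_F_semisimple : in_F M -> semisimple even_family.
Proof.
case=> k [U [Usimple Usum _]] T sT.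
suff grow n W : stable even_family W -> (T :&: W)%VS = 0%VS ->
    (\dim {:M} - \dim (T + W) < n)%N ->
    exists W, [/\ stable even_family W, (T + W)%VS = fullv & (T :&: W)%VS = 0%VS].
  exact: (grow _ 0%VS (stable0 _) (capv0 _) (ltnSn _)).
elim: n W => // n IHn W sW TW0; rewrite ltnS => dn.
have [TW1|TW1] := eqVneq (T + W)%VS fullv; first by exists W.
have [i Ui] : exists i, ~~ (U i <= T + W)%VS.
  apply: contrapT => nU; case/negP: TW1; rewrite eqEsubv subvf -Usum.
  by apply/subv_sumP => i _; apply: contrapT => /negP Ui; apply: nU; exists i.
have [[gU sU] U0 Ui_min] := Usimple i.
have sU' : stable even_family (U i) by apply/restr_stableP.
have [p Up] := even_simple_parity (Usimple i).
have capU : (U i :&: (T + W))%VS = 0%VS.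
  have [|||UE] := Ui_min (U i :&: (T + W))%VS => //.
  - apply/even_subsupermoduleP; split; first exact: graded_sub_gr (subv_trans (capvSl _ _) Up).
    by apply: stableI => //; apply: stableD.
  - exact: capvSl.
  - by case/negP: Ui; rewrite -UE capvSr.
apply: (IHn (W + U i)%VS); first exact: stableD.
  apply/eqP; rewrite -subv0; apply/subvP => t /memv_capP[tT /memv_addP[w wW [u uU tE]]].
  have u0 : u = 0.
    have uE : u = t - w by rewrite tE [w + u]addrC addrK.
    by apply/eqP; rewrite -memv0 -capU memv_cap uU uE memv_add ?memvN.
  by rewrite -TW0 memv_cap tT tE u0 addr0.
have dT : (\dim (T + W) < \dim (T + (W + U i)))%N.
  have -> : (\dim (T + (W + U i)) = \dim (T + W) + \dim (U i))%N.
    by rewrite addvA dimv_disjoint_sum // capvC.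
  by rewrite -addn1 leq_add2l lt0n dimv_eq0; apply/eqP.
have le1 : (\dim (T + (W + U i)) <= \dim {:M})%N by rewrite dimvS ?subvf.
by rewrite (leq_trans _ dn) // ltn_sub2l // (leq_trans dT).
Qed.

(** Complements are chosen separately inside the even and the odd part and then added. *)
Lemma graded_complement U : semisimple even_family -> graded U -> stable even_family U ->
  exists W, [/\ graded W, stable even_family W, (U + W)%VS = fullv & (U :&: W)%VS = 0%VS].
Proof.
move=> ss gU sU.
have ex i : exists W, [/\ stable even_family W, (W <= mod_gr M i)%VS,
    (U :&: mod_gr M i + W)%VS = mod_gr M i & (U :&: W)%VS = 0%VS].
  have [|W [sW UW1 UW0]] := ss (U :&: mod_gr M i)%VS.
    by apply: stableI => //; apply: stable_gr.
  exists (W :&: mod_gr M i)%VS; split; first by apply: stableI => //; apply: stable_gr.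
  - exact: capvSr.
  - by rewrite vspace_modl ?capvSr // UW1 capfv.
  - by apply/eqP; rewrite -subv0 -UW0 [(W :&: _)%VS]capvC capvA.
have [W0 [sW0 W0p W0s W0c]] := ex false; have [W1 [sW1 W1p W1s W1c]] := ex true.
have gW : graded (W0 + W1)%VS.
  by apply: (@graded_sum _ (fun i => if i then W1 else W0)) => // -[].
exists (W0 + W1)%VS; split=> //; first exact: stableD.
  apply/eqP; rewrite eqEsubv subvf -(grading_sum (mod_gr M)) -W0s -W1s !subv_add.
  rewrite !(subv_trans (capvSl _ _) (addvSl _ _)) (subv_trans (addvSl _ _) (addvSr _ _)).
  exact: subv_trans (addvSr _ _) (addvSr _ _).
have := graded_cap gU gW => <-.
have capi (i : bool) : (U :&: (W0 + W1) :&: mod_gr M i)%VS = 0%VS.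
  apply/eqP; rewrite -subv0; apply/subvP => v /memv_capP[/memv_capP[vU]].
  move=> /memv_addP[w0 w0W [w1 w1W vE]] vi.
  have w0p := subvP W0p _ w0W; have w1p := subvP W1p _ w1W.
  case: i vi => vi.
    rewrite -W1c memv_cap vU; suff -> : v = w1 by [].
    rewrite vE; suff -> : w0 = 0 by rewrite add0r.
    apply/eqP; rewrite -memv0 -(grading_cap (mod_gr M)) memv_cap w0p /=.
    by rewrite -(addrK w1 w0) -vE memvB.
  rewrite -W0c memv_cap vU; suff -> : v = w0 by [].
  rewrite vE; suff -> : w1 = 0 by rewrite addr0.
  apply/eqP; rewrite -memv0 -(grading_cap (mod_gr M)) memv_cap w1p andbT.
  by rewrite -(addKr w0 w1) -vE addrC memvB.
by rewrite !capi addv0.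
Qed.

(** A graded stable subspace contains a simple one, found by descent on the dimension; it is split
    off by a graded complement, and the rest is decomposed by induction. *)
Lemma semisimple_in_F : semisimple even_family -> in_F M.
Proof.
move=> ss.
suff dec n T : (\dim T < n)%N -> graded T -> stable even_family T ->
    exists k (U : 'I_k -> {vspace M}), [/\ forall i, even_simple (U i),
      (\sum_(i < k) U i)%VS = T & directv (\sum_(i < k) U i)].
  apply: (dec _ fullv (ltnSn _)); last exact: stablef.
  by rewrite /graded !capfv grading_sum.
elim: n T => // n IHn T; rewrite ltnS => dT gT sT.
have [T0|T0] := eqVneq T 0%VS.
  exists 0%N, (fun=> 0%VS); split; [by case|by rewrite big_ord0|].
  by rewrite directvE /= !big_ord0 dimv0.
have [S [Ss ST]] : exists S, even_simple S /\ (S <= T)%VS.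
  suff exS m S : (\dim S < m)%N -> graded S -> stable even_family S -> S != 0%VS ->
      exists S', even_simple S' /\ (S' <= S)%VS.
    exact: (exS _ T (ltnSn _)).
  elim: m S => // m IHm S; rewrite ltnS => dS gS sS S0.
  have [Ss|nSs] := pselect (even_simple S); first by exists S.
  have [W [[gW sW] WS W0 W1]] : exists W, [/\ even_subsupermodule W, (W <= S)%VS, W != 0%VS & W != S].
    apply: contrapT => nW; apply: nSs; split; [exact/even_subsupermoduleP|exact/eqP|].
    move=> W eW WS; have [->|W0] := eqVneq W 0%VS; first by left.
    by right; apply/eqP; apply: contrapT => /negP W1; apply: nW; exists W.
  have dW : (\dim W < m)%N.
    rewrite (leq_trans _ dS) // ltn_neqAle dimvS // andbT.
    by apply: contraNneq W1 => dE; rewrite eqEdim WS dE leqnn.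
  have [|S' [S's S'W]] := IHm W dW gW _ W0; first exact/restr_stableP.
  by exists S'; split=> //; apply: subv_trans WS.
have [/even_subsupermoduleP[gS sS] S0 _] := Ss.
have [W [gW sW SW1 SW0]] := graded_complement ss gS sS.
have TE : (S + (W :&: T))%VS = T by rewrite vspace_modl // SW1 capfv.
have ST0 : (S :&: (W :&: T))%VS = 0%VS by apply/eqP; rewrite -subv0 capvA SW0 cap0v.
have [|||k [U [Us Usum Udir]]] := IHn (W :&: T)%VS.
- rewrite (leq_trans _ dT) // -{2}TE dimv_disjoint_sum // -add1n leq_add2r.
  by rewrite lt0n dimv_eq0; apply/eqP.
- exact: graded_cap.
- exact: stableI.
exists k.+1, (fun i => if unlift ord0 i is Some j then U j else S).
have sumE : (\sum_(i < k.+1) (if unlift ord0 i is Some j then U j else S) = S + \sum_(j < k) U j)%VS.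
  by rewrite big_ord_recl unlift_none; congr (_ + _)%VS; apply: eq_bigr => j _; rewrite liftK.
split=> [i||]; first by case: unliftP.
  by rewrite sumE Usum.
rewrite directvE /= sumE Usum dimv_disjoint_sum //= big_ord_recl unlift_none.
apply/eqP; congr (_ + _)%N; rewrite -Usum; move: Udir; rewrite directvE /= => /eqP->.
by apply: eq_bigr => j _; rewrite liftK.
Qed.

(** The right side forgets the grading, so closure properties of F reduce to modules over an
    ordinary Lie algebra. *)
Lemma in_FP : in_F M <-> semisimple even_family.
Proof. by split; [exact: in_F_semisimple|exact: semisimple_in_F]. Qed.
End EvenSemisimple.

(** * Gradings as involutions *)

Section Parity.
Variables (C : numClosedFieldType) (V : vectType C) (gr : grading V).

Fact parity_key : unit. Proof. by []. Qed.
(** The operator v |-> (-1)^|v| v, from which the grading is recovered by eigenspaces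
    ([parityP]). *)
Definition parity : 'End(V) :=
  locked_with parity_key (daddv_pi (gr false) (gr true) - daddv_pi (gr true) (gr false)).

Definition parity_pow (i : bool) : 'End(V) := if i then parity else \1%VF.

Let cap01 : (gr false :&: gr true)%VS = 0%VS := grading_cap gr.
Let cap10 : (gr true :&: gr false)%VS = 0%VS. Proof. by rewrite capvC. Qed.

Lemma grading_decomp v : exists v0 v1, [/\ v0 \in gr false, v1 \in gr true & v = v0 + v1].
Proof.
have : v \in (gr false + gr true)%VS by rewrite grading_sum memvf.
by case/memv_addP => v0 v0p [v1 v1p ->]; exists v0, v1.
Qed.

Lemma parity_gr i v : v \in gr i -> parity v = (-1) ^+ i *: v.
Proof.
have other U W u : (U :&: W)%VS = 0%VS -> u \in W -> daddv_pi U W u = 0.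
  move=> UW0 uW; have WU0 : (W :&: U)%VS = 0%VS by rewrite capvC.
  apply: (addIr u); rewrite add0r -{2}(daddv_pi_id WU0 uW) daddv_pi_add //.
  by rewrite -[u]add0r memv_add ?mem0v.
rewrite /parity locked_withE add_lfunE opp_lfunE; case: i => vi.
  by rewrite other // daddv_pi_id // sub0r expr1 scaleN1r.
by rewrite daddv_pi_id // other // subr0 expr0 scale1r.
Qed.

Lemma parityK v : parity (parity v) = v.
Proof.
have [v0 [v1 [v0p v1p ->]]] := grading_decomp v.
rewrite !linearD /= !(parity_gr v0p, parity_gr v1p) !linearZ /=.
by rewrite !(parity_gr v0p, parity_gr v1p) !scalerA -!expr2 !sqrr_sign !scale1r.
Qed.

Lemma parityP (i : bool) v : reflect (parity v = (-1) ^+ i *: v) (v \in gr i).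
Proof.
apply: (iffP idP) => [/parity_gr //|].
have [v0 [v1 [v0p v1p ->]]] := grading_decomp v.
rewrite linearD /= (parity_gr v0p) (parity_gr v1p) expr0 scale1r expr1 scaleN1r.
have two0 (u : V) : u + u = 0 -> u = 0.
  by rewrite -mulr2n -scaler_nat => /eqP; rewrite scaler_eq0 pnatr_eq0 => /eqP.
case: i => /eqP.
  rewrite expr1 scaleN1r opprD (inj_eq (addIr _)) -subr_eq0 opprK => /eqP/two0->.
  by rewrite add0r.
rewrite expr0 scale1r (inj_eq (addrI _)) eq_sym -subr_eq0 opprK => /eqP/two0->.
by rewrite addr0.
Qed.
End Parity.
Arguments parity {C V} gr.
Arguments parity_pow {C V} gr i.

Section InvolutionGrading.
Variables (C : numClosedFieldType) (V : vectType C) (s : 'End(V)).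
Hypothesis sK : forall v, s (s v) = v.

Definition involution_part (i : bool) : {vspace V} := lker (s - (-1) ^+ i *: \1%VF).

Lemma involution_partP (i : bool) v : reflect (s v = (-1) ^+ i *: v) (v \in involution_part i).
Proof.
rewrite memv_ker add_lfunE opp_lfunE scale_lfunE id_lfunE subr_eq0.
exact: eqP.
Qed.

Lemma involution_sum : (involution_part false + involution_part true)%VS = fullv.
Proof.
apply/eqP; rewrite eqEsubv subvf; apply/subvP => v _.
have -> : v = 2^-1 *: (v + s v) + 2^-1 *: (v - s v).
  by rewrite -scalerDr addrACA subrr addr0 -mulr2n -scaler_nat scalerA mulVf ?scale1r // pnatr_eq0.
apply: memv_add; apply: memvZ; apply/involution_partP.
  by rewrite linearD /= sK expr0 scale1r addrC.
by rewrite linearB /= sK expr1 scaleN1r opprB.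
Qed.

Lemma involution_cap : (involution_part false :&: involution_part true)%VS = 0%VS.
Proof.
apply/eqP; rewrite -subv0; apply/subvP => v /memv_capP[/involution_partP].
rewrite expr0 scale1r => vs /involution_partP; rewrite vs expr1 scaleN1r => /eqP.
by rewrite -subr_eq0 opprK -mulr2n -scaler_nat scaler_eq0 pnatr_eq0 memv0.
Qed.

(** Converse to [parity]: as 2 is invertible, an involution splits the space into its two
    eigenspaces. Supermodules are built below from an involution in place of a grading. *)
Definition involution_grading := Grading involution_sum involution_cap.

Lemma parity_involution : parity involution_grading = s.
Proof.
apply/lfunP => v; have [v0 [v1 [v0p v1p ->]]] := grading_decomp involution_grading v.
rewrite !linearD /= (parity_gr v0p) (parity_gr v1p).
by move/involution_partP: v0p => ->; move/involution_partP: v1p => ->.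
Qed.
End InvolutionGrading.

Section ParityModule.
Variables (C : numClosedFieldType) (g : lieSuperalgebra C).
Implicit Types M N : supermodule g.

Definition par M : 'End(M) := parity (mod_gr M).
(** On a vector of degree j this is the Koszul sign (-1)^(i j); signs that depend on the degree of a
    vector thus become linear maps. *)
Definition parn M i : 'End(M) := parity_pow (mod_gr M) i.

Lemma par_act M (i : bool) x (m : M) : x \in lie_gr g i -> par M (mod_act M x m) = (-1) ^+ i *: mod_act M x (par M m).
Proof.
move=> xi; have [m0 [m1 [m0p m1p ->]]] := grading_decomp (mod_gr M) m.
rewrite !linearD /= (parity_gr (mod_act_deg xi m0p)) (parity_gr (mod_act_deg xi m1p)).
rewrite /par (parity_gr m0p) (parity_gr m1p).
have xZ c m' : mod_act M x (c *: m') = c *: mod_act M x m' by rewrite linearZ.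
by rewrite !xZ !scalerA !signr_addb.
Qed.

Lemma parn_act M i j x (m : M) : x \in lie_gr g j ->
  parn M i (mod_act M x m) = ksign C i j *: mod_act M x (parn M i m).
Proof.
move=> xj; rewrite /parn /parity_pow /ksign; case: i; last by rewrite !id_lfunE expr0 scale1r.
exact: par_act.
Qed.

Lemma parK M m : par M (par M m) = m. Proof. exact: parityK. Qed.

Lemma parnK M i m : parn M i (parn M i m) = m.
Proof. by case: i; rewrite /parn /= ?id_lfunE // parityK. Qed.

Lemma parn_addb M i j m : parn M (i (+) j) m = parn M i (parn M j m).
Proof. by case: i; case: j; rewrite /parn /= ?id_lfunE // parityK. Qed.

Lemma ksignC i j : ksign C i j = ksign C j i.
Proof. by rewrite /ksign andbC. Qed.

Lemma ksignK i j : ksign C i j * ksign C i j = 1.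
Proof. by rewrite /ksign -expr2 sqrr_sign. Qed.

Lemma even_morphismP M N (f : 'Hom(M, N)) : even_morphism f <->
  (forall m, f (par M m) = par N (f m)) /\ (forall x m, f (mod_act M x m) = mod_act N x (f m)).
Proof.
split=> [[fdeg fact]|[fpar fact]].
  split=> [m|x m].
    have [m0 [m1 [m0p m1p ->]]] := grading_decomp (mod_gr M) m.
    rewrite !linearD /= /par (parity_gr m0p) (parity_gr m1p) !linearZ /=.
    by rewrite (parity_gr (fdeg _ _ m0p)) (parity_gr (fdeg _ _ m1p)).
  have [x0 [x1 [x0p x1p ->]]] := grading_decomp (lie_gr g) x.
  rewrite !linearD /= !add_lfunE linearD /= (fact _ _ _ x0p) (fact _ _ _ x1p).
  by rewrite /ksign /= expr0 !scale1r.
split=> [j m mj|i x m xi]; last by rewrite /ksign /= expr0 scale1r.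
by apply/parityP; rewrite addFb -/(par N) -fpar /par (parity_gr mj) linearZ.
Qed.

Section Build.
Variables (V : vectType C) (s : 'End(V)) (rho : 'Hom(g, 'End(V))).
Hypothesis sK : forall v, s (s v) = v.
Hypothesis rho_par : forall (i : bool) x v, x \in lie_gr g i -> s (rho x v) = (-1) ^+ i *: rho x (s v).
Hypothesis rho_br : forall (i j : bool) (x y : g) v, x \in lie_gr g i -> y \in lie_gr g j ->
  rho (lie_br g x y) v = rho x (rho y v) - ksign C i j *: rho y (rho x v).

Lemma build_act_deg (i j : bool) (x : g) v : x \in lie_gr g i ->
  v \in involution_grading sK j -> rho x v \in involution_grading sK (i (+) j).
Proof.
move=> xi /involution_partP vj; apply/involution_partP.
by rewrite (rho_par _ xi) vj linearZ /= scalerA signr_addb.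
Qed.

Definition build_supermodule : supermodule g := Supermodule build_act_deg rho_br.

Lemma par_build : par build_supermodule = s.
Proof. exact: parity_involution. Qed.

End Build.
End ParityModule.

(** * The internal Hom *)

Section InternalHom.
Variables (C : numClosedFieldType) (g : lieSuperalgebra C) (A B : supermodule g).

Let pi0 : 'End(g) := daddv_pi (lie_gr g false) (lie_gr g true).
Let pi1 : 'End(g) := daddv_pi (lie_gr g true) (lie_gr g false).

Definition ihom_par : 'End('Hom(A, B)) := compress (par B) (par A).

Fact ihom_act_key : unit. Proof. by []. Qed.
(** The formula (x f)(v) = x f(v) - (-1)^(|x||f|) f(x v). Conjugating f by the parities multiplies
    it by (-1)^|f|, and [pi0], [pi1] split x so that only its odd component meets the conjugated
    f. *)
Definition ihom_act : 'Hom(g, 'End('Hom(A, B))) := locked_with ihom_act_key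
  (hom_act (mod_act A \o pi0)%VF (mod_act B) +
    (compress \1%VF ihom_par \o hom_act (mod_act A \o pi1)%VF 0))%VF.

Lemma ihom_parE f v : ihom_par f v = par B (f (par A v)).
Proof. exact: compressE. Qed.

Lemma lie_pi_homogeneous (i : bool) x : x \in lie_gr g i ->
  pi0 x = (if i then 0 else x) /\ pi1 x = (if i then x else 0).
Proof.
have cap01 := grading_cap (lie_gr g); have cap10 := cap01; rewrite capvC in cap10.
have other U W (u : g) : (U :&: W)%VS = 0%VS -> u \in W -> daddv_pi U W u = 0.
  move=> UW0 uW; have WU0 : (W :&: U)%VS = 0%VS by rewrite capvC.
  apply: (addIr u); rewrite add0r -{2}(daddv_pi_id WU0 uW) daddv_pi_add //.
  by rewrite -[u]add0r memv_add ?mem0v.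
case: i => xi; split.
- exact: other cap01 xi.
- exact: daddv_pi_id cap10 xi.
- exact: daddv_pi_id cap01 xi.
- exact: other cap10 xi.
Qed.

Lemma ihom_actE i x f v : x \in lie_gr g i ->
  ihom_act x f v = mod_act B x (f v) - parn B i (f (parn A i (mod_act A x v))).
Proof.
move=> xi; have [x0 x1] := lie_pi_homogeneous xi.
rewrite /ihom_act locked_withE !add_lfunE !comp_lfunE compressE id_lfunE !hom_act_applyE.
rewrite !comp_lfunE x0 x1 !zero_lfunE sub0r ihom_parE.
have a0 : mod_act A 0 v = 0 by rewrite linear0 zero_lfunE.
case: i {xi x0 x1}; rewrite /parn /parity_pow a0; first by rewrite [f 0]linear0 subr0.
by rewrite !id_lfunE [par A 0]linear0 [f 0]linear0 [par B 0]linear0 subr0.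
Qed.

Lemma ihom_parK f : ihom_par (ihom_par f) = f.
Proof. by apply/lfunP => v; rewrite !ihom_parE !parK. Qed.

Lemma ihom_act_par (i : bool) x f : x \in lie_gr g i ->
  ihom_par (ihom_act x f) = (-1) ^+ i *: ihom_act x (ihom_par f).
Proof.
move=> xi; apply/lfunP => v; rewrite scale_lfunE ihom_parE !(ihom_actE _ _ xi) !ihom_parE.
rewrite linearB /= (par_act _ xi) scalerBr; congr (_ - _).
have pp M j (m : mod_space M) : par M (parn M j m) = parn M j (par M m).
  by case: j; rewrite /parn /= ?id_lfunE.
have xp : mod_act A x (par A v) = (-1) ^+ i *: par A (mod_act A x v).
  by rewrite (par_act _ xi) scalerA -expr2 sqrr_sign scale1r.
have lin (U V : vectType C) (h : 'Hom(U, V)) c u : h (c *: u) = c *: h u by rewrite linearZ.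
by rewrite xp !lin !pp.
Qed.

Lemma ihom_act_br (i j : bool) (x y : g) f : x \in lie_gr g i -> y \in lie_gr g j ->
  ihom_act (lie_br g x y) f = ihom_act x (ihom_act y f) - ksign C i j *: ihom_act y (ihom_act x f).
Proof.
move=> xi yj; apply/lfunP => v; rewrite add_lfunE opp_lfunE scale_lfunE.
rewrite (ihom_actE _ _ (lie_br_deg xi yj)) !(ihom_actE _ _ xi, ihom_actE _ _ yj).
rewrite (mod_act_br _ xi yj) (mod_act_br _ xi yj) !parn_addb.
set e := ksign C i j.
have ee : e * e = 1 := ksignK C i j.
have comm (a b : bool) (w : A) : parn A a (parn A b w) = parn A b (parn A a w).
  by rewrite -!parn_addb addbC.
have commB (a b : bool) (w : B) : parn B a (parn B b w) = parn B b (parn B a w).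
  by rewrite -!parn_addb addbC.
have pxA (w : A) : mod_act A x (parn A j w) = e *: parn A j (mod_act A x w).
  by rewrite (parn_act _ _ xi) ksignC scalerA ee scale1r.
have pyA (w : A) : mod_act A y (parn A i w) = e *: parn A i (mod_act A y w).
  by rewrite (parn_act _ _ yj) scalerA ee scale1r.
have pxB (w : B) : parn B j (mod_act B x w) = e *: mod_act B x (parn B j w).
  by rewrite (parn_act _ _ xi) ksignC.
have pyB (w : B) : parn B i (mod_act B y w) = e *: mod_act B y (parn B i w) := parn_act i w yj.
have linZ (U V : vectType C) (h : 'Hom(U, V)) c u : h (c *: u) = c *: h u by rewrite linearZ.
have linB (U V : vectType C) (h : 'Hom(U, V)) u w : h (u - w) = h u - h w by rewrite linearB.
rewrite pxA pyA !(linB, linZ) pxB pyB (comm j i) (commB j i).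
move: (mod_act B x (mod_act B y (f v))) (mod_act B y (mod_act B x (f v))) => a b.
move: (mod_act B x (parn B j (f (parn A j (mod_act A y v))))) => G1.
move: (mod_act B y (parn B i (f (parn A i (mod_act A x v))))) => G2.
move: (parn B i _) (parn B i _) => F1 F2.
rewrite !scalerBr !scalerA ee !scale1r !opprB !addrA.
by move: (e *: b) (e *: G2) (e *: F2) => b' G2' F2'; vring.
Qed.

Definition ihom : supermodule g := build_supermodule ihom_parK ihom_act_par ihom_act_br.

Lemma par_ihom : par ihom = ihom_par.
Proof. exact: par_build. Qed.

End InternalHom.

Lemma lie_rep_mod_act (C : numClosedFieldType) (g : lieSuperalgebra C) (M : supermodule g) :
  lie_rep (lie_gr g false) (fun x y => lie_br g x y) (mod_act M).
Proof.
move=> x y x0 y0; apply/lfunP => v.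
by rewrite lcommE (mod_act_br _ x0 y0) /ksign expr0 scale1r.
Qed.

(** For even x no sign occurs and the action is the one of Chevalley's theorem. *)
Lemma in_F_ihom (C : numClosedFieldType) (g : lieSuperalgebra C) (A B : supermodule g) :
  in_F A -> in_F B -> in_F (ihom A B).
Proof.
move=> /in_FP ssA /in_FP ssB; apply/in_FP.
have br_closed (x y : g) : x \in lie_gr g false -> y \in lie_gr g false ->
    lie_br g x y \in lie_gr g false by exact: lie_br_deg.
have := hom_act_semisimple br_closed (@lie_rep_mod_act _ _ A) (@lie_rep_mod_act _ _ B) ssA ssB.
apply: semisimple_stable_iff => U; rewrite /even_family !restr_stableP.
have E x f : x \in lie_gr g false -> mod_act (ihom A B) x f = hom_act (mod_act A) (mod_act B) x f.
  move=> x0; apply/lfunP => v; rewrite hom_act_applyE [LHS](ihom_actE _ _ x0).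
  by rewrite /parn /= !id_lfunE.
by split=> sU x f xL fU; have := sU x f xL fU; rewrite E.
Qed.

(** * Kernels and cokernels in F *)

Section CompressedSupermodule.
Variables (C : numClosedFieldType) (g : lieSuperalgebra C) (M : supermodule g).
Variables (V : vectType C) (p : 'Hom(M, V)) (i : 'Hom(V, M)).

Definition structure_op (f : 'End(M)) := f = par M \/ exists x, f = mod_act M x.

Hypothesis piK : forall v, p (i v) = v.
Hypothesis compress_comp : forall f h, structure_op f -> structure_op h ->
  forall v, p (f (i (p (h (i v))))) = p (f (h (i v))).

Let op_par : structure_op (par M). Proof. by left. Qed.
Let op_act x : structure_op (mod_act M x). Proof. by right; exists x. Qed.

Lemma compress_parK v : compress p i (par M) (compress p i (par M) v) = v.
Proof. by rewrite !compressE compress_comp // parK piK. Qed.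

Lemma compress_act_par (k : bool) x v : x \in lie_gr g k ->
  compress p i (par M) (compress_rep (mod_act M) p i x v) =
  (-1) ^+ k *: compress_rep (mod_act M) p i x (compress p i (par M) v).
Proof.
move=> xk; rewrite !compressE !compress_repE ?compressE !compress_comp //.
by rewrite (par_act _ xk) linearZ.
Qed.

Lemma compress_act_br (k l : bool) (x y : g) v : x \in lie_gr g k -> y \in lie_gr g l ->
  compress_rep (mod_act M) p i (lie_br g x y) v =
  compress_rep (mod_act M) p i x (compress_rep (mod_act M) p i y v) -
  ksign C k l *: compress_rep (mod_act M) p i y (compress_rep (mod_act M) p i x v).
Proof.
move=> xk yl; rewrite !compress_repE !compress_comp //.
by rewrite (mod_act_br _ xk yl) linearB linearZ.
Qed.

(** Treats subsupermodules and quotients at once: [compress_comp] holds if the structure operators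
    preserve the image of [i], and also if they preserve the kernel of [p]. *)
Definition compress_supermodule : supermodule g :=
  build_supermodule compress_parK compress_act_par compress_act_br.

Lemma compress_supermodule_act x v : mod_act compress_supermodule x v = p (mod_act M x (i v)).
Proof. exact: compress_repE. Qed.

Lemma compress_supermodule_par v : par compress_supermodule v = p (par M (i v)).
Proof. by rewrite /compress_supermodule par_build compressE. Qed.
End CompressedSupermodule.

Section MonoEpi.
Variables (C : numClosedFieldType) (g : lieSuperalgebra C).

Lemma even_morphism0 (A B : supermodule g) : even_morphism (0 : 'Hom(A, B)).
Proof. by apply/even_morphismP; split=> *; rewrite !zero_lfunE linear0. Qed.

(** The kernel of [e] lies in F, so it can serve as test object: its inclusion and the zero map
    agree after composition with [e]. *)
Lemma mono_F_injective (A B : supermodule g) (e : 'Hom(A, B)) :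
  in_F A -> mono_F e -> forall a, e a = 0 -> a = 0.
Proof.
move=> FA [/even_morphismP[epar eact] emono] a ea0.
pose U := lker e; pose i := sub_incl U; pose p := sub_proj U U^C.
have capU : (U :&: U^C)%VS = 0%VS := capv_compl U.
have opU f : structure_op f -> forall v, i (p (f (i v))) = f (i v).
  move=> opf v; apply: sub_incl_projK => //.
  have := sub_incl_mem v; rewrite !memv_ker => /eqP iv0.
  by case: opf => [->|[x ->]]; rewrite ?epar ?eact iv0 linear0.
have pK v : p (i v) = v by apply: sub_proj_inclK.
have comp f h : structure_op f -> structure_op h ->
    forall v, p (f (i (p (h (i v))))) = p (f (h (i v))).
  by move=> _ oph v; rewrite opU.
pose N := compress_supermodule pK comp.
have FN : in_F N.
  apply/in_FP; move/in_FP: FA; apply: (semisimple_sub (i := i)) => [v v0|x v].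
    by rewrite -(pK v) v0 linear0.
  by rewrite /even_family /restr_family compress_supermodule_act opU //; right; exists (vsval x).
have ei : even_morphism (i : 'Hom(N, A)).
  apply/even_morphismP; split=> [m|x m].
    by rewrite compress_supermodule_par opU //; left.
  by rewrite compress_supermodule_act opU //; right; exists x.
have ie0 : (e \o (i : 'Hom(N, A)))%VF = (e \o (0 : 'Hom(N, A)))%VF.
  apply/lfunP => v; rewrite !comp_lfunE zero_lfunE linear0; apply/eqP.
  by rewrite -memv_ker sub_incl_mem.
have i0 := emono N i 0 FN ei (even_morphism0 _ _) ie0.
have [u ->] : exists u, a = i u by apply: sub_incl_ex; rewrite memv_ker ea0.
by rewrite i0 zero_lfunE.
Qed.

(** The test object is the cokernel, realized on a linear complement [W] of the image: the
    projection and the zero map agree on the image. *)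
Lemma epi_F_surjective (A B : supermodule g) (e : 'Hom(A, B)) :
  in_F B -> epi_F e -> forall b, exists a, e a = b.
Proof.
move=> FB [/even_morphismP[epar eact] eepi] b.
pose U := limg e; pose W := (U^C)%VS; pose i := sub_incl W; pose p := sub_proj W U.
have WU0 : (W :&: U)%VS = 0%VS := compl_disjoint U.
have WU1 : (W + U)%VS = fullv by rewrite addvC addv_complf.
have pU m : m \in U -> p m = 0 by apply: sub_proj_other.
have opU f : structure_op f -> forall v, v \in U -> f v \in U.
  move=> opf _ /memv_imgP[a _ ->].
  by case: opf => [->|[x ->]]; rewrite -?epar -?eact memv_img ?memvf.
have opp f : structure_op f -> forall v, p (f (i (p v))) = p (f v).
  move=> opf v; rewrite -[in RHS](sub_proj_decomp WU0 WU1 v) !linearD /=.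
  by rewrite [X in _ = _ + X]pU ?addr0 // opU ?sub_incl_mem.
have pK v : p (i v) = v by apply: sub_proj_inclK.
have comp f h : structure_op f -> structure_op h ->
    forall v, p (f (i (p (h (i v))))) = p (f (h (i v))).
  by move=> opf _ v; rewrite opp.
pose N := compress_supermodule pK comp.
have FN : in_F N.
  apply/in_FP; move/in_FP: FB; apply: (semisimple_quotient (p := p)) => [v|x v].
    by exists (i v).
  rewrite /even_family /restr_family [RHS]compress_supermodule_act; symmetry; apply: opp.
  by right; exists (vsval x).
have ep : even_morphism (p : 'Hom(B, N)).
  apply/even_morphismP; split=> [m|x m].
    by rewrite [RHS]compress_supermodule_par; symmetry; apply: opp; left.
  by rewrite [RHS]compress_supermodule_act; symmetry; apply: opp; right; exists x.
have pe0 : ((p : 'Hom(B, N)) \o e)%VF = ((0 : 'Hom(B, N)) \o e)%VF.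
  by apply/lfunP => v; rewrite !comp_lfunE zero_lfunE; apply: pU; rewrite memv_img ?memvf.
have p0 := eepi N p 0 FN ep (even_morphism0 _ _) pe0.
have : b \in U.
  rewrite -(sub_proj_decomp WU0 WU1 b) -/p p0 zero_lfunE linear0 add0r.
  exact: sub_incl_mem.
by case/memv_imgP => a _ ->; exists a.
Qed.

Lemma injective_mono_F (A B : supermodule g) (e : 'Hom(A, B)) :
  even_morphism e -> (forall a, e a = 0 -> a = 0) -> mono_F e.
Proof.
move=> ee e0; split=> // N u v _ _ _ /lfunP euv; apply/lfunP => n.
apply/eqP; rewrite -subr_eq0; apply/eqP/e0; rewrite linearB /= -!comp_lfunE euv.
exact: subrr.
Qed.

Lemma surjective_epi_F (A B : supermodule g) (e : 'Hom(A, B)) :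
  even_morphism e -> (forall b, exists a, e a = b) -> epi_F e.
Proof.
move=> ee es; split=> // N u v _ _ _ /lfunP euv; apply/lfunP => b.
by have [a <-] := es b; have := euv a; rewrite !comp_lfunE.
Qed.
End MonoEpi.

(** * Contractions with dual bases *)

Section Contraction.
Variable C : fieldType.

Lemma lfun_exists (U V : vectType C) (f : U -> V) : linear f ->
  exists F : 'Hom(U, V), forall u, F u = f u.
Proof.
move=> lf; pose F0 := GRing.isLinear.Build C U V _ _ lf.
pose F : {linear U -> V} := HB.pack f F0.
by exists (linfun F) => u; rewrite lfunE.
Qed.

Definition line_fun (V : vectType C) (b : V) (c : C^o) : V := c *: b.

Lemma line_fun_is_linear (V : vectType C) (b : V) : linear (line_fun b).
Proof. by move=> a c d; rewrite /line_fun scalerDl scalerA. Qed.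

HB.instance Definition _ (V : vectType C) (b : V) :=
  GRing.isSemilinear.Build C _ _ _ (line_fun b)
    (GRing.semilinear_linear (line_fun_is_linear b)).

Fact rank1_key : unit. Proof. by []. Qed.
(** The pure tensor l (x) b, seen in Hom(U,V). *)
Definition rank1 (U V : vectType C) (l : 'Hom(U, C^o)) (b : V) : 'Hom(U, V) :=
  locked_with rank1_key (linfun (line_fun b) \o l)%VF.

Lemma rank1E (U V : vectType C) (l : 'Hom(U, C^o)) (b : V) u : rank1 l b u = (l u : C) *: b.
Proof. by rewrite /rank1 locked_withE comp_lfunE lfunE. Qed.

Lemma rank1P (U V : vectType C) (l : 'Hom(U, C^o)) a (b c : V) :
  rank1 l (a *: b + c) = a *: rank1 l b + rank1 l c.
Proof.
apply/lfunP => u; rewrite add_lfunE scale_lfunE !rank1E scalerDr !scalerA.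
by rewrite mulrC.
Qed.

Lemma rank1Pl (U V : vectType C) a (l l' : 'Hom(U, C^o)) (b : V) :
  rank1 (a *: l + l') b = a *: rank1 l b + rank1 l' b.
Proof.
apply/lfunP => u; rewrite add_lfunE scale_lfunE !rank1E add_lfunE scale_lfunE.
by rewrite scalerDl scalerA.
Qed.

Definition bas (V : vectType C) (i : 'I_(\dim {:V})) : V := (vbasis {:V})`_i.
Definition crd (V : vectType C) (i : 'I_(\dim {:V})) : 'Hom(V, C^o) :=
  linfun (coord (vbasis {:V}) i : {linear V -> C^o}).

Lemma crdE (V : vectType C) i (v : V) : crd i v = coord (vbasis {:V}) i v.
Proof. by rewrite /crd lfunE. Qed.

Lemma crd_sum (V : vectType C) (v : V) : v = \sum_i (crd i v : C) *: bas i.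
Proof.
rewrite {1}(coord_vbasis (memvf v)); apply: eq_bigr => i _.
by rewrite crdE.
Qed.

(** Naturality of the canonical tensor sum e_i (x) e^i, with [B] in place of the tensor product: [T]
    passes from the vector to the covector. The left sum runs over a basis of V, the right one over
    a basis of W. *)
Lemma contraction (V W : vectType C) (U : lmodType C) (B : W -> 'Hom(V, C^o) -> U) (T : 'Hom(V, W)) :
  (forall a u v l, B (a *: u + v) l = a *: B u l + B v l) ->
  (forall a u l l', B u (a *: l + l') = a *: B u l + B u l') ->
  \sum_i B (T (bas i)) (crd i) = \sum_i B (bas i) (crd i \o T)%VF.
Proof.
move=> Bl Br.
have Bsl (I : Type) (r : seq I) (F : I -> W) (a : I -> C) z :
    B (\sum_(i <- r) a i *: F i) z = \sum_(i <- r) a i *: B (F i) z.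
  elim/big_rec2: _ => [|i y1 y2 _ <-]; last exact: Bl.
  by have := Bl (-1) 0 0 z; rewrite scaler0 addr0 scaleN1r addNr.
have Bsr (I : Type) (r : seq I) (F : I -> 'Hom(V, C^o)) (a : I -> C) z :
    B z (\sum_(i <- r) a i *: F i) = \sum_(i <- r) a i *: B z (F i).
  elim/big_rec2: _ => [|i y1 y2 _ <-]; last exact: Br.
  by have := Br (-1) z 0 0; rewrite scaler0 addr0 scaleN1r addNr.
have crdT i : (crd i \o T)%VF = \sum_j (crd i (T (bas j)) : C) *: crd j.
  apply/lfunP => v; rewrite comp_lfunE {1}(crd_sum v) !linear_sum sum_lfunE.
  by apply: eq_bigr => j _; rewrite scale_lfunE !linearZ; apply: mulrC.
under eq_bigr => i _ do rewrite (crd_sum (T (bas i))) Bsl.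
under [RHS]eq_bigr => i _ do rewrite crdT Bsr.
by rewrite exchange_big.
Qed.

Lemma crd_bas (V : vectType C) (B : 'End(V)) : ltrace B = \sum_i (crd i (B (bas i)) : C).
Proof. by rewrite ltrace_coord; apply: eq_bigr => i _; rewrite crdE. Qed.
End Contraction.

(** * Functoriality of the internal Hom *)

Section Functoriality.
Variables (C : numClosedFieldType) (g : lieSuperalgebra C).
Variables (P A B : supermodule g) (e : 'Hom(A, B)).
Hypothesis e_even : even_morphism e.

Let e_par m : e (par A m) = par B (e m). Proof. by case/even_morphismP: e_even. Qed.
Let e_act x m : e (mod_act A x m) = mod_act B x (e m).
Proof. by case/even_morphismP: e_even. Qed.

Lemma even_parn (i : bool) m : e (parn A i m) = parn B i (e m).
Proof. by case: i; rewrite /parn /parity_pow ?id_lfunE. Qed.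

Definition ihom_post : 'Hom(ihom P A, ihom P B) := compress e \1%VF.
Definition ihom_pre : 'Hom(ihom B P, ihom A P) := compress \1%VF e.

Lemma ihom_post_even : even_morphism ihom_post.
Proof.
split=> [i f /parityP fi|i x f xi].
  apply/parityP; rewrite -/(par _) par_ihom addFb.
  move: fi; rewrite -/(par _) par_ihom => /lfunP fi; apply/lfunP => v.
  rewrite ihom_parE compressE id_lfunE -e_par scale_lfunE compressE id_lfunE.
  by have := fi v; rewrite ihom_parE scale_lfunE => ->; rewrite linearZ.
rewrite /ksign expr0 scale1r; apply/lfunP => v.
rewrite [RHS](ihom_actE _ _ xi) !compressE !id_lfunE.
by rewrite [ihom_act _ _ _ _ _](ihom_actE _ _ xi) linearB /= e_act even_parn.
Qed.

Lemma ihom_pre_even : even_morphism ihom_pre.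
Proof.
split=> [i f /parityP fi|i x f xi].
  apply/parityP; rewrite -/(par _) par_ihom addFb.
  move: fi; rewrite -/(par _) par_ihom => /lfunP fi; apply/lfunP => v.
  rewrite ihom_parE compressE id_lfunE e_par scale_lfunE compressE id_lfunE.
  by have := fi (e v); rewrite ihom_parE scale_lfunE => ->.
rewrite /ksign expr0 scale1r; apply/lfunP => v.
rewrite [RHS](ihom_actE _ _ xi) !compressE !id_lfunE.
by rewrite [ihom_act _ _ _ _ _](ihom_actE _ _ xi) even_parn e_act.
Qed.

Lemma ihom_post_injective : (forall a, e a = 0 -> a = 0) -> forall f, ihom_post f = 0 -> f = 0.
Proof.
move=> e0 f /lfunP ef; apply/lfunP => v; rewrite zero_lfunE; apply: e0.
by have := ef v; rewrite compressE id_lfunE zero_lfunE.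
Qed.

(** A linear section of [e] is enough; it need not commute with the action. *)
Lemma ihom_post_surjective : (forall b, exists a, e a = b) -> forall f, exists h, ihom_post h = f.
Proof.
move=> es f; exists (e^-1 \o f)%VF; apply/lfunP => v; rewrite compressE id_lfunE comp_lfunE.
by apply: limg_lfunVK; have [a <-] := es (f v); rewrite memv_img ?memvf.
Qed.

Lemma ihom_pre_surjective : (forall a, e a = 0 -> a = 0) -> forall f, exists h, ihom_pre h = f.
Proof.
move=> e0 f; exists (f \o e^-1)%VF; apply/lfunP => v; rewrite compressE id_lfunE comp_lfunE.
rewrite lker0_lfunK //; apply/lker0P => a b ab; apply/eqP; rewrite -subr_eq0; apply/eqP/e0.
by rewrite linearB /= ab subrr.
Qed.

Lemma ihom_pre_injective : (forall b, exists a, e a = b) -> forall f, ihom_pre f = 0 -> f = 0.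
Proof.
move=> es f /lfunP ef; apply/lfunP => b; rewrite zero_lfunE; have [a <-] := es b.
by have := ef a; rewrite compressE id_lfunE zero_lfunE.
Qed.
End Functoriality.

(** * Homogeneous components and the supertrace *)

Section ParityProjections.
Variables (C : numClosedFieldType) (g : lieSuperalgebra C) (M : supermodule g).

Definition par_proj (p : bool) : 'End(M) := 2^-1 *: (\1%VF + (-1) ^+ p *: par M).

Lemma par_proj_par (p : bool) m : par M (par_proj p m) = (-1) ^+ p *: par_proj p m.
Proof.
have linZ c u : par M (c *: u) = c *: par M u by rewrite linearZ.
have linD u v : par M (u + v) = par M u + par M v by rewrite linearD.
rewrite /par_proj !scale_lfunE !add_lfunE !scale_lfunE id_lfunE linZ linD linZ parK.
rewrite scalerA [(-1) ^+ p * _]mulrC -scalerA; congr (_ *: _).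
rewrite scalerDr scalerA -expr2 sqrr_sign scale1r.
by rewrite addrC.
Qed.

Lemma par_proj_sum m : par_proj false m + par_proj true m = m.
Proof.
rewrite /par_proj !scale_lfunE !add_lfunE !scale_lfunE id_lfunE expr0 expr1 scale1r scaleN1r.
by rewrite -scalerDr addrACA subrr addr0 -mulr2n -scaler_nat scalerA mulVf ?scale1r // pnatr_eq0.
Qed.

Lemma par_proj_id (p q : bool) m : par M m = (-1) ^+ p *: m -> par_proj q m = if q == p then m else 0.
Proof.
move=> mp; rewrite /par_proj !scale_lfunE !add_lfunE !scale_lfunE id_lfunE mp scalerA -signr_addb.
case: p q {mp} => [] []; rewrite /= ?expr0 ?expr1 ?scale1r ?scaleN1r ?subrr ?scaler0 //.
  by rewrite -mulr2n -scaler_nat scalerA mulVf ?scale1r // pnatr_eq0.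
by rewrite -mulr2n -scaler_nat scalerA mulVf ?scale1r // pnatr_eq0.
Qed.

Lemma parity_ind (N : vectType C) (f h : 'Hom(M, N)) :
  (forall (p : bool) m, par M m = (-1) ^+ p *: m -> f m = h m) -> f = h.
Proof.
move=> fh; apply/lfunP => m; rewrite -(par_proj_sum m) !linearD /=.
by rewrite !(fh _ _ (par_proj_par _ _)).
Qed.
End ParityProjections.

Lemma ltrace_rank1 (C : fieldType) (V : vectType C) (l : 'Hom(V, C^o)) (b : V) :
  ltrace (rank1 l b) = l b.
Proof.
rewrite crd_bas [in RHS](crd_sum b) linear_sum; apply: eq_bigr => i _.
by rewrite rank1E !linearZ; apply: mulrC.
Qed.

Section ParityLemmas.
Variables (C : numClosedFieldType) (g : lieSuperalgebra C).
Implicit Types M N : supermodule g.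

Lemma even_morphism_homogeneous M N (f : 'Hom(M, N)) :
  (forall m, f (par M m) = par N (f m)) ->
  (forall (i : bool) x m, x \in lie_gr g i -> f (mod_act M x m) = mod_act N x (f m)) ->
  even_morphism f.
Proof.
move=> fpar fact; apply/even_morphismP; split=> // x m.
have [x0 [x1 [x0p x1p ->]]] := grading_decomp (lie_gr g) x.
by rewrite !linearD /= !add_lfunE linearD /= (fact _ _ _ x0p) (fact _ _ _ x1p).
Qed.

Lemma parn_homogeneous M (i p : bool) (m : M) : par M m = (-1) ^+ p *: m ->
  parn M i m = ksign C i p *: m.
Proof.
by move=> mp; rewrite /ksign; case: i; rewrite /parn /parity_pow ?id_lfunE ?expr0 ?scale1r.
Qed.

Lemma parn_ihom M N (i : bool) (f : 'Hom(M, N)) v :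
  parn (ihom M N) i f v = parn N i (f (parn M i v)).
Proof.
case: i; rewrite /parn /parity_pow ?id_lfunE // -/(par _) par_ihom.
exact: ihom_parE.
Qed.

Lemma par_ihomE M N (f : 'Hom(M, N)) v : par (ihom M N) f v = par N (f (par M v)).
Proof. by rewrite par_ihom ihom_parE. Qed.

Lemma act_ihomE M N (i : bool) x (f : 'Hom(M, N)) v : x \in lie_gr g i ->
  mod_act (ihom M N) x f v = mod_act N x (f v) - parn N i (f (parn M i (mod_act M x v))).
Proof. exact: ihom_actE. Qed.

Lemma act_homogeneous M (i p : bool) x (m : M) : x \in lie_gr g i ->
  par M m = (-1) ^+ p *: m -> par M (mod_act M x m) = (-1) ^+ (i (+) p) *: mod_act M x m.
Proof. by move=> xi mp; rewrite (par_act _ xi) mp linearZ /= scalerA signr_addb. Qed.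

(** The trace of par o h is the supertrace of h. This is its invariance under cyclic exchange of x
    and h; the two factors [parn M i] carry the sign (-1)^(i |h|). *)
Lemma ltrace_par_act M (i : bool) x (h : 'End(M)) : x \in lie_gr g i ->
  ltrace (par M \o (parn M i \o (h \o (parn M i \o mod_act M x))))%VF =
  ltrace (par M \o (mod_act M x \o h))%VF.
Proof.
move=> xi; have -> : (par M \o (parn M i \o (h \o (parn M i \o mod_act M x))))%VF =
  ((par M \o (parn M i \o h)) \o (parn M i \o mod_act M x))%VF by rewrite !comp_lfunA.
rewrite ltraceC; congr ltrace; apply/lfunP => v; rewrite !comp_lfunE.
case: i xi => xi; rewrite /parn /parity_pow ?id_lfunE; first by rewrite !parityK.
by rewrite (par_act _ xi) expr0 scale1r.
Qed.

End ParityLemmas.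

(** * Projective objects are injective *)

Section ProjectiveInjective.
Variables (C : numClosedFieldType) (g : lieSuperalgebra C) (P B : supermodule g).
Variable at_ : 'Hom(P, ihom (ihom P B) P).
Hypothesis at_even : even_morphism at_.

Let at_par v (f : 'Hom(P, B)) : at_ (par P v) f = par P (at_ v (par (ihom P B) f)).
Proof. by have /even_morphismP[-> _] := at_even; rewrite par_ihomE. Qed.

Let at_act i x v (f : 'Hom(P, B)) : x \in lie_gr g i -> at_ (mod_act P x v) f =
  mod_act P x (at_ v f) - parn P i (at_ v (parn (ihom P B) i (mod_act (ihom P B) x f))).
Proof. by move=> xi; have /even_morphismP[_ ->] := at_even; rewrite (act_ihomE _ _ xi). Qed.

Let atP v a (f f' : 'Hom(P, B)) : at_ v (a *: f + f') = a *: at_ v f + at_ v f'.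
Proof. by rewrite linearP. Qed.

(** The crosswise contraction, with an operator [S] inserted on the contracted copy of P. Sign
    operators and the action of g are absorbed into [S] when they cross the contraction. *)
Definition contract (S : 'End(P)) (b : B) : P := \sum_i at_ (bas i) (rank1 (crd i \o S)%VF b).

Lemma contract_linear S : linear (contract S).
Proof.
move=> a b c; rewrite /contract scaler_sumr -big_split; apply: eq_bigr => i _.
by rewrite rank1P atP.
Qed.

Lemma contract_scale S a b : contract S (a *: b) = a *: contract S b.
Proof.
have c0 : contract S 0 = 0.
  by have := contract_linear S (-1) 0 0; rewrite scaler0 addr0 scaleN1r addNr.
by rewrite -[a *: b]addr0 contract_linear c0 addr0.
Qed.

Lemma contract_scalel S a b : contract (a *: S) b = a *: contract S b.
Proof.
rewrite /contract scaler_sumr; apply: eq_bigr => i _.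
rewrite -comp_lfunZr -[a *: _]addr0 rank1Pl.
have -> : rank1 (0 : 'Hom(P, C^o)) b = 0.
  by apply/lfunP => u; rewrite rank1E !zero_lfunE scale0r.
by rewrite addr0 linearZ.
Qed.

Lemma contract_move (S T : 'End(P)) b :
  \sum_i at_ (T (bas i)) (rank1 (crd i \o S)%VF b) = contract (T \o S)%VF b.
Proof.
rewrite (contraction (B := fun v l => at_ v (rank1 (l \o S)%VF b))).
- by apply: eq_bigr => i _; rewrite comp_lfunA.
- by move=> a u v l; rewrite linearP add_lfunE scale_lfunE.
- by move=> a u l l'; rewrite comp_lfunDl -comp_lfunZl rank1Pl atP.
Qed.

Lemma contract_par S b : contract (par P \o S)%VF b = par P (contract (S \o par P)%VF (par B b)).
Proof.
rewrite -contract_move /contract linear_sum; apply: eq_bigr => i _.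
rewrite at_par; congr (par P (at_ _ _)); apply/lfunP => u.
by rewrite par_ihomE !rank1E linearZ !comp_lfunE.
Qed.

Lemma contract_parn i S b :
  parn P i (contract S b) = contract (parn P i \o (S \o parn P i))%VF (parn B i b).
Proof.
case: i; rewrite /parn /parity_pow ?id_lfunE ?comp_lfun1l ?comp_lfun1r //.
rewrite -!/(par _) contract_par parK; congr (par P (contract _ _)).
by apply/lfunP => v; rewrite !comp_lfunE parK.
Qed.

(** Equivariance of [at_] applied to x e_i: x reappears on the value, on the vector [b], and,
    through the contraction, on the other side of [S]. *)
Lemma contract_act i x S b : x \in lie_gr g i ->
  contract (mod_act P x \o S)%VF b = mod_act P x (contract S b)
  - parn P i (contract (S \o parn P i)%VF (parn B i (mod_act B x b)))
  + (-1) ^+ i *: parn P i (contract (S \o mod_act P x)%VF b).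
Proof.
move=> xi; rewrite -contract_move /contract !linear_sum -!big_split.
apply: eq_bigr => k _; rewrite /= (at_act _ _ xi) -addrA; congr (_ + _) => /=.
have -> : parn (ihom P B) i (mod_act (ihom P B) x (rank1 (crd k \o S)%VF b)) =
    (- (-1) ^+ i) *: rank1 (crd k \o (S \o mod_act P x))%VF b +
    rank1 (crd k \o (S \o parn P i))%VF (parn B i (mod_act B x b)).
  have linZ (U V : vectType C) (h : 'Hom(U, V)) c u : h (c *: u) = c *: h u by rewrite linearZ.
  apply/lfunP => u; rewrite parn_ihom (act_ihomE _ _ xi) add_lfunE scale_lfunE !rank1E.
  rewrite !comp_lfunE linearB /= !linZ parnK addrC; congr (_ + _).
  rewrite (parn_act _ _ xi) parnK !linZ scaleNr; congr (- _).
  by rewrite /ksign andbb scalerA.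
by rewrite atP linearP /= opprD scaleNr opprK addrC.
Qed.

(** A vector b of degree p has to pass the contracted copy of P, which costs the Koszul sign
    [parn P p]. *)
Definition contract_hom (b : B) : P :=
  contract \1%VF (par_proj B false b) + contract (par P) (par_proj B true b).

Lemma contract_hom_linear : linear contract_hom.
Proof.
move=> a b c; rewrite /contract_hom !linearP !contract_linear scalerDr.
by rewrite addrACA.
Qed.

Lemma contract_homE (p : bool) b : par B b = (-1) ^+ p *: b ->
  contract_hom b = contract (parn P p) b.
Proof.
have c0 S : contract S 0 = 0.
  by have := contract_scale S 0 0; rewrite !scale0r.
move=> bp; rewrite /contract_hom !(par_proj_id _ bp).
by case: p {bp}; rewrite /= c0 ?add0r ?addr0.
Qed.

Lemma contract_hom_par b : contract_hom (par B b) = par P (contract_hom b).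
Proof.
have [h hE] := lfun_exists contract_hom_linear; rewrite -!hE -!comp_lfunE; congr (fun_of_lfun _ b).
apply: parity_ind => p {}b bp; rewrite !comp_lfunE bp linearZ /= !hE (contract_homE bp).
have := contract_par (parn P p \o par P)%VF (par B b).
have -> : ((parn P p \o par P) \o par P)%VF = parn P p.
  by apply/lfunP => v; rewrite !comp_lfunE parK.
have -> : (par P \o (parn P p \o par P))%VF = parn P p.
  by apply/lfunP => v; rewrite !comp_lfunE; case: (p); rewrite /parn /parity_pow ?id_lfunE ?parK.
by rewrite parK bp contract_scale => ->.
Qed.

Lemma contract_hom_act (i : bool) x b : x \in lie_gr g i ->
  contract_hom (mod_act B x b) = mod_act P x (contract_hom b).
Proof.
move=> xi; have [h hE] := lfun_exists contract_hom_linear; rewrite -!hE -!comp_lfunE; congr (fun_of_lfun _ b).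
apply: parity_ind => p {}b bp; rewrite !comp_lfunE !hE (contract_homE bp).
rewrite (contract_homE (act_homogeneous xi bp)).
(* For this choice of [S] the last term of [contract_act] equals its left side; what remains is the
   claim. *)
have := contract_act (parn P p) b xi; rewrite !contract_parn parnK.
have -> : (parn P i \o ((parn P p \o parn P i) \o parn P i))%VF = parn P (i (+) p).
  by apply/lfunP => v; rewrite !comp_lfunE parnK parn_addb.
have -> : (parn P i \o ((parn P p \o mod_act P x) \o parn P i))%VF =
    ((-1) ^+ i * ksign C i p) *: (mod_act P x \o parn P p)%VF.
  apply/lfunP => v; rewrite scale_lfunE !comp_lfunE (parn_act _ _ xi).
  rewrite linearZ /= (parn_act _ _ xi) -[parn P p (parn P i v)]parn_addb addbC parn_addb parnK.
  by rewrite scalerA mulrC /ksign andbb [p && i]andbC.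
rewrite (parn_homogeneous _ bp) contract_scale contract_scalel !scalerA.
have -> : (-1) ^+ i * ksign C i p * ((-1) ^+ i * ksign C i p) = 1 :> C.
  by rewrite mulrACA -expr2 sqrr_sign mul1r ksignK.
rewrite scale1r -[X in X = _]add0r => /addIr/esym/eqP.
by rewrite subr_eq0 => /eqP.
Qed.
End ProjectiveInjective.

Theorem projective_injective (C : numClosedFieldType) (g : lieSuperalgebra C) (P : supermodule g) :
  in_F P -> projective_F P -> injective_F P.
Proof.
move=> FP projP A B e f FA FB emono feven.
have e0 := mono_F_injective FA emono; have ee := emono.1.
have [epar eact] := (even_morphismP e).1 ee; have [fpar fact] := (even_morphismP f).1 feven.
pose Te := ihom_pre P (ihom_post P e).
have Te_epi : epi_F Te.
  apply: surjective_epi_F; first exact: ihom_pre_even (ihom_post_even _ ee).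
  exact: ihom_pre_surjective (ihom_post_injective e0).
(* [l] is the functional paired with [f] by the supertrace. It is even and invariant, which is what
   makes [alpha] a morphism. *)
have [l lE] : exists l : 'Hom('Hom(P, A), C^o), forall phi, l phi = ltrace (par P \o (f \o phi))%VF.
  by apply: lfun_exists => a u v; rewrite !comp_lfunDr -!comp_lfunZr linearP.
have l_par phi : l (par (ihom P A) phi) = l phi.
  rewrite !lE; have -> : (par P \o (f \o par (ihom P A) phi))%VF = ((f \o phi) \o par P)%VF.
    by apply/lfunP => v; rewrite !comp_lfunE par_ihomE -fpar parK.
  by rewrite ltraceC.
have l_parn i phi : l (parn (ihom P A) i phi) = l phi.
  by case: i; rewrite /parn /parity_pow ?id_lfunE // -/(par _) l_par.
have l_act i x phi : x \in lie_gr g i -> l (mod_act (ihom P A) x phi) = 0.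
  move=> xi; have -> : l (mod_act (ihom P A) x phi) =
      ltrace (par P \o (mod_act P x \o (f \o phi)))%VF -
      ltrace (par P \o (parn P i \o ((f \o phi) \o (parn P i \o mod_act P x))))%VF.
    rewrite lE -linearB /= -comp_lfunNr -comp_lfunDr; congr (ltrace (_ \o _)%VF).
    apply/lfunP => v; rewrite add_lfunE opp_lfunE !comp_lfunE (act_ihomE _ _ xi) linearB /=.
    by rewrite fact (even_parn feven).
  by rewrite ltrace_par_act // subrr.
have [alpha alphaE] : exists alpha : 'Hom(P, ihom (ihom P A) P), forall v, alpha v = rank1 l v.
  by apply: lfun_exists => a u v; apply: rank1P.
have alpha_even : even_morphism alpha.
  apply: even_morphism_homogeneous => [m|i x m xi]; apply/lfunP => phi.
    by rewrite par_ihomE !alphaE !rank1E l_par linearZ.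
  by rewrite (act_ihomE _ _ xi) !alphaE !rank1E l_parn (l_act _ _ _ xi) scale0r linear0 subr0 linearZ.
have FT X : in_F X -> in_F (ihom (ihom P X) P) by move=> FX; do 2!apply: in_F_ihom => //.
have [at_ [at_even at_lift]] := projP _ _ Te alpha (FT _ FB) (FT _ FA) Te_epi alpha_even.
have atE v phi : at_ v (e \o phi)%VF = (l phi : C) *: v.
  have /lfunP/(_ v)/lfunP/(_ phi) := at_lift; rewrite comp_lfunE alphaE rank1E => <-.
  rewrite compressE id_lfunE; congr (at_ v _); apply/lfunP => u.
  by rewrite compressE id_lfunE comp_lfunE.
have [h hE] := lfun_exists (contract_hom_linear at_).
exists h; split.
  apply: even_morphism_homogeneous => [m|i x m xi]; rewrite !hE.
    exact: contract_hom_par at_even m.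
  exact (contract_hom_act at_even m xi).
(* A rank one map with values in the image of [e] factors through [e], so [atE] applies, and each
   term is the supertrace of a rank one map, that is, a coordinate of f a up to sign. The supertrace
   and [parn P p] both contribute (-1)^p, and the two signs cancel. *)
apply: (@parity_ind _ _ A) => p a ap; rewrite comp_lfunE hE.
rewrite (contract_homE at_ (p := p)); last by rewrite -epar ap linearZ.
rewrite [RHS]crd_sum; apply: eq_bigr => i _.
have -> : rank1 (crd i \o parn P p)%VF (e a) = (e \o rank1 (crd i \o parn P p)%VF a)%VF.
  by apply/lfunP => u; rewrite comp_lfunE !rank1E linearZ.
rewrite atE lE; congr (_ *: _).
have -> : (par P \o (f \o rank1 (crd i \o parn P p) a))%VF = rank1 (crd i \o parn P p)%VF (par P (f a)).
  by apply/lfunP => u; rewrite !comp_lfunE !rank1E !linearZ.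
rewrite ltrace_rank1 comp_lfunE -fpar ap linearZ /=; congr (crd i _).
have fap : par P (f a) = (-1) ^+ p *: f a by rewrite -fpar ap linearZ.
rewrite linearZ /= (parn_homogeneous _ fap) scalerA /ksign andbb.
by rewrite -expr2 sqrr_sign scale1r.
Qed.

(** * Injective objects are projective *)

Section InjectiveProjective.
Variables (C : numClosedFieldType) (g : lieSuperalgebra C) (P A : supermodule g).

Lemma lfun_evalE (U V : vectType C) (w : U) (f : 'Hom(U, V)) : linfun (@lfun_eval C U V w) f = f w.
Proof. exact: lfunE. Qed.

(** The pure tensors w (x) v (x) l of Hom(Hom(P,X),P), read as P (x) P (x) X^* up to signs. *)
Definition eval_tensor (X : supermodule g) (l : 'Hom(X, C^o)) (w v : P) : 'Hom('Hom(P, X), P) :=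
  rank1 (l \o linfun (@lfun_eval C P X w))%VF v.

Lemma eval_tensorE (X : supermodule g) (l : 'Hom(X, C^o)) (w v : P) f :
  eval_tensor l w v f = (l (f w) : C) *: v.
Proof. by rewrite /eval_tensor rank1E comp_lfunE lfun_evalE. Qed.

Variable bt : 'Hom(ihom (ihom P A) P, P).
Hypothesis bt_even : even_morphism bt.

Let bt_tensorP a l w u v : bt (eval_tensor l w (a *: u + v)) =
  a *: bt (eval_tensor l w u) + bt (eval_tensor l w v).
Proof. by rewrite /eval_tensor rank1P linearP. Qed.

Let bt_tensorPw a l w u v : bt (eval_tensor l (a *: w + u) v) =
  a *: bt (eval_tensor l w v) + bt (eval_tensor l u v).
Proof.
rewrite -linearP; congr (bt _); apply/lfunP => f.
rewrite [RHS]add_lfunE scale_lfunE !eval_tensorE !linearP /=.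
by rewrite scalerDl scalerA.
Qed.

Let bt_tensorPl a l l' w v : bt (eval_tensor (a *: l + l') w v) =
  a *: bt (eval_tensor l w v) + bt (eval_tensor l' w v).
Proof.
rewrite -linearP; congr (bt _); apply/lfunP => f.
rewrite [RHS]add_lfunE scale_lfunE !eval_tensorE add_lfunE scale_lfunE.
by rewrite scalerDl scalerA.
Qed.

(** The value of [bt] is contracted against the factor [w] of the tensor, with [S] inserted on the
    contracted copy of P; [v] and [l] stay free. *)
Definition partial_trace (S : 'End(P)) (v : P) (l : 'Hom(A, C^o)) : C :=
  \sum_i (crd i (S (bt (eval_tensor l (bas i) v))) : C).

Lemma partial_tracePl S v a l l' :
  partial_trace S v (a *: l + l') = a * partial_trace S v l + partial_trace S v l'.
Proof.
rewrite /partial_trace mulr_sumr -big_split; apply: eq_bigr => i _ /=.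
by rewrite bt_tensorPl !linearP.
Qed.

Lemma partial_trace_move (S N : 'End(P)) v l :
  \sum_i (crd i (S (bt (eval_tensor l (N (bas i)) v))) : C) = partial_trace (N \o S)%VF v l.
Proof.
rewrite (contraction (U := C^o) (B := fun w k => k (S (bt (eval_tensor l w v))))).
- by apply: eq_bigr => i _; rewrite !comp_lfunE.
- by move=> a u w k; rewrite bt_tensorPw !linearP.
- by move=> a u k k'; rewrite add_lfunE scale_lfunE.
Qed.

(** As a function of [l] the partial trace is a linear functional on the dual of A, hence a vector
    of A, written here in coordinates. *)
Definition cocontract (S : 'End(P)) (v : P) : A := \sum_j partial_trace S v (crd j) *: bas j.

Lemma cocontract_move (X : supermodule g) S v (R : 'Hom(A, X)) :
  \sum_j partial_trace S v (crd j \o R)%VF *: bas j = R (cocontract S v).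
Proof.
rewrite /cocontract linear_sum -(contraction (B := fun u l => partial_trace S v l *: u)).
- by apply: eq_bigr => j _; rewrite linearZ.
- by move=> a u w l; rewrite scalerDr !scalerA mulrC.
- by move=> a u l l'; rewrite partial_tracePl scalerDl scalerA.
Qed.

Lemma partial_tracePv S l a u v :
  partial_trace S (a *: u + v) l = a * partial_trace S u l + partial_trace S v l.
Proof.
rewrite /partial_trace mulr_sumr -big_split; apply: eq_bigr => i _ /=.
by rewrite bt_tensorP !linearP.
Qed.

Lemma cocontract_linear S : linear (cocontract S).
Proof.
move=> a u v; rewrite /cocontract scaler_sumr -big_split; apply: eq_bigr => j _ /=.
by rewrite partial_tracePv scalerDl scalerA.
Qed.

Lemma cocontract0 S : cocontract S 0 = 0.
Proof. by have := cocontract_linear S (-1) 0 0; rewrite scaler0 addr0 scaleN1r addNr. Qed.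

Lemma cocontract_scale S a v : cocontract S (a *: v) = a *: cocontract S v.
Proof. by rewrite -[a *: v]addr0 cocontract_linear cocontract0 addr0. Qed.

Lemma cocontract_scalel S a v : cocontract (a *: S) v = a *: cocontract S v.
Proof.
rewrite /cocontract scaler_sumr; apply: eq_bigr => j _; rewrite scalerA; congr (_ *: _).
by rewrite /partial_trace mulr_sumr; apply: eq_bigr => i _; rewrite scale_lfunE linearZ.
Qed.

Lemma cocontract_par (S : 'End(P)) v :
  cocontract (S \o par P)%VF v = par A (cocontract (par P \o S)%VF (par P v)).
Proof.
rewrite -cocontract_move /cocontract; apply: eq_bigr => j _; congr (_ *: _).
rewrite -(partial_trace_move S (par P)); apply: eq_bigr => i _; congr (crd i _).
rewrite comp_lfunE; congr (S _); have /even_morphismP[<- _] := bt_even.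
congr (bt _); apply/lfunP => f.
by rewrite par_ihomE !eval_tensorE comp_lfunE par_ihomE linearZ.
Qed.

Lemma cocontract_act i x (S : 'End(P)) v : x \in lie_gr g i ->
  cocontract (S \o mod_act P x)%VF v = cocontract S (mod_act P x v)
  - parn A i (mod_act A x (cocontract (parn P i \o S)%VF (parn P i v)))
  + (-1) ^+ i *: cocontract (mod_act P x \o S)%VF (parn P i v).
Proof.
move=> xi; rewrite -comp_lfunE -cocontract_move /cocontract scaler_sumr -sumrB -big_split.
apply: eq_bigr => j _ /=; rewrite scalerA -scalerBl -scalerDl; congr (_ *: _).
rewrite -(partial_trace_move S (parn P i)) -(partial_trace_move S (mod_act P x)).
rewrite /partial_trace mulr_sumr -sumrB -big_split.
apply: eq_bigr => k _ /=; rewrite comp_lfunE; have /even_morphismP[_ <-] := bt_even.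
have linZ (U V : vectType C) (h : 'Hom(U, V)) c u : h (c *: u) = c *: h u by rewrite linearZ.
have -> : mod_act (ihom (ihom P A) P) x (eval_tensor (crd j) (bas k) v) =
    (- 1) *: eval_tensor (crd j \o (parn A i \o mod_act A x))%VF (parn P i (bas k)) (parn P i v) +
    ((-1) ^+ i *: eval_tensor (crd j) (mod_act P x (bas k)) (parn P i v) +
     eval_tensor (crd j) (bas k) (mod_act P x v)).
  apply/lfunP => f; rewrite (act_ihomE _ _ xi) !add_lfunE !scale_lfunE !eval_tensorE !comp_lfunE.
  rewrite parn_ihom (act_ihomE _ _ xi) linearB /= parnK.
  rewrite (parn_act _ _ xi) parnK !linZ linearB /= linZ.
  rewrite /ksign andbb scaleN1r scalerBl opprB scalerA addrA [RHS]addrC.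
  by congr (_ - _); apply: addrC.
rewrite !linearP /=; set a1 := crd k _; set a2 := crd k _; set a3 := crd k _.
have -> : -1 *: a1 + ((-1) ^+ i *: a2 + a3) = - (a1 : C) + ((-1) ^+ i * (a2 : C) + a3).
  by rewrite scaleN1r.
by rewrite [LHS]addrC -addrA [RHS]addrC.
Qed.

(** On v of degree p this is (-1)^p times the contraction with S = [parn P p]. The prefactor
    compensates the sign (-1)^p by which that [S] acts on v itself when the composite with [e] is
    computed. *)
Definition cocontract_hom (v : P) : A :=
  cocontract \1%VF (par_proj P false v) - cocontract (par P) (par_proj P true v).

Lemma cocontract_hom_linear : linear cocontract_hom.
Proof.
move=> a u v; rewrite /cocontract_hom !linearP !cocontract_linear scalerBr.
by rewrite opprD addrACA.
Qed.

Lemma cocontract_homE (p : bool) v : par P v = (-1) ^+ p *: v ->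
  cocontract_hom v = (-1) ^+ p *: cocontract (parn P p) v.
Proof.
move=> vp; rewrite /cocontract_hom !(par_proj_id _ vp).
case: p {vp}; rewrite /= cocontract0 ?subr0 ?sub0r ?expr0 ?expr1 ?scale1r //.
by rewrite scaleN1r.
Qed.

Lemma cocontract_parity (p : bool) v : par P v = (-1) ^+ p *: v ->
  par A (cocontract (parn P p) v) = (-1) ^+ p *: cocontract (parn P p) v.
Proof.
move=> vp; have := cocontract_par (parn P p \o par P)%VF v.
have -> : ((parn P p \o par P) \o par P)%VF = parn P p.
  by apply/lfunP => u; rewrite !comp_lfunE parK.
have -> : (par P \o (parn P p \o par P))%VF = parn P p.
  by apply/lfunP => u; rewrite !comp_lfunE; case: (p); rewrite /parn /parity_pow ?id_lfunE ?parK.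
rewrite vp cocontract_scale linearZ /= => {2}->.
by rewrite scalerA -expr2 sqrr_sign scale1r.
Qed.

Lemma cocontract_hom_par v : cocontract_hom (par P v) = par A (cocontract_hom v).
Proof.
have [h hE] := lfun_exists cocontract_hom_linear; rewrite -!hE -!comp_lfunE; congr (fun_of_lfun _ v).
apply: parity_ind => p {}v vp; rewrite !comp_lfunE vp linearZ /= !hE (cocontract_homE vp).
by rewrite [RHS]linearZ /= cocontract_parity.
Qed.

Lemma cocontract_hom_act (i : bool) x v : x \in lie_gr g i ->
  cocontract_hom (mod_act P x v) = mod_act A x (cocontract_hom v).
Proof.
move=> xi; have [h hE] := lfun_exists cocontract_hom_linear.
rewrite -!hE -!comp_lfunE; congr (fun_of_lfun _ v).
apply: parity_ind => p {}v vp; rewrite !comp_lfunE !hE (cocontract_homE vp).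
rewrite (cocontract_homE (act_homogeneous xi vp)) linearZ /=.
(* The degree of x v determines [S]. With it the left side and the last term of [cocontract_act]
   agree by [s1], and [s2] collects the remaining signs. *)
have := cocontract_act (parn P (i (+) p)) v xi.
have -> : (parn P i \o parn P (i (+) p))%VF = parn P p.
  by apply/lfunP => u; rewrite comp_lfunE -parn_addb addbA addbb addFb.
have -> : (parn P (i (+) p) \o mod_act P x)%VF =
    ksign C (i (+) p) i *: (mod_act P x \o parn P (i (+) p))%VF.
  by apply/lfunP => u; rewrite scale_lfunE !comp_lfunE (parn_act _ _ xi).
rewrite (parn_homogeneous _ vp) !cocontract_scale cocontract_scalel !linearZ /=.
have xp := act_homogeneous xi (cocontract_parity vp).
rewrite (parn_homogeneous _ xp) scalerA.
have s1 : ksign C (i (+) p) i = ksign C i p * (-1) ^+ i.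
  by rewrite /ksign; case: (i); case: (p); rewrite /= ?expr0 ?expr1 ?mulr1 ?mulrNN ?mul1r ?mulr1.
have s2 : ksign C i p * ksign C i (i (+) p) = (-1) ^+ i.
  by rewrite /ksign; case: (i); case: (p); rewrite /= ?expr0 ?expr1 ?mulr1 ?mul1r.
rewrite s1 scalerN scalerA s2 -[X in X = _]add0r => /addIr/esym/eqP.
rewrite subr_eq0 => /eqP->; rewrite scalerA -signr_addb.
by rewrite addbAC addbb addFb.
Qed.
End InjectiveProjective.

Theorem injective_projective (C : numClosedFieldType) (g : lieSuperalgebra C) (P : supermodule g) :
  in_F P -> injective_F P -> projective_F P.
Proof.
move=> FP injP A B e f FA FB eepi feven.
have es := epi_F_surjective FB eepi; have ee := eepi.1.
have [epar eact] := (even_morphismP e).1 ee; have [fpar fact] := (even_morphismP f).1 feven.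
pose Te := ihom_pre P (ihom_post P e).
have Te_mono : mono_F Te.
  apply: injective_mono_F; first exact: ihom_pre_even (ihom_post_even _ ee).
  exact: ihom_pre_injective (ihom_post_surjective es).
have [beta betaE] : exists beta : 'Hom(ihom (ihom P B) P, P), forall F, beta F = F f.
  by apply: lfun_exists => a F F'; rewrite add_lfunE scale_lfunE.
have f_par : par (ihom P B) f = f.
  by apply/lfunP => v; rewrite par_ihomE fpar parK.
(* Evaluation at [f] is a morphism because f is an even and invariant element of the internal
   Hom. *)
have beta_even : even_morphism beta.
  apply: even_morphism_homogeneous => [F|i x F xi]; rewrite !betaE.
    by rewrite par_ihomE f_par.
  rewrite (act_ihomE _ _ xi); have -> : mod_act (ihom P B) x f = 0; last first.
    by rewrite !linear0 ?subr0 ?addr0.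
  apply/lfunP => v; rewrite (act_ihomE _ _ xi) zero_lfunE (even_parn feven) parnK.
  by rewrite fact subrr.
have FT X : in_F X -> in_F (ihom (ihom P X) P) by move=> FX; do 2!apply: in_F_ihom => //.
have [bt [bt_even bt_ext]] := injP _ _ Te beta (FT _ FB) (FT _ FA) Te_mono beta_even.
have btE (F : 'Hom('Hom(P, B), P)) : bt (Te F) = F f.
  by have /lfunP/(_ F) := bt_ext; rewrite comp_lfunE betaE.
have [h hE] := lfun_exists (cocontract_hom_linear bt).
exists h; split.
  apply: even_morphism_homogeneous => [m|i x m xi]; rewrite !hE.
    exact (cocontract_hom_par bt_even m).
  exact (cocontract_hom_act bt_even m xi).
(* A functional that factors through [e] gives a tensor in the image of [Te], where [bt] is
   evaluation at [f]. Summing over the contracted basis reassembles f (S v). *)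
have eD S v : e (cocontract bt S v) = f (S v).
  rewrite -cocontract_move [RHS]crd_sum; apply: eq_bigr => k _; congr (_ *: _).
  rewrite [in RHS](crd_sum (S v)) !linear_sum; apply: eq_bigr => i _.
  have -> : eval_tensor (crd k \o e)%VF (bas i) v = Te (eval_tensor (crd k) (bas i) v).
    apply/lfunP => phi; rewrite /Te [RHS]compressE id_lfunE !eval_tensorE comp_lfunE.
    by rewrite compressE id_lfunE.
  by rewrite btE eval_tensorE !linearZ /=; apply: mulrC.
apply: (@parity_ind _ _ P) => p v vp; rewrite comp_lfunE hE (cocontract_homE bt vp).
rewrite linearZ /= eD (parn_homogeneous _ vp) linearZ /= scalerA /ksign andbb.
by rewrite -expr2 sqrr_sign scale1r.
Qed.

Theorem proposition2p2p2 (R : realType) (g : lieSuperalgebra R[i])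
    (hg : classical g) (M : supermodule g) (hM : in_F M) :
  projective_F M <-> injective_F M.
Proof.
split; [exact: projective_injective hM | exact: injective_projective hM].
Qed.
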